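(* Let $G$ be $SO(3)$ or $SL(2,\mathbb{R})$, endowed with a nonzero Poisson-Lie structure $\Pi_G$, and let $H\subset G$ be a closed connected Lie subgroup with $\dim(G/H)=2$ such that $(G/H,\Pi)$ is a coisotropic Poisson homogeneous space of $(G,\Pi_G)$. Then $(G/H,\Pi)$ is not unimodular.
   Context: A Poisson-Lie structure on a Lie group $G$ is a Poisson bivector $\Pi_G$ for which multiplication $G\times G\to G$ is a Poisson map. $(G/H,\Pi)$ is a coisotropic Poisson homogeneous space (coisotropic Poisson quotient) of $(G,\Pi_G)$ if $\Pi$ is a Poisson structure on $G/H$ such that the action $(G,\Pi_G)\times(G/H,\Pi)\to(G/H,\Pi)$, $(g,g'H)\mapsto gg'H$, is Poisson and the projection $q:(G,\Pi_G)\to(G/H,\Pi)$ is a Poisson map. For a Poisson manifold $(M,\pi)$, $X_h^\pi=i_{dh}\pi$, and the modular vector field $\mathcal{M}_\nu^\pi$ of a volume form $\nu$ is the unique vector field with $\mathcal{L}_{X_h^\pi}\nu=\mathcal{M}_\nu^\pi(h)\,\nu$ for all $h\in C^\infty(M)$. An orientable Poisson manifold $(M,\pi)$ is unimodular if $\mathcal{M}_\nu^\pi$ is a Hamiltonian vector field for some (equivalently, any) volume form $\nu$; equivalently, if some volume form is preserved by all Hamiltonian vector fields. *)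

(* Defs.v *)
From HB Require Import structures.
From mathcomp Require Import all_boot all_order all_algebra.
From mathcomp Require Import all_classical all_reals all_analysis.

Set Implicit Arguments.
Unset Strict Implicit.
Unset Printing Implicit Defensive.

Import Order.TTheory GRing.Theory Num.Theory.
Import numFieldNormedType.Exports.

Local Open Scope classical_set_scope.
Local Open Scope ring_scope.

(* MathComp-Analysis, over an arbitrary [R : realType].

   A smooth manifold [M] is represented by its points and the algebra
   C^oo(M) of its smooth real functions.  Tangent vectors are point
   derivations of C^oo(M), and vector fields are derivations of C^oo(M).
   Operators are total on [M -> R], but only their values on smooth functions
   are meaningful; all conditions below are restricted to those. *)

Fixpoint Ck (R : realType) (V : normedModType R) (k : nat) (f : V -> R) : Prop :=
  if k is j.+1 then
    continuous f /\
    forall v, (forall x, derivable f x v) /\ Ck j (fun x => 'D_v f x)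
  else continuous f.

Definition Coo (R : realType) (V : normedModType R) (f : V -> R) : Prop :=
  forall k, Ck k f.

Record manifold (R : realType) := Manifold {
  points :> Type;
  smooth : set (points -> R)
}.

Section PoissonManifolds.
Context {R : realType}.

Definition functional (S : Type) := (S -> R) -> R.
Definition operator (S : Type) := (S -> R) -> (S -> R).
Definition bracket (S : Type) := (S -> R) -> (S -> R) -> (S -> R).
Definition pre_form (S : Type) := S -> functional S -> functional S -> R.

Section Calculus.
Variable M : manifold R.

Definition tangent (p : M) (v : functional M) : Prop :=
  (forall (a : R) (f g : M -> R), smooth f -> smooth g ->
     v (fun x => a * f x + g x) = a * v f + v g) /\
  (forall f g : M -> R, smooth f -> smooth g ->
     v (fun x => f x * g x) = v f * g p + f p * v g).

Definition at_point (X : operator M) (p : M) : functional M :=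
  fun f => X f p.

Definition vector_field (X : operator M) : Prop :=
  (forall f, smooth f -> smooth (X f)) /\ (forall p, tangent p (at_point X p)).

Definition commutator (X Y : operator M) : operator M :=
  fun f p => X (Y f) p - Y (X f) p.

(* A bivector field [pi] is given by its values [pi f g] = pi(df, dg). *)
Definition bivector (pi : bracket M) : Prop :=
  (forall f g, smooth f -> smooth g -> forall p, pi f g p = - pi g f p) /\
  (forall f, smooth f -> vector_field (pi f)).

Definition poisson (pi : bracket M) : Prop :=
  bivector pi /\
  forall f g h, smooth f -> smooth g -> smooth h -> forall p,
    pi f (pi g h) p + pi g (pi h f) p + pi h (pi f g) p = 0.

Definition nonzero_bivector (pi : bracket M) : Prop :=
  exists f g p, [/\ smooth f, smooth g & pi f g p <> 0].

(* X_h = i_{dh} pi, that is, X_h(f) = pi(dh, df). *)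
Definition hamiltonian_field (pi : bracket M) (h : M -> R) : operator M := pi h.

Definition is_hamiltonian (pi : bracket M) (X : operator M) : Prop :=
  exists2 h, smooth h &
    forall f, smooth f -> forall p, X f p = hamiltonian_field pi h f p.

Definition eval_form (nu : pre_form M) (X Y : operator M) : M -> R :=
  fun p => nu p (at_point X p) (at_point Y p).

(* Second condition: [nu p] is a function of the tangent vectors, i.e. it does
   not see how the operators representing them act on non-smooth functions. *)
Definition two_form (nu : pre_form M) : Prop :=
  [/\ forall X Y, vector_field X -> vector_field Y -> smooth (eval_form nu X Y),
      forall p u v w, tangent p u -> tangent p v -> tangent p w ->
        (forall f, smooth f -> u f = v f) -> nu p u w = nu p v w,
      forall p (a : R) u v w, tangent p u -> tangent p v -> tangent p w ->
        nu p (fun f => a * u f + v f) w = a * nu p u w + nu p v w &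
      forall p u v, tangent p u -> tangent p v -> nu p u v = - nu p v u].

(* On a manifold of dimension 2, a volume form is a nowhere vanishing 2-form. *)
Definition volume_form (nu : pre_form M) : Prop :=
  two_form nu /\
  forall p, exists u v, [/\ tangent p u, tangent p v & nu p u v <> 0].

(* (L_X nu)(Y, Z) *)
Definition lie_derivative (X : operator M) (nu : pre_form M)
    (Y Z : operator M) : M -> R :=
  fun p => X (eval_form nu Y Z) p - eval_form nu (commutator X Y) Z p
           - eval_form nu Y (commutator X Z) p.

(* [D] is the modular vector field of [pi] with respect to [nu]:
   L_{X_h} nu = D(h) nu for all smooth h. *)
Definition modular_field (pi : bracket M) (nu : pre_form M) (D : operator M) : Prop :=
  vector_field D /\
  forall h, smooth h -> forall Y Z, vector_field Y -> vector_field Z ->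
    forall p, lie_derivative (hamiltonian_field pi h) nu Y Z p
              = D h p * eval_form nu Y Z p.

(* Unimodularity of a Poisson manifold of dimension 2; the existence of [nu]
   includes orientability. *)
Definition unimodular (pi : bracket M) : Prop :=
  exists nu D,
    [/\ volume_form nu, modular_field pi nu D & is_hamiltonian pi D].

End Calculus.

(* The product Poisson structure on [M * N]. *)
Definition prod_bivector (M N : manifold R)
    (piM : bracket M) (piN : bracket N) : bracket (M * N) :=
  fun F K z => piM (fun x => F (x, z.2)) (fun x => K (x, z.2)) z.1
             + piN (fun y => F (z.1, y)) (fun y => K (z.1, y)) z.2.

(* The bracket condition for a smooth map [phi : S -> N] to be Poisson; it is
   used below for the multiplication of a Lie group, the action on a
   homogeneous space and the quotient map, all of which are smooth. *)
Definition poisson_map (S : Type) (N : manifold R)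
    (piS : bracket S) (piN : bracket N)
    (phi : S -> N) : Prop :=
  forall f g, smooth f -> smooth g -> forall s,
    piS (fun x => f (phi x)) (fun x => g (phi x)) s = piN f g (phi s).

End PoissonManifolds.

Record matrix_group (R : realType) (n : nat) := MatrixGroup {
  carrier :> set 'M[R]_n;
  carrier_unit : forall A, carrier A -> A \in unitmx;
  carrier1 : carrier 1%:M;
  carrierM : forall A B, carrier A -> carrier B -> carrier (A *m B);
  carrierV : forall A, carrier A -> carrier (invmx A)
}.

Section Groups.
Variables (R : realType) (n : nat).

Definition SL_set : set 'M[R]_n := [set A | \det A = 1].

Definition SO_set : set 'M[R]_n := [set A | A *m A^T = 1%:M /\ \det A = 1].

Lemma SL_unit A : SL_set A -> A \in unitmx.
Proof. by rewrite /SL_set /= unitmxE => ->; rewrite unitr1. Qed.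

Lemma SL_one : SL_set 1%:M. Proof. exact: det1. Qed.

Lemma SL_mul A B : SL_set A -> SL_set B -> SL_set (A *m B).
Proof. by rewrite /SL_set /= det_mulmx => -> ->; rewrite mulr1. Qed.

Lemma SL_inv A : SL_set A -> SL_set (invmx A).
Proof. by rewrite /SL_set /= det_inv => ->; rewrite invr1. Qed.

Definition SL : matrix_group R n := MatrixGroup SL_unit SL_one SL_mul SL_inv.

Lemma SO_unit A : SO_set A -> A \in unitmx.
Proof. by case=> _; exact: SL_unit. Qed.

Lemma SO_one : SO_set 1%:M.
Proof. by split; [rewrite trmx1 mulmx1 | exact: det1]. Qed.

Lemma SO_mul A B : SO_set A -> SO_set B -> SO_set (A *m B).
Proof.
move=> [oA dA] [oB dB]; split; last exact: SL_mul.
by rewrite trmx_mul mulmxA -(mulmxA A) oB mulmx1.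
Qed.

Lemma SO_inv A : SO_set A -> SO_set (invmx A).
Proof.
move=> SA; have uA := SO_unit SA; case: SA => [oA dA].
split; last exact: SL_inv.
have -> : invmx A = A^T by rewrite -[RHS](mulKmx uA) oA mulmx1.
by rewrite trmxK; exact: mulmx1C.
Qed.

Definition SO : matrix_group R n := MatrixGroup SO_unit SO_one SO_mul SO_inv.

(* The velocities of the one-parameter subgroups of [G]. *)
Definition lie_algebra (G : matrix_group R n) : set 'M[R]_n :=
  [set X | exists phi : R -> 'M[R]_n,
    [/\ forall s t, phi (s + t) = phi s *m phi t,
        forall t, carrier G (phi t) &
        is_derive (0 : R) (1 : R) phi X]].

(* dim (G / H) = d, for a closed subgroup [H] of [G] *)
Definition quotient_dim (G H : matrix_group R n) (d : nat) : Prop :=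
  exists V W : {vspace 'M[R]_n},
    [/\ forall X, lie_algebra G X <-> X \in V,
        forall X, lie_algebra H X <-> X \in W &
        \dim V = (\dim W + d)%N].

(* For [G] closed in the space of matrices, the smooth functions on [G] are the
   restrictions of the smooth functions on that space. *)
Definition group_manifold (G : matrix_group R n) : manifold R :=
  @Manifold R G
    [set f | exists2 F : 'M[R]_n -> R, Coo F & forall x : G, f x = F (val x)].

Definition gmul (G : matrix_group R n) (x y : G) : G :=
  exist _ (val x *m val y)
    (mem_set (carrierM (set_mem (valP x)) (set_mem (valP y)))).

Definition lcoset (G H : matrix_group R n) (g : G) : set G :=
  [set x | carrier H (invmx (val g) *m val x)].

Definition coset_space (G H : matrix_group R n) : Type := range (@lcoset G H).

Definition coset_map (G H : matrix_group R n) (g : G) : coset_space G H :=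
  exist _ (lcoset H g) (mem_set (imageT (@lcoset G H) g)).

(* For [H] closed, the quotient map is a submersion, so a function on [G / H]
   is smooth if and only if its pullback to [G] is. *)
Definition quotient_manifold (G H : matrix_group R n) : manifold R :=
  @Manifold R (coset_space G H)
    [set f | @smooth R (group_manifold G) (fun g => f (coset_map H g))].

Lemma translate_lcoset (G H : matrix_group R n) (g a : G) :
  gmul g @` lcoset H a = lcoset H (gmul g a).
Proof.
have ug := carrier_unit (set_mem (valP g)).
have ua := carrier_unit (set_mem (valP a)).
have uga : val g *m val a \in unitmx by rewrite unitmx_mul ug.
have invM : invmx (val g *m val a) = invmx (val a) *m invmx (val g).
  rewrite -[RHS](mulmxK uga) mulmxA.
  by rewrite -(mulmxA (invmx _)) mulVmx // mulmx1 mulVmx // mul1mx.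
have Gg := set_mem (valP g).
apply/seteqP; split=> [_ [y Hy <-]|x]; rewrite /lcoset /= invM.
  by rewrite -mulmxA mulKmx.
move=> Hx; pose g' : G := exist _ (invmx (val g)) (mem_set (carrierV Gg)).
exists (gmul g' x); first by rewrite /lcoset /= mulmxA.
by apply: val_inj; rewrite /= mulKVmx.
Qed.

Lemma range_lcoset (G H : matrix_group R n) (g : G) (S : set G) :
  range (@lcoset G H) S -> range (@lcoset G H) (gmul g @` S).
Proof. by case=> a _ <-; exists (gmul g a); rewrite ?translate_lcoset. Qed.

Definition coset_act (G H : matrix_group R n) (g : G) (S : coset_space G H) :
    coset_space G H :=
  exist _ (gmul g @` val S) (mem_set (range_lcoset g (set_mem (valP S)))).

Lemma coset_actE (G H : matrix_group R n) (g a : G) :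
  coset_act g (coset_map H a) = coset_map H (gmul g a).
Proof. by apply: val_inj; rewrite /= translate_lcoset. Qed.

Definition poisson_lie (G : matrix_group R n)
    (piG : @bracket R (group_manifold G)) : Prop :=
  poisson piG /\
  poisson_map (prod_bivector piG piG) piG
    (fun z : group_manifold G * group_manifold G => gmul z.1 z.2).

Definition coisotropic_homogeneous (G H : matrix_group R n)
    (piG : @bracket R (group_manifold G))
    (pi : @bracket R (quotient_manifold G H)) : Prop :=
  [/\ poisson pi,
      poisson_map (prod_bivector piG pi) pi
        (fun z : group_manifold G * quotient_manifold G H =>
           coset_act z.1 z.2) &
      poisson_map piG pi
        (fun g : group_manifold G => coset_map H g)].

End Groups.

(* Main.v *)
Require Import Defs.
From HB Require Import structures.
From mathcomp Require Import all_boot all_order all_algebra.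
From mathcomp Require Import all_classical all_reals all_analysis.
From mathcomp Require Import ring lra.

Set Implicit Arguments.
Unset Strict Implicit.
Unset Printing Implicit Defensive.

Import Order.TTheory GRing.Theory Num.Theory.
Import numFieldNormedType.Exports.

Local Open Scope classical_set_scope.
Local Open Scope ring_scope.

(** If a volume form nu has Hamiltonian modular field X_k, write Pi = F nu^-1.
    Then exp(k) F is annihilated by all Hamiltonian vector fields, hence locally
    constant where Pi <> 0, so (F exp(k))^2 has zero differential everywhere and
    is constant on G / H.  A Poisson-Lie structure vanishes at the unit, so
    F(eH) = 0 and therefore Pi = 0.  By multiplicativity, the functions invariant
    under right translation by any conjugate y H y^-1 then commute for Pi_G, so
    that Pi_G(x), read in Lambda^2 g = g^*, annihilates the Lie algebra of every
    y H y^-1; these span the simple algebra g, hence Pi_G = 0.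

    In terms of derivations, the tangent spaces of G and G / H are computed from
    Hadamard's lemma and explicit local sections of G -> G / H.  The sections
    require knowing H exactly: up to conjugation it is the connected centralizer
    of a companion matrix in SL(2), or the group of rotations about an axis in
    SO(3). *)

(** * Smooth functions and Hadamard's lemma *)

(** The density F is picked point by point from Pi and nu, so nothing says that it is smooth. Near a
    given point it is written m / E with E = Y(a) and m = - nu(X_a, Y) smooth, where Y comes from
    the action of G and Y(a) does not vanish there; only m and E are ever differentiated. The square
    answers the zeros of F: the identity for dF is obtained by cancelling a nonzero bracket, while
    where F = 0 the derivative of F^2 vanishes by itself.

    In the last step let w span the Lie algebra of H and let w' run through its conjugates. The
    functions z |-> tr (A z w' z^-1) supply enough invariants: their differentials are covectors of
    the form [w', A], and Pi_G on two such covectors is l(w') times a coefficient linear in w',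
    where l in g^* represents Pi_G(x). Since w' <> 0, some coefficient is nonzero, so l kills the
    whole orbit of w. *)

Section SmoothFunctions.
Context {R : realType} {V : normedModType R}.
Implicit Types (f g : V -> R) (k : nat).

Lemma CkW k f : Ck k.+1 f -> Ck k f.
Proof.
elim: k f => [|k IH] f [cf df]; first exact: cf.
by split=> // v; have [dv Dv] := df v; split=> //; exact: IH.
Qed.

Lemma Coo_continuous f : Coo f -> continuous f.
Proof. by move/(_ 0%N). Qed.

Lemma Coo_derivable f : Coo f -> forall x v, derivable f x v.
Proof. by case/(_ 1%N) => _ df x v; have [] := df v. Qed.

Arguments Coo_derivable {f}.

Lemma Coo_derive f v : Coo f -> Coo (fun x => 'D_v f x).
Proof. by move=> cf k; have [_ /(_ v) []] := cf k.+1. Qed.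

Lemma CkD k f g : Ck k f -> Ck k g -> Ck k (fun x => f x + g x).
Proof.
elim: k f g => [|k IH] f g.
  by move=> cf cg x; exact: (cvgD (cf x) (cg x)).
move=> [cf df] [cg dg]; split=> [x|v]; first exact: (cvgD (cf x) (cg x)).
have [dfv Df] := df v; have [dgv Dg] := dg v.
split=> [x|]; first exact: (derivableD (dfv x) (dgv x)).
rewrite (_ : (fun x => _) = (fun x => 'D_v f x + 'D_v g x)); first exact: IH.
by apply/funext => x; exact: (deriveD (dfv x) (dgv x)).
Qed.

Lemma CkM k f g : Ck k f -> Ck k g -> Ck k (fun x => f x * g x).
Proof.
elim: k f g => [|k IH] f g.
  by move=> cf cg x; exact: (cvgM (cf x) (cg x)).
move=> hf hg; have [cf df] := hf; have [cg dg] := hg.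
split=> [x|v]; first exact: (cvgM (cf x) (cg x)).
have [dfv Df] := df v; have [dgv Dg] := dg v.
split=> [x|]; first exact: (derivableM (dfv x) (dgv x)).
rewrite (_ : (fun x => _) = (fun x => f x * 'D_v g x + g x * 'D_v f x)).
  by apply: CkD; apply: IH => //; exact: CkW.
by apply/funext => x; exact: (deriveM (dfv x) (dgv x)).
Qed.

Lemma Coo_cst (c : R) : Coo (fun _ : V => c).
Proof.
move=> k; elim: k c => [|k IH] c; first by move=> x; exact: cvg_cst.
split=> [x|v]; first exact: cvg_cst.
split=> [x|]; first exact: derivable_cst.
have -> : (fun x => 'D_v (fun _ : V => c) x) = (fun=> 0).
  by apply/funext => x; exact: derive_cst.
exact: IH.
Qed.

Lemma CooD f g : Coo f -> Coo g -> Coo (fun x => f x + g x).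
Proof. by move=> cf cg k; exact: CkD. Qed.

Lemma CooM f g : Coo f -> Coo g -> Coo (fun x => f x * g x).
Proof. by move=> cf cg k; exact: CkM. Qed.

Lemma CooZ (c : R) f : Coo f -> Coo (fun x => c * f x).
Proof. by move=> cf; apply: CooM => //; exact: Coo_cst. Qed.

Lemma CooN f : Coo f -> Coo (fun x => - f x).
Proof.
move=> cf; rewrite (_ : (fun x => _) = (fun x => -1 * f x)); first exact: CooZ.
by apply/funext => x; rewrite mulN1r.
Qed.

Lemma CooB f g : Coo f -> Coo g -> Coo (fun x => f x - g x).
Proof. by move=> cf cg; apply: CooD => //; exact: CooN. Qed.

Lemma Ck_sum k (I : Type) (r : seq I) (P : pred I) (F : I -> V -> R) :
  (forall i, Ck k (F i)) -> Ck k (fun x => \sum_(i <- r | P i) F i x).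
Proof.
move=> cF; elim: r => [|i r IH].
  by under eq_fun do rewrite big_nil; exact: Coo_cst.
under eq_fun do rewrite big_cons.
by case: (P i) => //; exact: CkD.
Qed.

Lemma Coo_sum (I : Type) (r : seq I) (P : pred I) (F : I -> V -> R) :
  (forall i, Coo (F i)) -> Coo (fun x => \sum_(i <- r | P i) F i x).
Proof. by move=> cF k; apply: Ck_sum => i; exact: cF. Qed.

Lemma Coo_prod (I : Type) (r : seq I) (P : pred I) (F : I -> V -> R) :
  (forall i, Coo (F i)) -> Coo (fun x => \prod_(i <- r | P i) F i x).
Proof.
move=> cF; elim: r => [|i r IH].
  by under eq_fun do rewrite big_nil; exact: Coo_cst.
under eq_fun do rewrite big_cons.
by case: (P i) => //; exact: CooM.
Qed.

Lemma is_derive_line f : Coo f -> forall (x v : V) (t : R),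
  is_derive t (1 : R) (fun s : R => f (x + s *: v)) ('D_v f (x + t *: v)).
Proof.
move=> cf x v t; have dv := Coo_derivable cf (x + t *: v) v.
have E : (fun h : R => h^-1 *: (f (x + (h *: 1 + t) *: v) - f (x + t *: v)))
       = (fun h : R => h^-1 *: (f (h *: v + (x + t *: v)) - f (x + t *: v))).
  apply/funext => h; congr (_ *: (f _ - _)).
  by rewrite scaler1 scalerDl addrCA.
apply: DeriveDef; first by rewrite /derivable /= E; exact: dv.
by rewrite /derive /= E.
Qed.

Lemma derive_dirZ f x (v : V) (c : R) : Coo f -> 'D_(c *: v) f x = c * 'D_v f x.
Proof.
move=> cf.
have h1 := is_derive_line cf x (c *: v) 0.
have h2 : is_derive (0 : R) (1 : R) (fun s : R => f (x + s *: (c *: v))) (c * 'D_v f x).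
  have d1 := is_derive_line cf x v (c * 0).
  have d2 : is_derive (0:R) (1:R) (fun s : R => c * s) (c *: (1 : R)) by exact: is_deriveZ.
  have := is_derive1_comp d1 d2.
  rewrite mulr0 scale0r addr0.
  rewrite /GRing.scale /= mulr1 mulrC.
  rewrite (_ : (fun s : R => f (x + s *: (c *: v))) = (fun x0 : R => f (x + x0 *: v)) \o (fun s : R => c * s)) //.
  by apply/funext => s /=; rewrite scalerA mulrC.
have := @derive_val _ _ _ _ _ _ _ h1; rewrite (@derive_val _ _ _ _ _ _ _ h2).
by rewrite scale0r addr0 => ->.
Qed.


(** [Coo] provides directional derivatives only, so additivity in the direction is not built in. The
    increment along h (u + v) is split at x + h u; the mean value theorem on the second segment and
    the continuity of 'D_v f give the limit. *)
Lemma derive_dirD f x (u v : V) : Coo f -> 'D_(u + v) f x = 'D_u f x + 'D_v f x.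
Proof.
move=> cf; apply/cvg_lim => //.
pose q (h : R) := h^-1 *: (f (x + h *: u) - f x) + (h^-1 *: (f (x + h *: (u + v)) - f (x + h *: u))).
rewrite (_ : (fun h => _) = q); last first.
  apply/funext => h /=; rewrite /q -scalerDr; congr (_ *: _).
  by rewrite [h *: (u + v) + x]addrC; lra.
apply: cvgD.
  have := Coo_derivable cf x u; rewrite /derivable /derive /=.
  by under eq_fun do rewrite [_ + x]addrC; move/cvgP.
apply/cvgrPdist_lt => e e0.
have cD := Coo_continuous (Coo_derive v cf).
have /cvgrPdist_lt /(_ e e0) := cD x.
rewrite -nbhs_ballE => -[r /= r0 rP].
have K0 : 0 < `|u| + `|v| + 1 by rewrite ltr_wpDl // addr_ge0.
near=> h.
have h0 : h != 0 by near: h; exact: nbhs_dnbhs_neq.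
have hr : `|h| < r / (`|u| + `|v| + 1).
  by near: h; apply: dnbhs0_lt; rewrite divr_gt0.
(* The mean value theorem is used on [h, 0] or on [0, h] according to the sign of h. *)
have [c ch ->] : exists2 c, `|c| <= `|h| &
    h^-1 *: (f (x + h *: (u + v)) - f (x + h *: u)) = 'D_v f (x + h *: u + c *: v).
  have [h0'|h0'|] := ltgtP h 0; last by move/eqP; rewrite (negbTE h0).
  - have [c] := @MVT R (fun s => f (x + h *: u + s *: v)) (fun s => 'D_v f (x + h *: u + s *: v)) h 0 h0'
      (fun y _ => is_derive_line cf _ _ _) (derivable_within_continuous (fun y _ => @ex_derive _ _ _ _ _ _ _ (is_derive_line cf _ _ _))).
    rewrite in_itv /= => /andP[c1 c2] E; exists c; first by rewrite !ltr0_norm // lerN2 ltW.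
    rewrite scale0r addr0 in E.
    rewrite [h *: (u + v)]scalerDr addrA -[f _ - _]opprB E sub0r mulrN opprK.
    by rewrite /GRing.scale /= mulrC mulfK.
  - have [c] := @MVT R (fun s => f (x + h *: u + s *: v)) (fun s => 'D_v f (x + h *: u + s *: v)) 0 h h0'
      (fun y _ => is_derive_line cf _ _ _) (derivable_within_continuous (fun y _ => @ex_derive _ _ _ _ _ _ _ (is_derive_line cf _ _ _))).
    rewrite in_itv /= => /andP[c1 c2] E; exists c; first by rewrite !gtr0_norm // ltW.
    rewrite scale0r addr0 in E.
    rewrite [h *: (u + v)]scalerDr addrA E subr0.
    by rewrite /GRing.scale /= mulrC mulfK.
apply: rP; rewrite -ball_normE /= -addrA opprD addNKr normrN.
apply: le_lt_trans (ler_normD _ _) _; rewrite !normrZ.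
rewrite ltr_pdivlMr // in hr; apply: le_lt_trans hr.
rewrite !mulrDr mulr1 -addrA lerD2l.
by rewrite -[leLHS]addr0 lerD // ler_wpM2r.
Unshelve. all: by end_near. Qed.

End SmoothFunctions.
Arguments Coo_derivable {R V f}.

Section UnitIntegral.
Context {R : realType}.
Implicit Types h : R -> R.
Local Notation mu := (@lebesgue_measure R).

Definition int01 h : R := \int[mu]_(t in `[0, 1]) h t.

Lemma integrable01 h : continuous h -> mu.-integrable `[0, 1] (EFin \o h).
Proof.
move=> ch; apply: continuous_compact_integrable; first exact: segment_compact.
exact: continuous_subspaceT.
Qed.

Lemma int01_cst (c : R) : int01 (fun=> c) = c.
Proof.
rewrite /int01 Rintegral_cst //= lebesgue_measure_itv /= lte_fin ltr01 /=.
by rewrite oppr0 addr0 mulr1.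
Qed.

Lemma int01B h1 h2 : continuous h1 -> continuous h2 ->
  int01 (fun t => h1 t - h2 t) = int01 h1 - int01 h2.
Proof. by move=> c1 c2; rewrite /int01 RintegralB //; exact: integrable01. Qed.

Lemma int01Z (c : R) h : continuous h -> int01 (fun t => c * h t) = c * int01 h.
Proof. by move=> ch; rewrite /int01 RintegralZl //; exact: integrable01. Qed.

Lemma int01D h1 h2 : continuous h1 -> continuous h2 ->
  int01 (fun t => h1 t + h2 t) = int01 h1 + int01 h2.
Proof. by move=> c1 c2; rewrite /int01 RintegralD //; exact: integrable01. Qed.

Lemma int01_norm_le h (e : R) : continuous h ->
  (forall t, 0 <= t <= 1 -> `|h t| <= e) -> `|int01 h| <= e.
Proof.
move=> ch he; have ih := integrable01 ch.
apply: le_trans (le_normr_Rintegral _ ih) _ => //.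
rewrite -[leRHS]int01_cst; apply: le_Rintegral => //.
- exact: integrable_norm.
- by apply: (@integrable01 (fun=> e)) => t; exact: cvg_cst.
Qed.

Lemma int01_FTC (F f : R -> R) : (forall t : R, is_derive t (1 : R) F (f t)) ->
  continuous f -> int01 f = F 1 - F 0.
Proof.
move=> dF cf; rewrite /int01 /Rintegral.
have cF : continuous F.
  by move=> t; apply: differentiable_continuous; apply/derivable1_diffP; have [] := dF t.
rewrite (@continuous_FTC2 _ f F) ?ltr01 //=.
- exact: continuous_subspaceT.
- split=> [t _| | ]; first by have [] := dF t.
  + exact/cvg_at_right_filter/cF.
  + exact/cvg_at_left_filter/cF.
- by move=> t _; rewrite derive1E; have [] := dF t.
Qed.

End UnitIntegral.

(** * Averages over the segments issuing from a point *)

Section RadialAverage.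
Context {R : realType} {V : normedModType R} (p : V).
Implicit Types (f : V -> R) (m k : nat).

(** The weight t ^+ m closes the family under derivation: each differentiation under the integral
    produces one more factor t, so smoothness follows by induction for all m at once. Hadamard's
    coefficients are the case m = 0. *)
Definition radial m f (x : V) : R := int01 (fun t => t ^+ m * f (p + t *: (x - p))).

Lemma radial_arg_continuous f : continuous f ->
  continuous (fun z : R * V => f (p + z.1 *: (z.2 - p))).
Proof.
move=> cf z; apply: (@continuous_comp _ _ _ (fun z : R * V => p + z.1 *: (z.2 - p)) f).
  apply: cvgD; first exact: cvg_cst.
  by apply: cvgZ; [exact: cvg_fst|apply: cvgB; [exact: cvg_snd|exact: cvg_cst]].
exact: cf.
Qed.

Lemma radial_integrand_continuous m f (x : V) : continuous f ->
  continuous (fun t : R => t ^+ m * f (p + t *: (x - p))).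
Proof.
move=> cf t; apply: cvgM; first exact: exprn_continuous.
apply: (@continuous_comp _ _ _ (fun t : R => p + t *: (x - p)) f); last exact: cf.
apply: cvgD; first exact: cvg_cst.
by apply: cvgZr_tmp; exact: cvg_id.
Qed.

(** Compactness of [0, 1] makes the estimate uniform in t, which passing to the limit under the
    integral requires. *)
Lemma radial_near f (x : V) (e : R) : continuous f -> 0 < e ->
  \forall y \near x, forall t : R, 0 <= t <= 1 ->
    `|f (p + t *: (y - p)) - f (p + t *: (x - p))| < e.
Proof.
move=> cf e0.
have := @segment_compact R 0 1; rewrite compact_near_coveringP.
move=> /(_ V (nbhs x) (fun y t => `|f (p + t *: (y - p)) - f (p + t *: (x - p))| < e) _).
move=> H; suff : \forall i \near x, `[0, 1] `<=` (fun t => `|f (p + t *: (i - p)) - f (p + t *: (x - p))| < e).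
  by apply: filterS => y H' t t01; apply: H'; rewrite /= in_itv.
apply: H => t _.
have e2 : 0 < e / 2 by rewrite divr_gt0.
have /cvgrPdist_lt /(_ _ e2) h1 := @radial_arg_continuous f cf (t, x).
have h2 : \forall s \near t, `|f (p + t *: (x - p)) - f (p + s *: (x - p))| < e / 2.
  have /cvgrPdist_lt /(_ _ e2) := @radial_integrand_continuous 0 f x cf t.
  by apply: filterS => s; rewrite !expr0 !mul1r.
have h3 : \forall z \near (t, x), `|f (p + t *: (x - p)) - f (p + z.1 *: (x - p))| < e / 2.
  by apply: (cvg_fst h2).
near=> z.
have /= a1 : `|f (p + t *: (x - p)) - f (p + z.1 *: (z.2 - p))| < e / 2 by near: z; exact: h1.
have /= a2 : `|f (p + t *: (x - p)) - f (p + z.1 *: (x - p))| < e / 2 by near: z; exact: h3.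
rewrite -(subrKA (f (p + t *: (x - p)))) (splitr e).
by apply: le_lt_trans (ler_normD _ _) _; rewrite distrC ltrD // distrC.
Unshelve. all: by end_near. Qed.

Lemma radial_continuous m f : continuous f -> continuous (radial m f).
Proof.
move=> cf x; apply/cvgrPdist_le => e e0.
have := @radial_near f x e cf e0; apply: filterS => y hy.
rewrite /radial distrC -int01B; try exact: radial_integrand_continuous.
apply: int01_norm_le.
  by move=> t; apply: cvgB; exact: radial_integrand_continuous.
move=> t t01; rewrite -mulrBr normrM; apply: le_trans (ltW (hy t t01)).
have /andP[t0 t1] := t01.
by rewrite ler_piMl // normrX exprn_ile1 // ger0_norm.
Qed.

(** The mean value theorem turns the difference quotient of the integrand into t ^+ m.+1 times 'D_v
    f at p + t (x + c v - p) with |c| <= |h|; [radial_near] then bounds the error uniformly in t. *)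
Lemma radial_is_derive m f (x v : V) : Coo f ->
  is_derive x v (radial m f) (radial m.+1 (fun y => 'D_v f y) x).
Proof.
move=> cf; have c0 := Coo_continuous cf.
have cD := Coo_continuous (Coo_derive v cf).
suff L : h^-1 *: (radial m f (h *: v + x) - radial m f x) @[h --> 0^'] --> radial m.+1 (fun y => 'D_v f y) x.
  by apply: DeriveDef; [apply/cvgP: L|exact: cvg_lim L].
apply/cvgrPdist_le => e e0.
have /nbhs_ballP[r /= r0 rP] := @radial_near _ x e cD e0.
have K0 : 0 < `|v| + 1 by rewrite ltr_wpDl.
near=> h.
have h0 : h != 0 by near: h; exact: nbhs_dnbhs_neq.
have hr : `|h| < r / (`|v| + 1) by near: h; apply: dnbhs0_lt; rewrite divr_gt0.
have ci (g : V -> R) k y : continuous g -> continuous (fun t : R => t ^+ k * g (p + t *: (y - p))).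
  exact: radial_integrand_continuous.
have cB : continuous (fun t : R => t ^+ m * f (p + t *: (h *: v + x - p)) - t ^+ m * f (p + t *: (x - p))).
  by move=> t; apply: cvgB; exact: ci.
have cZ : continuous (fun t : R => h^-1 * (t ^+ m * f (p + t *: (h *: v + x - p)) - t ^+ m * f (p + t *: (x - p)))).
  by move=> t; apply: cvgM; [exact: cvg_cst|exact: cB].
rewrite /radial -(int01B (ci f m (h *: v + x) c0) (ci f m x c0)).
rewrite /GRing.scale /= -(int01Z _ cB) -(int01B (ci _ m.+1 x cD) cZ).
apply: int01_norm_le => [t|t t01].
  exact: (cvgB (ci _ m.+1 x cD t) (cZ t)).
have /andP[t0 t1] := t01.
(* Moving x by s v moves the point of the segment by s (t v): the origin of the extra factor t. *)
have E s : p + t *: (s *: v + x - p) = (p + t *: (x - p)) + s *: (t *: v).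
  rewrite -[s *: v + x - p]addrA [t *: (s *: v + _)]scalerDr.
  by rewrite [t *: (s *: v) + _]addrC addrA !scalerA mulrC.
pose g := fun s : R => f ((p + t *: (x - p)) + s *: (t *: v)).
have dg (s : R) : is_derive s (1 : R) g (t * 'D_v f (p + t *: (s *: v + x - p))).
  have := is_derive_line cf (p + t *: (x - p)) (t *: v) s.
  by rewrite derive_dirZ // -E.
have [c ch Ec] : exists2 c, `|c| <= `|h| & g h - g 0 = t * 'D_v f (p + t *: (c *: v + x - p)) * h.
  have wc a b : {within `[a, b], continuous g}.
    by apply: derivable_within_continuous => y _; have [] := dg y.
  have [h0'|h0'|] := ltgtP h 0; last by move/eqP; rewrite (negbTE h0).
  - have [c] := MVT h0' (fun y _ => dg y) (wc _ _).
    rewrite in_itv /= => /andP[c1 c2] E'; exists c; first by rewrite !ltr0_norm // lerN2 ltW.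
    by rewrite -[g h - _]opprB E' sub0r mulrN opprK.
  - have [c] := MVT h0' (fun y _ => dg y) (wc _ _).
    rewrite in_itv /= => /andP[c1 c2] E'; exists c; first by rewrite !gtr0_norm // ltW.
    by rewrite E' subr0.
have -> : f (p + t *: (h *: v + x - p)) = g h by rewrite E.
have -> : f (p + t *: (x - p)) = g 0 by rewrite /g scale0r addr0.
rewrite -mulrBr Ec.
have -> : h^-1 * (t ^+ m * (t * 'D_v f (p + t *: (c *: v + x - p)) * h)) = t ^+ m.+1 * 'D_v f (p + t *: (c *: v + x - p)).
  by rewrite exprSr; field.
rewrite -mulrBr normrM.
have tm : `|t ^+ m.+1| <= 1 by rewrite normrX exprn_ile1 // ger0_norm.
apply: le_trans (ler_piMl _ tm) _ => //.
rewrite distrC ltW //; apply: rP => //; rewrite -ball_normE /= opprD addrCA subrr addr0 normrN normrZ.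
apply: le_lt_trans (ler_wpM2r _ ch) _ => //.
rewrite ltr_pdivlMr // in hr; apply: le_lt_trans hr.
by rewrite mulrDr mulr1 lerDl.
Unshelve. all: by end_near. Qed.

Lemma Coo_radial m f : Coo f -> Coo (radial m f).
Proof.
move=> cf k; elim: k m f cf => [|k IH] m f cf; first exact/radial_continuous/Coo_continuous.
split=> [|v]; first exact/radial_continuous/Coo_continuous.
split=> [x|]; first by have [] := radial_is_derive m x v cf.
rewrite (_ : (fun x => 'D_v (radial m f) x) = radial m.+1 (fun y => 'D_v f y)).
  exact/IH/Coo_derive.
by apply/funext => x; have [] := radial_is_derive m x v cf.
Qed.

Lemma radial_FTC f (x : V) : Coo f ->
  f x - f p = radial 0 (fun y => 'D_(x - p) f y) x.
Proof.
move=> cf; rewrite /radial.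
have d (t : R) : is_derive t (1 : R) (fun t : R => f (p + t *: (x - p)))
    (t ^+ 0 * 'D_(x - p) f (p + t *: (x - p))).
  by rewrite mul1r; exact: is_derive_line.
have c := @radial_integrand_continuous 0 _ x (Coo_continuous (Coo_derive (x - p) cf)).
by rewrite (int01_FTC d c) scale1r scale0r addr0 [p + _]addrC subrK.
Qed.

End RadialAverage.

Section DirectionalComposition.
Context {R : realType} {V : normedModType R}.

(** Brings a directional derivative back to a line, where the one-variable chain rule applies. *)
Lemma is_derive_lineP {W : normedModType R} (f : V -> W) x v (d : W) :
  is_derive x v f d <-> is_derive (0 : R) (1 : R) (fun h : R => f (h *: v + x)) d.
Proof.
have E : (fun h : R => h^-1 *: (((fun h : R => f (h *: v + x)) \o shift 0) (h *: 1) - f (0 *: v + x)))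
       = (fun h : R => h^-1 *: ((f \o shift x) (h *: v) - f x)).
  by apply/funext => h /=; rewrite addr0 scale0r add0r [h *: 1]mulr1.
by split=> -[]; rewrite /derivable /derive; rewrite ?E => h1 h2; split; rewrite /derivable /derive ?E.
Qed.

Lemma is_derive_comp1 (phi : R -> R) (f : V -> R) x v (a d : R) :
  is_derive (f x) (1 : R) phi a -> is_derive x v f d ->
  is_derive x v (phi \o f) (a * d).
Proof.
move=> dphi /(iffLR (is_derive_lineP _ _ _ _)) df; apply/is_derive_lineP.
have e : f x = f (0 *: v + x) by rewrite scale0r add0r.
rewrite e in dphi.
exact: (is_derive1_comp dphi df).
Qed.
End DirectionalComposition.

Section SmoothScalarComposition.
Context {R : realType} {V : normedModType R}.
Implicit Types f : V -> R.

(** Meant for functions such as 1 / f or sqrt f, whose derivatives are expressed with the function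
    itself: [Ck k f] may be assumed when showing that the derivatives are [Ck k]. *)
Lemma Coo_rect f : continuous f -> (forall x v, derivable f x v) ->
  (forall k, Ck k f -> forall v, Ck k (fun x => 'D_v f x)) -> Coo f.
Proof.
move=> cf df H k; elim: k => [|k IH]; first exact: cf.
by split=> // v; split=> [x|]; [exact: df|exact: H].
Qed.

Lemma Coo_inv f : Coo f -> (forall x, f x != 0) -> Coo (fun x => (f x)^-1).
Proof.
move=> cf f0.
have df x v : is_derive x v (fun x => (f x)^-1) (- (f x) ^- 2 *: 'D_v f x).
  have d := Coo_derivable cf x v.
  by apply: DeriveDef; [apply: derivableV|apply: deriveV].
apply: Coo_rect => [x|x v|k hk v].
- apply: (@continuous_comp _ _ _ f (fun y => y^-1)); first exact: Coo_continuous.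
  exact: inv_continuous.
- by have [] := df x v.
- rewrite (_ : (fun x => _) = (fun x => (- 'D_v f x) * ((f x)^-1 * (f x)^-1))).
    apply: CkM; last exact: CkM.
    exact: (CooN (Coo_derive v cf)).
  apply/funext => x; have [_ ->] := df x v.
  by rewrite /GRing.scale /= expr2 invfM; ring.
Qed.

Lemma Coo_sqrt f : Coo f -> (forall x, 0 < f x) -> Coo (fun x => Num.sqrt (f x)).
Proof.
move=> cf f0.
have df x v : is_derive x v (fun x => Num.sqrt (f x)) ((2 * Num.sqrt (f x))^-1 * 'D_v f x).
  apply: (@is_derive_comp1 R V Num.sqrt f); last first.
    exact: (DeriveDef (Coo_derivable cf x v) erefl).
  exact: is_derive1_sqrt.
apply: Coo_rect => [x|x v|k hk v].
- apply: (@continuous_comp _ _ _ f Num.sqrt); first exact: Coo_continuous.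
  exact: sqrt_continuous.
- by have [] := df x v.
- rewrite (_ : (fun x => _) = (fun x => (2^-1 * 'D_v f x * (f x)^-1) * Num.sqrt (f x))).
    apply: CkM => //; move: k {hk}; apply: CooM.
      exact/CooZ/Coo_derive.
    by apply: Coo_inv => // y; rewrite gt_eqF.
  apply/funext => x; have [_ ->] := df x v.
  have s0 : Num.sqrt (f x) != 0 by rewrite gt_eqF // sqrtr_gt0.
  rewrite -[in (f x)^-1](sqr_sqrtr (ltW (f0 x))).
  by field.
Qed.

(** The induction runs over phi as well, because the derivative involves the derivative of phi
    composed with f. *)
Lemma Coo_comp1 (phi : R -> R) f : Coo phi -> Coo f -> Coo (fun x => phi (f x)).
Proof.
move=> cphi cf k; elim: k phi cphi => [|k IH] phi cphi.
  move=> x; apply: (@continuous_comp _ _ _ f phi); exact: Coo_continuous.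
have df x v : is_derive x v (fun x => phi (f x)) ('D_1 phi (f x) * 'D_v f x).
  apply: (@is_derive_comp1 R V phi f).
    exact: (DeriveDef (Coo_derivable cphi (f x) 1) erefl).
  exact: (DeriveDef (Coo_derivable cf x v) erefl).
split=> [x|v]; first by apply: (@continuous_comp _ _ _ f phi); exact: Coo_continuous.
split=> [x|]; first by have [] := df x v.
rewrite (_ : (fun x => _) = (fun x => 'D_1 phi (f x) * 'D_v f x)).
  apply: CkM; last exact: Coo_derive.
  exact: (IH (fun y => 'D_1 phi y) (Coo_derive _ cphi)).
by apply/funext => x; have [_ ->] := df x v.
Qed.

End SmoothScalarComposition.

(** * Hadamard's lemma and chain rules for functions of matrices *)

Section SmoothMatrixComposition.
Context {R : realType} {n : nat}.
Local Notation M := 'M[R]_n.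
Implicit Types (F : M -> R) (p C : M).

Lemma derive_mx_sum F C (x : M) : Coo F ->
  'D_C F x = \sum_i \sum_j C i j * 'D_(delta_mx i j) F x.
Proof.
move=> cF.
have S (I : Type) (r : seq I) (X : I -> M) :
    'D_(\sum_(i <- r) X i) F x = \sum_(i <- r) 'D_(X i) F x.
  elim: r => [|i r IH]; first by rewrite !big_nil derive0.
  by rewrite !big_cons derive_dirD // IH.
rewrite {1}[C]matrix_sum_delta S; apply: eq_bigr => i _.
by rewrite S; apply: eq_bigr => j _; rewrite derive_dirZ.
Qed.

(** The coefficients are the averages of the partial derivatives of F over the segment from p to x.
    This linearizes F at p without Frechet differentiability, for chain rules and for derivations
    alike. *)
Lemma hadamard F p : Coo F -> exists G : 'I_n -> 'I_n -> M -> R,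
  [/\ forall i j, Coo (G i j), forall i j, G i j p = 'D_(delta_mx i j) F p &
      forall x, F x - F p = \sum_i \sum_j (x - p) i j * G i j x].
Proof.
move=> cF; exists (fun i j => radial p 0 (fun y => 'D_(delta_mx i j) F y)).
have cr (g : M -> R) (x : M) := @radial_integrand_continuous R M p 0 g x.
split=> [i j|i j|x].
- exact/Coo_radial/Coo_derive.
- rewrite /radial -[RHS]int01_cst; congr int01; apply/funext => t.
  by rewrite mul1r subrr scaler0 addr0.
- have S (I : Type) (r : seq I) (c : I -> R) (g : I -> M -> R) :
      (forall i, continuous (g i)) ->
      radial p 0 (fun y => \sum_(i <- r) c i * g i y) x
      = \sum_(i <- r) c i * radial p 0 (g i) x.
    move=> cg; elim: r => [|i r IH].
      rewrite big_nil -[RHS](int01_cst 0) /radial; congr int01.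
      by apply/funext => t; rewrite big_nil mulr0.
    have cs : continuous (fun y => \sum_(i <- r) c i * g i y).
      apply: (@Ck_sum R M 0) => j; apply: (@CkM R M 0) => //.
      exact: (Coo_cst (c j) 0).
    have c1 : continuous (fun t : R => c i * (t ^+ 0 * g i (p + t *: (x - p)))).
      by move=> t; exact: (cvgM (cvg_cst _) (cr (g i) x (cg i) t)).
    rewrite big_cons -IH /radial -(int01Z _ (cr (g i) x (cg i))).
    rewrite -(int01D c1 (cr _ x cs)).
    by congr int01; apply/funext => t; rewrite !mul1r big_cons.
  have cD i j := Coo_continuous (Coo_derive (delta_mx i j : M) cF).
  rewrite radial_FTC //.
  rewrite (_ : (fun y => 'D_(x - p) F y) = (fun y => \sum_(ij : 'I_n * 'I_n)
      (x - p) ij.1 ij.2 * 'D_(delta_mx ij.1 ij.2) F y)); last first.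
    by apply/funext => y; rewrite derive_mx_sum // pair_bigA.
  by rewrite S ?pair_bigA // => -[i j]; exact: cD.
Qed.

Lemma mx_continuousP (T : topologicalType) (S : T -> M) (x : T) :
  (forall i j, {for x, continuous (fun y => S y i j)}) -> {for x, continuous S}.
Proof.
move=> cS; apply/cvgrPdist_le => /= e e0; near=> y.
rewrite /Num.Def.normr /= mx_normrE (bigmax_le _ (ltW e0)) //= => i _.
rewrite !mxE /=; move: i; near: y; apply: filter_forall => /= i.
exact: ((cvgrPdist_le _ _).1 (cS i.1 i.2)).
Unshelve. all: by end_near. Qed.

Lemma is_derive_mxP {V : normedModType R} (S : V -> M) (x v : V) C :
  is_derive x v S C <-> forall i j, is_derive x v (fun y => S y i j) (C i j).
Proof.
split=> [[dS <-] i j|H].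
  rewrite derive_mx // mxE; apply: DeriveDef => //.
  by move: i j; apply/derivable_mxP.
have dS : derivable S x v by apply/derivable_mxP => i j; have [] := H i j.
apply: DeriveDef => //; rewrite derive_mx //; apply/matrixP => i j; rewrite mxE.
by have [] := H i j.
Qed.

(** Hadamard's expansion at gamma t makes the difference quotient a sum of quotients of the entries
    of gamma times continuous factors. *)
Lemma is_derive_curve F (gamma : R -> M) (t : R) C : Coo F ->
  is_derive t (1 : R) gamma C ->
  is_derive t (1 : R) (fun s => F (gamma s)) ('D_C F (gamma t)).
Proof.
move=> cF dg; have [G [cG Gp FG]] := hadamard (gamma t) cF.
have cg : {for t, continuous gamma}.
  by apply: differentiable_continuous; apply/derivable1_diffP; have [] := dg.
have dgij i j : is_derive t (1 : R) (fun s => gamma s i j) (C i j).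
  by move: i j; apply/is_derive_mxP.
suff L : h^-1 *: (F (gamma (h *: 1 + t)) - F (gamma t)) @[h --> 0^'] --> 'D_C F (gamma t).
  by apply: DeriveDef; [apply/cvgP: L|exact: cvg_lim L].
rewrite derive_mx_sum //.
rewrite (_ : (fun h => _) = (fun h : R => \sum_i \sum_j
   (h^-1 *: (gamma (h *: 1 + t) i j - gamma t i j)) * G i j (gamma (h *: 1 + t)))); last first.
  apply/funext => h; rewrite FG scaler_sumr; apply: eq_bigr => i _.
  rewrite scaler_sumr; apply: eq_bigr => j _.
  by rewrite !mxE scalerAl.
have ct : {for 0, continuous (fun h : R => gamma (h *: 1 + t))}.
  apply: (@continuous_comp _ _ _ (fun h : R => h *: 1 + t) gamma).
    by apply: cvgD; [apply: cvgZr_tmp; exact: cvg_id|exact: cvg_cst].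
  by rewrite /= scale0r add0r.
apply: cvg_big => [|i _]; first exact: add_continuous.
apply: cvg_big => [|j _]; first exact: add_continuous.
apply: cvgM.
  by have [d1 d2] := dgij i j; rewrite -d2; exact: d1.
rewrite -Gp.
have E : gamma t = gamma (0 *: 1 + t) by rewrite scale0r add0r.
rewrite E; apply: cvg_trans (@continuous_comp _ _ _ _ (G i j) 0 ct _).
  by apply: cvg_app; exact: cvg_within.
exact: Coo_continuous.
Qed.

Lemma is_derive_comp_mx {V : normedModType R} F (S : V -> M) (x v : V) C : Coo F ->
  is_derive x v S C -> is_derive x v (fun y => F (S y)) ('D_C F (S x)).
Proof.
move=> cF /(iffLR (is_derive_lineP _ _ _ _)) dS; apply/is_derive_lineP.
have := is_derive_curve cF dS; by rewrite scale0r add0r.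
Qed.

Definition Coo_mx {V : normedModType R} (S : V -> M) : Prop :=
  forall i j, Coo (fun y => S y i j).

Lemma Coo_mx_is_derive {V : normedModType R} (S : V -> M) (x v : V) : Coo_mx S ->
  is_derive x v S (\matrix_(i, j) 'D_v (fun y => S y i j) x).
Proof.
move=> cS; apply/is_derive_mxP => i j; rewrite mxE.
exact: (DeriveDef (Coo_derivable (cS i j) x v) erefl).
Qed.

Lemma Coo_comp_mx {V : normedModType R} F (S : V -> M) :
  Coo F -> Coo_mx S -> Coo (fun y => F (S y)).
Proof.
move=> cF cS k; elim: k F cF => [|k IH] F cF.
  move=> x; apply: (@continuous_comp _ _ _ S F); last exact: Coo_continuous.
  by apply: mx_continuousP => i j; exact: Coo_continuous.
have df x v := is_derive_comp_mx cF (Coo_mx_is_derive x v cS).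
split=> [x|v].
  apply: (@continuous_comp _ _ _ S F); last exact: Coo_continuous.
  by apply: mx_continuousP => i j; exact: Coo_continuous.
split=> [x|]; first by have [] := df x v.
rewrite (_ : (fun x => _) = (fun x => \sum_i \sum_j 'D_v (fun y => S y i j) x * 'D_(delta_mx i j) F (S x))).
  apply: Ck_sum => i; apply: Ck_sum => j; apply: CkM; first exact: Coo_derive.
  exact: (IH (fun y => 'D_(delta_mx i j) F y) (Coo_derive _ cF)).
apply/funext => x; have [_ ->] := df x v.
by rewrite derive_mx_sum //; apply: eq_bigr => i _; apply: eq_bigr => j _; rewrite mxE.
Qed.

Lemma Coo_coord (i j : 'I_n) : Coo (fun x : M => x i j).
Proof.
apply: Coo_rect => [|x v|k _ v].
- exact: coord_continuous.
- exact/diff_derivable/differentiable_coord.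
- have E x : is_derive x v (fun y : M => y i j) (v i j).
    by apply: (iffLR (is_derive_mxP id x v v)); exact: is_derive_id.
  rewrite (_ : (fun x => _) = (fun=> v i j)); first exact: Coo_cst.
  by apply/funext => x; have [] := E x.
Qed.

End SmoothMatrixComposition.

(** * A flat function and a smooth step *)

Section FlatFunction.
Context {R : realType}.
Implicit Types (x : R) (m : nat).

(** The power of 1 / x makes the family stable under derivation. *)
Definition flat m x : R := if 0 < x then x^-1 ^+ m * expR (- x^-1) else 0.

Lemma flat_ge0 m x : 0 <= flat m x.
Proof.
rewrite /flat; case: ifPn => // x0.
by rewrite mulr_ge0 ?expR_ge0 // exprn_ge0 // invr_ge0 ltW.
Qed.

Lemma flat_gt0 x : 0 < x -> 0 < flat 0 x.
Proof. by move=> x0; rewrite /flat x0 mul1r expR_gt0. Qed.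

Lemma flat_le0 m x : x <= 0 -> flat m x = 0.
Proof. by rewrite /flat ltNge => ->. Qed.

(** Comparison of exp(1 / x) with the term of degree m + 2 of its series. The exponent 2 in the
    bound forces the derivative at 0 to vanish. *)
Lemma flat_bound m x : flat m x <= (m.+2)`!%:R * x ^+ 2.
Proof.
rewrite /flat; case: ifPn => x0; last by rewrite mulr_ge0 ?ler0n ?sqr_ge0.
have y0 : 0 < x^-1 by rewrite invr_gt0.
have f0 : 0 < (m.+2)`!%:R :> R by rewrite ltr0n fact_gt0.
have H : x^-1 ^+ m.+2 / (m.+2)`!%:R <= expR x^-1.
  by apply: le_trans (expR_ge1Dxn m.+1 (ltW y0)); rewrite lerDr.
rewrite expRN ler_pdivrMr ?expR_gt0 //.
have -> : x^-1 ^+ m = ((m.+2)`!%:R * x ^+ 2) * (x^-1 ^+ m.+2 / (m.+2)`!%:R).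
  by rewrite !exprS expr0; field; rewrite !gt_eqF.
by rewrite ler_wpM2l // mulr_ge0 ?sqr_ge0 // ltW.
Qed.

Lemma is_derive_flat m x :
  is_derive x (1 : R) (flat m) (- m%:R * flat m.+1 x + flat m.+2 x).
Proof.
have [x0|x0|<-] := ltgtP 0 x.
- pose g := fun y : R => y^-1 ^+ m * expR (- y^-1).
  have dV : is_derive x (1 : R) (fun y : R => y^-1) (- x ^- 2).
    have ne : @id R x != 0 by rewrite gt_eqF.
    have dI : derivable (@id R) x 1 by exact: derivable_id.
    have e := @deriveV R R (@id R) x 1 ne dI.
    apply: DeriveDef; first exact: (@derivableV R R (@id R) x 1 ne dI).
    by rewrite e derive_id /GRing.scale /= mulr1.
  have dN : is_derive x (1 : R) (fun y : R => - y^-1) (x ^- 2).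
    by have := is_deriveN dV; rewrite opprK.
  have dE : is_derive x (1 : R) (fun y : R => expR (- y^-1)) (expR (- x^-1) * x ^- 2).
    exact: (@is_derive1_comp _ expR (fun y => - y^-1) x _ _ (is_derive_expR (- x^-1)) dN).
  have dX := is_deriveX m dV.
  have dg := is_deriveM dX dE.
  rewrite exprfctE mulrfctE in dg.
  apply: (@near_eq_is_derive _ _ _ g).
    near=> y; rewrite /flat /g ifT //; near: y; exact: lt_nbhsr.
  apply: (is_derive_eq dg).
  rewrite /flat x0 /GRing.scale /=.
  case: m {g dX dg} => [|m].
    by rewrite !mul0r expr0; field; rewrite gt_eqF.
  by rewrite !exprS expr0; field; rewrite gt_eqF.
- apply: (@near_eq_is_derive _ _ _ (fun=> 0)).
    near=> y; rewrite flat_le0 // ltW //; near: y; exact: lt_nbhsl.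
  by rewrite !flat_le0 ?ltW // mulr0 addr0; exact: is_derive_cst.
- rewrite !(flat_le0 _ (lexx 0)) mulr0 addr0.
  suff L : h^-1 *: (flat m (h *: 1 + 0) - flat m 0) @[h --> 0^'] --> (0 : R).
    by apply: DeriveDef; [apply/cvgP: L|exact: cvg_lim L].
  apply/cvgrPdist_le => e e0; near=> h.
  have h0 : h != 0 by near: h; exact: nbhs_dnbhs_neq.
  rewrite sub0r normrN addr0 (flat_le0 _ (lexx 0)) subr0 normrM normfV [h *: 1]mulr1.
  rewrite ger0_norm ?flat_ge0 // mulrC ler_pdivrMr ?normr_gt0 //.
  apply: le_trans (flat_bound m h) _.
  rewrite -real_normK ?num_real // expr2 mulrA ler_wpM2r // mulrC -ler_pdivlMr.
    by near: h; apply: dnbhs0_le; rewrite divr_gt0 // ltr0n fact_gt0.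
  by rewrite ltr0n fact_gt0.
Unshelve. all: by end_near. Qed.

Lemma Coo_flat m : Coo (flat m : R -> R).
Proof.
move=> k; elim: k m => [|k IH] m.
  move=> x; apply: differentiable_continuous; apply/derivable1_diffP.
  by have [] := is_derive_flat m x.
have df x v : is_derive x v (flat m) ((- m%:R * flat m.+1 x + flat m.+2 x) * v).
  exact: (is_derive_comp1 (is_derive_flat m x) (is_derive_id x v)).
split=> [x|v].
  apply: differentiable_continuous; apply/derivable1_diffP.
  by have [] := is_derive_flat m x.
split=> [x|]; first by have [] := df x v.
rewrite (_ : (fun x => _) = (fun x => (- m%:R * flat m.+1 x + flat m.+2 x) * v)).
  apply: CkM; last exact: (Coo_cst v k).
  apply: CkD => //; apply: CkM => //; exact: (Coo_cst (- m%:R) k).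
by apply/funext => x; have [] := df x v.
Qed.

(** The plateau starts at 1/2 because the argument will be either nonpositive or a positive number
    whose square exceeds 1/2. *)
Definition smooth_step x : R := flat 0 x / (flat 0 x + flat 0 (1 / 2 - x)).

Lemma smooth_step_den_gt0 x : 0 < flat 0 x + flat 0 (1 / 2 - x).
Proof.
have [x0|x0] := ltP 0 x; first by rewrite ltr_wpDr ?flat_ge0 ?flat_gt0.
by rewrite ltr_wpDl ?flat_ge0 // flat_gt0 //; lra.
Qed.

Lemma smooth_step0 x : x <= 0 -> smooth_step x = 0.
Proof. by move=> x0; rewrite /smooth_step flat_le0 // mul0r. Qed.

Lemma smooth_step1 x : 1 / 2 <= x -> smooth_step x = 1.
Proof.
move=> x0; rewrite /smooth_step (flat_le0 _ (_ : 1 / 2 - x <= 0)) ?addr0; last by lra.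
by rewrite divff // gt_eqF // flat_gt0 //; lra.
Qed.

End FlatFunction.

Section SmoothMatrixFunctions.
Context {R : realType} {V : normedModType R} {n : nat}.
Implicit Types S T : V -> 'M[R]_n.

Lemma Coo_mx_cst (A : 'M[R]_n) : Coo_mx (fun _ : V => A).
Proof. by move=> i j; exact: Coo_cst. Qed.

Lemma Coo_mx_mul S T : Coo_mx S -> Coo_mx T -> Coo_mx (fun x => S x *m T x).
Proof.
move=> cS cT i j; under eq_fun do rewrite mxE.
by apply: Coo_sum => k; apply: CooM.
Qed.

Lemma Coo_tr S : Coo_mx S -> Coo (fun x => \tr (S x)).
Proof. by move=> cS; apply: Coo_sum. Qed.

End SmoothMatrixFunctions.

Section SmoothDeterminant.
Context {R : realType} {V : normedModType R}.

Lemma Coo_det n (S : V -> 'M[R]_n) : Coo_mx S -> Coo (fun x => \det (S x)).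
Proof.
move=> cS; rewrite /determinant; apply: Coo_sum => s.
by apply: CooZ; apply: Coo_prod.
Qed.

Lemma Coo_mx_adj n (S : V -> 'M[R]_n) : Coo_mx S -> Coo_mx (fun x => \adj (S x)).
Proof.
move=> cS i j; under eq_fun do rewrite mxE.
apply: CooZ; apply: Coo_det => k l; under eq_fun do rewrite !mxE.
exact: cS.
Qed.

End SmoothDeterminant.

(** * Poisson structures on surfaces *)

Section Derivations.
Context {R : realType} (M : manifold R).

Definition smooth_algebra : Prop :=
  [/\ forall c : R, smooth (fun _ : M => c),
      forall f g : M -> R, smooth f -> smooth g -> smooth (fun x => f x + g x) &
      forall f g : M -> R, smooth f -> smooth g -> smooth (fun x => f x * g x)].

Hypothesis smM : smooth_algebra.

Lemma smooth_cst (c : R) : smooth (fun _ : M => c). Proof. by have [] := smM. Qed.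

Lemma smoothD (f g : M -> R) : smooth f -> smooth g -> smooth (fun x => f x + g x).
Proof. by have [_ + _] := smM; exact. Qed.

Lemma smoothM (f g : M -> R) : smooth f -> smooth g -> smooth (fun x => f x * g x).
Proof. by have [_ _] := smM; exact. Qed.

Lemma smooth_lin (a : R) (f g : M -> R) :
  smooth f -> smooth g -> smooth (fun x => a * f x + g x).
Proof. by move=> sf sg; apply: smoothD => //; apply: smoothM => //; exact: smooth_cst. Qed.

Lemma smooth_sum (I : Type) (r : seq I) (F : I -> M -> R) :
  (forall i, smooth (F i)) -> smooth (fun x => \sum_(i <- r) F i x).
Proof.
move=> sF; elim: r => [|i r IH].
  by under eq_fun do rewrite big_nil; exact: smooth_cst.
by under eq_fun do rewrite big_cons; exact: smoothD.
Qed.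

Variable p : M.
Implicit Types (u v w : @functional R M) (f g : M -> R).

Lemma tangent_lin v (a : R) f g : tangent p v -> smooth f -> smooth g ->
  v (fun x => a * f x + g x) = a * v f + v g.
Proof. by case=> + _; exact. Qed.

Lemma tangentM v f g : tangent p v -> smooth f -> smooth g ->
  v (fun x => f x * g x) = v f * g p + f p * v g.
Proof. by case=> _; exact. Qed.

Lemma tangent_cst v (c : R) : tangent p v -> v (fun=> c) = 0.
Proof.
move=> tv; have s1 := smooth_cst 1.
have v1 : v (fun=> 1) = 0.
  have := tangentM tv s1 s1.
  rewrite (_ : (fun _ : M => 1 * 1) = (fun=> 1)); last by apply/funext => x; rewrite mulr1.
  by lra.
have v0 : v (fun=> 0) = 0.
  have := tangent_lin (-1) tv s1 s1.
  rewrite (_ : (fun _ : M => -1 * 1 + 1) = (fun=> 0)); last by apply/funext => x; rewrite mulr1 addNr.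
  by rewrite v1 mulr0 addr0.
have := tangent_lin c tv s1 (smooth_cst 0).
rewrite (_ : (fun _ : M => c * 1 + 0) = (fun=> c)); last by apply/funext => x; rewrite mulr1 addr0.
by rewrite v1 v0 mulr0 addr0.
Qed.

Lemma tangentD v f g : tangent p v -> smooth f -> smooth g ->
  v (fun x => f x + g x) = v f + v g.
Proof.
move=> tv sf sg; have := tangent_lin 1 tv sf sg.
rewrite (_ : (fun x => 1 * f x + g x) = (fun x => f x + g x)); last first.
  by apply/funext => x; rewrite mul1r.
by rewrite mul1r.
Qed.

Lemma tangent_sum v (I : Type) (r : seq I) (F : I -> M -> R) : tangent p v ->
  (forall i, smooth (F i)) ->
  v (fun x => \sum_(i <- r) F i x) = \sum_(i <- r) v (F i).
Proof.
move=> tv sF; elim: r => [|i r IH].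
  rewrite big_nil -[RHS](tangent_cst 0 tv); congr v; apply/funext => x.
  by rewrite big_nil.
rewrite big_cons -IH -tangentD //; last exact: smooth_sum.
by congr v; apply/funext => x; rewrite big_cons.
Qed.

Lemma tangent_ext u v : (forall f, smooth f -> u f = v f) -> tangent p v ->
  tangent p u.
Proof.
move=> uv [l m]; split=> [a f g sf sg|f g sf sg].
  by rewrite !uv ?l //; exact: smooth_lin.
by rewrite !uv ?m //; exact: smoothM.
Qed.

Lemma tangent_comb (a : R) u v : tangent p u -> tangent p v ->
  tangent p (fun f => a * u f + v f).
Proof.
move=> tu tv; split=> [b f g sf sg|f g sf sg].
  by rewrite !tangent_lin //; ring.
by rewrite !tangentM //; ring.
Qed.

Lemma tangent0 : tangent p (fun=> 0).
Proof. by split=> *; rewrite ?mulr0 ?mul0r addr0. Qed.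

End Derivations.

(* On a surface, a Poisson structure is a function F times the inverse of a
   volume form nu; F is characterized by nu(X_f, Y) = - F Y(f). *)
Section PoissonSurface.
Context {R : realType} (M : manifold R).
Hypothesis smM : smooth_algebra M.
Hypothesis dim2 : forall (p : M) (u1 u2 u3 : @functional R M),
  tangent p u1 -> tangent p u2 -> tangent p u3 ->
  exists a1 a2 a3 : R, (a1, a2, a3) <> (0, 0, 0) /\
    forall f, smooth f -> a1 * u1 f + a2 * u2 f + a3 * u3 f = 0.
Variables (pi : @bracket R M) (nu : @pre_form R M).
Hypothesis bi : bivector pi.
Hypothesis vol : volume_form nu.
Implicit Types (p : M) (f g h : M -> R) (u v w : @functional R M).

Let tX f p : smooth f -> tangent p (at_point (pi f) p).
Proof. by move=> sf; have [_ /(_ f sf) [_]] := bi. Qed.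

Let sX f g : smooth f -> smooth g -> smooth (pi f g).
Proof. by move=> sf sg; have [_ /(_ f sf) [+ _]] := bi; exact. Qed.

Lemma form_lin p (a : R) u v w : tangent p u -> tangent p v -> tangent p w ->
  nu p (fun f => a * u f + v f) w = a * nu p u w + nu p v w.
Proof. by have [[_ _ + _] _] := vol; exact. Qed.

Lemma form_ext p u v w : tangent p u -> tangent p v -> tangent p w ->
  (forall f, smooth f -> u f = v f) -> nu p u w = nu p v w.
Proof. by have [[_ + _ _] _] := vol; exact. Qed.

Lemma form_anti p u v : tangent p u -> tangent p v -> nu p u v = - nu p v u.
Proof. by have [[_ _ _ +] _] := vol; exact. Qed.

Lemma form_diag p u : tangent p u -> nu p u u = 0.
Proof. by move=> tu; have := form_anti tu tu; lra. Qed.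

(** Padding with the zero functional writes the relation as a combination of the shape accepted by
    [form_lin]; [form_ext] identifies it with zero, since only smooth functions count. *)
Lemma form_relation p (a b c : R) u v w z : tangent p u -> tangent p v ->
  tangent p w -> tangent p z ->
  (forall f, smooth f -> a * u f + b * v f + c * w f = 0) ->
  a * nu p u z + b * nu p v z + c * nu p w z = 0.
Proof.
move=> tu tv tw tz H; have t0 := tangent0 p.
have n0 : nu p (fun=> 0) z = 0.
  have := form_lin (-1) t0 t0 tz.
  rewrite (_ : (fun _ : M -> R => -1 * 0 + 0) = (fun=> 0)); last first.
    by apply/funext => x; rewrite mulr0 addr0.
  by move=> ->; rewrite mulN1r addNr.
have t1 := tangent_comb c tw t0; have t2 := tangent_comb b tv t1.
have t3 := tangent_comb a tu t2.
have H' f : smooth f -> a * u f + (b * v f + (c * w f + 0)) = 0.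
  by move=> sf; rewrite addr0 addrA H.
by have := form_ext t3 t0 tz H'; rewrite !form_lin // n0 addr0 addrA.
Qed.

Lemma form_null p u z : tangent p u -> tangent p z ->
  (forall f, smooth f -> u f = 0) -> nu p u z = 0.
Proof.
move=> tu tz H; have := @form_relation p 1 0 0 u u u z tu tu tu tz.
by rewrite mul1r !mul0r !addr0; apply => f sf; rewrite H // !mulr0 !addr0.
Qed.

(** Cramer's rule in a plane. In a dependence relation among u, v, w the coefficient of w is
    nonzero: otherwise pairing with u and v would kill the other two, as nu(u, v) <> 0. *)
Lemma form_basis p u v w f : tangent p u -> tangent p v -> tangent p w ->
  nu p u v <> 0 -> smooth f ->
  nu p u v * w f = nu p w v * u f - nu p w u * v f.
Proof.
move=> tu tv tw /eqP c0 sf.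
have [a [b [d [nz rel]]]] := dim2 tu tv tw.
have r1 := form_relation tu tv tw tv rel.
have r2 := form_relation tu tv tw tu rel.
rewrite !form_diag // (form_anti tv tu) in r1 r2.
set c := nu p u v in c0 r1 r2 *.
have d0 : d != 0.
  apply/eqP => d0; apply: nz; rewrite d0 in r1 r2 *.
  have /eqP : a * c = 0 by lra.
  rewrite mulf_eq0 (negbTE c0) orbF => /eqP ->.
  have /eqP : b * c = 0 by lra.
  by rewrite mulf_eq0 (negbTE c0) orbF => /eqP ->.
have rf := rel f sf.
apply: (mulfI d0).
have -> : d * (c * w f) = c * (d * w f) by ring.
have -> : d * w f = - (a * u f + b * v f) by lra.
have -> : d * (nu p w v * u f - nu p w u * v f) = (d * nu p w v) * u f - (d * nu p w u) * v f by ring.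
have -> : d * nu p w v = - (a * c) by lra.
have -> : d * nu p w u = b * c by lra.
by ring.
Qed.

(** If all these minors vanished, u and v would be proportional on smooth functions and nu(u, v)
    would be 0. *)
Lemma form_dual p u v : tangent p u -> tangent p v -> nu p u v <> 0 ->
  exists f g, [/\ smooth f, smooth g & u f * v g - u g * v f <> 0].
Proof.
move=> tu tv c0; apply: contrapT => H.
have E f g : smooth f -> smooth g -> u f * v g - u g * v f = 0.
  by move=> sf sg; apply: contrapT => n; apply: H; exists f, g.
have [[f [sf uf]]|nu0] := pselect (exists f, smooth f /\ u f <> 0); last first.
  apply: c0; apply: form_null => // f sf; apply: contrapT => n.
  by apply: nu0; exists f.
have rel g : smooth g -> v f * u g + (- u f) * v g + 0 * v g = 0.
  by move=> sg; have := E f g sf sg; lra.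
have := form_relation tu tv tv tv rel; rewrite form_diag // !mulr0 !addr0.
move/eqP; rewrite mulf_eq0 => /orP[/eqP vf|/eqP//].
apply: c0; rewrite form_anti // form_null ?oppr0 // => g sg.
have := E f g sf sg; rewrite vf mulr0 subr0 => /eqP.
by rewrite mulf_eq0 => /orP[/eqP/uf|/eqP].
Qed.

(** In the basis (u, v), pi is encoded by P f = nu(X_f, u) and Q f = nu(X_f, v). Antisymmetry of pi
    forces (P, Q) = la (u, v) on smooth functions, as bivectors of a plane form a line; then F = -
    la. *)
Lemma poisson_density p : exists F : R,
  (forall f w, smooth f -> tangent p w -> nu p (at_point (pi f) p) w = - F * w f) /\
  (F = 0 <-> forall f g, smooth f -> smooth g -> pi f g p = 0).
Proof.
have [_ /(_ p) [u [v [tu tv c0]]]] := vol.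
set c := nu p u v in c0.
pose P f := nu p (at_point (pi f) p) u; pose Q f := nu p (at_point (pi f) p) v.
have br f g : smooth f -> smooth g -> c * pi f g p = Q f * u g - P f * v g.
  by move=> sf sg; rewrite -(form_basis tu tv (tX p sf)).
have anti f g : smooth f -> smooth g ->
    Q f * u g - P f * v g = - (Q g * u f - P g * v f).
  by move=> sf sg; rewrite -!br // -mulrN; congr (_ * _); case: bi => + _; exact.
have [x [y [sx sy D0]]] := form_dual tu tv c0.
set D := u x * v y - u y * v x in D0.
have axx := anti x x sx sx; have ayy := anti y y sy sy; have axy := anti x y sx sy.
(* The only value compatible with P x = la u x and Q x = la v x, which give P x v y - Q x u y = la
   D. *)
pose la := (P x * v y - Q x * u y) / D.
have laD : la * D = P x * v y - Q x * u y by rewrite /la divfK //; apply/eqP.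
have dD : D != 0 by apply/eqP.
have Px : P x = la * u x.
  by apply: (mulIf dD); rewrite mulrAC laD /D; have := congr1 ( *%R (u y)) axx; lra.
have Qx : Q x = la * v x.
  by apply: (mulIf dD); rewrite mulrAC laD /D; have := congr1 ( *%R (v y)) axx; lra.
have Py : P y = la * u y.
  apply: (mulIf dD); rewrite mulrAC laD /D.
  by have := congr1 ( *%R (u y)) axy; have := congr1 ( *%R (u x)) ayy; lra.
have Qy : Q y = la * v y.
  apply: (mulIf dD); rewrite mulrAC laD /D.
  by have := congr1 ( *%R (v y)) axy; have := congr1 ( *%R (v x)) ayy; lra.
have PQ f : smooth f -> P f = la * u f /\ Q f = la * v f.
  move=> sf; have := anti f x sf sx; have := anti f y sf sy.
  rewrite Px Qx Py Qy => e2 e1; split; apply: (mulIf dD); rewrite /D.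
    by have := congr1 ( *%R (u y)) e1; have := congr1 ( *%R (u x)) e2; lra.
  by have := congr1 ( *%R (v y)) e1; have := congr1 ( *%R (v x)) e2; lra.
have Pf f : smooth f -> P f = la * u f by move=> /PQ [].
have Qf f : smooth f -> Q f = la * v f by move=> /PQ [].
exists (- la); split=> [f w sf tw|].
  have cc : c != 0 by apply/eqP.
  apply: (mulfI cc); rewrite opprK.
  have rel g : smooth g -> c * w g + (- nu p w v) * u g + nu p w u * v g = 0.
    by move=> sg; rewrite (form_basis tu tv tw) //; ring.
  have := form_relation tw tu tv (tX p sf) rel.
  rewrite (form_anti tw (tX p sf)) (form_anti tu (tX p sf)) (form_anti tv (tX p sf)).
  rewrite -/(P f) -/(Q f) Pf // Qf //.
  have := congr1 ( *%R la) (form_basis tu tv tw c0 sf); rewrite -/c; lra.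
split=> [la0 f g sf sg|H].
  have := br f g sf sg; rewrite Pf // Qf // (_ : la = 0); last by lra.
  by rewrite !mul0r subrr => /eqP; rewrite mulf_eq0 => /orP[/eqP/c0|/eqP].
have z f : smooth f -> la * u f = 0 /\ la * v f = 0.
  move=> sf; rewrite -Pf // -Qf // /P /Q.
  by split; apply: form_null => // [|g sg]; rewrite ?/at_point ?H //; exact: tX.
have [z1 z2] := z x sx; have [z3 z4] := z y sy.
apply/eqP; rewrite oppr_eq0; apply/eqP; apply: (mulIf dD); rewrite mul0r /D.
by rewrite mulrBr !mulrA z1 z3; ring.
Qed.

(* The function [q = m - F(p) E + m(p) k] satisfies {h, q}(p) = 0 for all h, so
   X_q vanishes at p and 0 = nu(X_q, w) = - F(p) w(q). *)
Lemma density_transport (D : @operator R M) (k F E m : M -> R) p w :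
  poisson pi -> modular_field pi nu D -> smooth k ->
  (forall f, smooth f -> forall q, D f q = pi k f q) ->
  (forall q f v, smooth f -> tangent q v -> nu q (at_point (pi f) q) v = - F q * v f) ->
  (forall q, F q = 0 <-> forall f g, smooth f -> smooth g -> pi f g q = 0) ->
  smooth E -> smooth m -> (forall q, m q = F q * E q) -> E p <> 0 ->
  tangent p w -> F p * (w m - F p * w E + w k * m p) = 0.
Proof.
move=> [_ jac] [_ mod] sk hD hF hF0 sE sm mFE E0 tw.
have [->|F0] := eqVneq (F p) 0; first by rewrite mul0r.
have [f [g [sf sg fg0]]] : exists f g, [/\ smooth f, smooth g & pi f g p <> 0].
  apply: contrapT => H; move/eqP: F0; apply; apply/hF0 => f g sf sg.
  by apply: contrapT => n; apply: H; exists f, g.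
have anti a b q : smooth a -> smooth b -> pi a b q = - pi b a q.
  by move=> sa sb; case: bi => + _; exact.
have vX a : smooth a -> vector_field (pi a) by move=> sa; case: bi => _; exact.
have XD a : smooth a -> forall b c, smooth b -> smooth c ->
    pi a (fun x => b x * c x) p = pi a b p * c p + b p * pi a c p.
  by move=> sa b c sb sc; exact: (tangentM (tX p sa) sb sc).
have XN a b c : smooth a -> smooth b -> smooth c ->
    pi a (pi b c) p = - pi a (pi c b) p.
  move=> sa sb sc; have c0 := tangent_cst smM 0 (tX p sa).
  have := tangent_lin (-1) (tX p sa) (sX sc sb) (smooth_cst smM 0).
  rewrite c0 addr0 mulN1r => <-; congr (pi a _ p).
  by apply/funext => q; rewrite addr0 mulN1r anti.
(* Modularity is tested on the Hamiltonian fields X_f and X_g, for which nu(X_f, X_g) = F {f, g}. *)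
pose N := eval_form nu (pi f) (pi g).
have NE q : N q = F q * pi f g q.
  rewrite /N /eval_form hF //; last exact: tX.
  by rewrite /at_point (anti f g) // mulNr mulrN.
have sN : smooth N by have [[sv _ _ _] _] := vol; apply: sv; exact: vX.
have sfg := sX sf sg.
(* Multiplication by E trades F for the smooth function m; differentiating this identity replaces
   differentiating F. *)
have ENm : (fun x => E x * N x) = (fun x => m x * pi f g x).
  by apply/funext => q; rewrite NE mFE mulrA [E q * _]mulrC.
(* The Jacobi identity in the form [X_h, X_a] = X_{h, a}. *)
have comm h a : smooth h -> smooth a -> forall l, smooth l ->
    at_point (commutator (pi h) (pi a)) p l = at_point (pi (pi h a)) p l.
  move=> sh sa l sl; rewrite /at_point /commutator.
  have := jac h a l sh sa sl p.
  rewrite (anti l) //; last exact: sX.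
  rewrite (XN a l h) //.
  by lra.
(* By the Jacobi identity, L_{X_h} nu = D(h) nu on (X_f, X_g) reduces to X_h(N) - F {h, {f, g}} =
   {k, h} N. Combined with the derivative of [ENm], every term is a multiple of {f, g}(p), which is
   cancelled. *)
have key h : smooth h -> pi h m p - F p * pi h E p + pi h k p * m p = 0.
  move=> sh.
  have shf := sX sh sf; have shg := sX sh sg.
  have e1 := XD h sh E N sE sN; rewrite ENm (XD h sh m _ sm sfg) in e1.
  have := mod h sh _ _ (vX f sf) (vX g sg) p.
  rewrite /lie_derivative /hamiltonian_field -/N hD // /eval_form.
  have tc a b : smooth a -> smooth b -> tangent p (at_point (commutator (pi a) (pi b)) p).
    move=> sa sb; apply: (tangent_ext smM (comm a b sa sb)).
    by apply: tX; exact: sX.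
  rewrite (form_ext (tc h f sh sf) (tX p shf) (tX p sg) (comm h f sh sf)).
  rewrite (form_anti (tX p sf) (tc h g sh sg)).
  rewrite (form_ext (tc h g sh sg) (tX p shg) (tX p sf) (comm h g sh sg)).
  rewrite !hF //; try exact: tX.
  rewrite /at_point (anti g (pi h f)) // (anti k) //.
  have := jac h f g sh sf sg p.
  rewrite (XN f g h) // => j; move: j.
  rewrite (anti g (pi h f)) // !NE mFE => j mo.
  rewrite NE mFE in e1.
  apply: (@mulIf _ (pi f g p)); first exact/eqP.
  rewrite mul0r.
  have j' := congr1 ( *%R (F p * E p)) j.
  have mo' := congr1 ( *%R (E p)) mo.
  lra.
pose q x := (- F p) * E x + ((m p) * k x + m x).
have sq : smooth q by apply: (smooth_lin smM) => //; exact: (smooth_lin smM).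
have lq v : tangent p v -> v q = v m - F p * v E + v k * m p.
  move=> tv; rewrite /q (tangent_lin _ tv) //; last exact: (smooth_lin smM).
  by rewrite (tangent_lin _ tv) //; ring.
rewrite -lq //.
suff : nu p (at_point (pi q) p) w = 0 by rewrite hF // mulNr => /eqP; rewrite oppr_eq0 => /eqP.
apply: form_null => //; first exact: tX.
move=> h sh; rewrite /at_point anti // -[pi h q p]/(at_point (pi h) p q) lq; last exact: tX.
by rewrite /at_point key // oppr0.
Qed.

End PoissonSurface.

(** * Tangent spaces of homogeneous spaces *)

Section MatrixCurves.
Context {R : realType} {n : nat}.
Local Notation M := 'M[R]_n.

Lemma is_derive_mulmx (a b : R -> M) (t : R) (A B : M) :
  is_derive t (1 : R) a A -> is_derive t (1 : R) b B ->
  is_derive t (1 : R) (fun s => a s *m b s) (A *m b t + a t *m B).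
Proof.
move=> da db; apply/is_derive_mxP => i j.
have dai k : is_derive t (1 : R) (fun s => a s i k) (A i k).
  by move: i k {j}; apply/is_derive_mxP.
have dbj k : is_derive t (1 : R) (fun s => b s k j) (B k j).
  by move: k j {i dai}; apply/is_derive_mxP.
rewrite (_ : (fun s => _) = \sum_k (fun s => a s i k * b s k j)); last first.
  by apply/funext => s; rewrite mxE fct_sumE.
have d k : is_derive t (1 : R) (fun s => a s i k * b s k j) (a t i k *: B k j + b t k j *: A i k).
  exact: is_deriveM.
apply: (is_derive_eq (is_derive_sum d)).
rewrite !mxE -big_split /=; apply: eq_bigr => k _.
by rewrite /GRing.scale /= addrC [b t k j * _]mulrC.
Qed.

Lemma is_derive_mulmxLR (a : R -> M) (t : R) (A B C : M) :
  is_derive t (1 : R) a A ->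
  is_derive t (1 : R) (fun s => B *m a s *m C) (B *m A *m C).
Proof.
move=> da.
have d1 := is_derive_mulmx (is_derive_cst B t 1) da.
have := is_derive_mulmx d1 (is_derive_cst C t 1).
by rewrite mulmx0 addr0 mul0mx add0r.
Qed.

Lemma is_derive_mulmxl (a : R -> M) (t : R) (A B : M) :
  is_derive t (1 : R) a A -> is_derive t (1 : R) (fun s => B *m a s) (B *m A).
Proof.
move=> da; have := is_derive_mulmx (is_derive_cst B t 1) da.
by rewrite mul0mx add0r.
Qed.

Lemma is_derive_mulmxr (a : R -> M) (t : R) (A B : M) :
  is_derive t (1 : R) a A -> is_derive t (1 : R) (fun s => a s *m B) (A *m B).
Proof.
move=> da; have := is_derive_mulmx da (is_derive_cst B t 1).
by rewrite mulmx0 addr0.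
Qed.

Lemma is_derive_mxtrace (a : R -> M) (t : R) (A : M) :
  is_derive t (1 : R) a A -> is_derive t (1 : R) (fun s => \tr (a s)) (\tr A).
Proof.
move=> /(iffLR (is_derive_mxP _ _ _ _)) da.
rewrite (_ : (fun s => _) = \sum_k (fun s => a s k k)); last first.
  by apply/funext => s; rewrite fct_sumE.
exact: is_derive_sum (fun k => da k k).
Qed.

Lemma invmx_mul (A B : M) : A \in unitmx -> B \in unitmx ->
  invmx (A *m B) = invmx B *m invmx A.
Proof.
move=> uA uB; have uAB : A *m B \in unitmx by rewrite unitmx_mul uA.
rewrite -[RHS](mulmxK uAB) mulmxA -(mulmxA (invmx B)) mulVmx // mulmx1.
by rewrite mulVmx // mul1mx.
Qed.

(** * One-parameter subgroups *)

Definition one_parameter (G : matrix_group R n) (X : M) (phi : R -> M) : Prop :=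
  [/\ forall s t, phi (s + t) = phi s *m phi t,
      forall t, carrier G (phi t) & is_derive (0 : R) (1 : R) phi X].

Section OneParameter.
Variables (G : matrix_group R n) (X : M) (phi : R -> M).
Hypothesis op : one_parameter G X phi.

Lemma one_parameter_unit t : phi t \in unitmx.
Proof. by case: op => _ Gp _; exact: carrier_unit (Gp t). Qed.

Lemma one_parameter0 : phi 0 = 1%:M.
Proof.
have [pD _ _] := op; have := pD 0 0; rewrite addr0 => e.
by rewrite -(mulKmx (one_parameter_unit 0) (phi 0)) -e mulVmx // one_parameter_unit.
Qed.

Lemma one_parameterN t : phi (- t) = invmx (phi t).
Proof.
have [pD _ _] := op; have := pD t (- t); rewrite subrr one_parameter0 => e.
by rewrite -(mulKmx (one_parameter_unit t) (phi (- t))) -e mulmx1.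
Qed.

Lemma one_parameter_is_derive t : is_derive t (1 : R) phi (phi t *m X).
Proof.
have [pD _ d0] := op.
have := is_derive_mulmxl (phi t) d0.
have -> : (fun s => phi t *m phi s) = (fun s => phi (t + s)).
  by apply/funext => s; rewrite pD.
move=> /(iffLR (is_derive_lineP _ _ _ _)) d; apply/is_derive_lineP.
rewrite (_ : (fun h : R => phi (h *: 1 + t)) = (fun h : R => phi (t + (h *: 1 + 0)))) //.
by apply/funext => h; rewrite addr0 addrC.
Qed.

Lemma one_parameter_inv_is_derive :
  is_derive (0 : R) (1 : R) (fun t => phi (- t)) (- X).
Proof.
have [_ _ d0] := op; apply/is_derive_mxP => i j; rewrite mxE -mulrN1.
have dN : is_derive (0 : R) (1 : R) (fun t : R => - t) (-1).
  exact: is_deriveN (is_derive_id _ _).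
apply: (@is_derive1_comp _ (fun t => phi t i j) (fun t => - t)) dN.
by rewrite oppr0; move: i j; apply/is_derive_mxP.
Qed.

Lemma one_parameter_comm t : phi t *m X = X *m phi t.
Proof.
have [pD _ d0] := op.
have d1 := is_derive_mulmxl (phi t) d0; have d2 := is_derive_mulmxr (phi t) d0.
have E : (fun s => phi t *m phi s) = (fun s => phi s *m phi t).
  by apply/funext => s; rewrite -!pD addrC.
rewrite E in d1; have [_ <-] := d1; by have [_ <-] := d2.
Qed.

Lemma one_parameter_conj (g : M) : carrier G g ->
  one_parameter G (g *m X *m invmx g) (fun t => g *m phi t *m invmx g).
Proof.
move=> Gg; have [pD Gp d0] := op; have ug := carrier_unit Gg; split.
- by move=> s t; rewrite pD !mulmxA mulmxKV.
- by move=> t; apply: carrierM; [exact: carrierM|exact: carrierV].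
- exact: is_derive_mulmxLR.
Qed.

End OneParameter.

Lemma lie_algebra_conj (G : matrix_group R n) (g X : M) : carrier G g ->
  lie_algebra G X -> lie_algebra G (g *m X *m invmx g).
Proof. by move=> Gg [phi op]; eexists; exact: (one_parameter_conj op Gg). Qed.

End MatrixCurves.

Section SmoothManifolds.
Context {R : realType} {n : nat}.
Local Notation M := 'M[R]_n.
Variables (G H : matrix_group R n).

Lemma group_smooth_algebra : smooth_algebra (group_manifold G).
Proof.
split=> [c|f g [F cF eF] [K cK eK]|f g [F cF eF] [K cK eK]].
- by exists (fun=> c); [exact: Coo_cst|].
- by exists (fun x => F x + K x); [exact: CooD|move=> x; rewrite eF eK].
- by exists (fun x => F x * K x); [exact: CooM|move=> x; rewrite eF eK].
Qed.

Lemma quotient_smooth_algebra : smooth_algebra (quotient_manifold G H).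
Proof.
have [a b c] := group_smooth_algebra.
by split=> [d|f g sf sg|f g sf sg]; [exact: a|exact: b|exact: c].
Qed.

(** By Hadamard's lemma, F o S minus a constant is a sum of products whose first factor vanishes at
    p, so the product rule leaves only the entries of S. With S the inclusion of G, or a map built
    from the section, this computes the tangent spaces of G and of G / H. *)
Lemma derivation_expand (N : manifold R) (smN : smooth_algebra N) (p : N)
    (v : @functional R N) (S : N -> M) (F : M -> R) :
  tangent p v -> (forall K : M -> R, Coo K -> smooth (fun x => K (S x))) -> Coo F ->
  v (fun x => F (S x)) = 'D_(\matrix_(i, j) v (fun x => S x i j)) F (S p).
Proof.
move=> tv sS cF; have [K [cK Kp FK]] := hadamard (S p) cF.
have sc i j : smooth (fun x => S x i j) by exact: (sS _ (Coo_coord i j)).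
have sd i j : smooth (fun x => (S x - S p) i j).
  rewrite (_ : (fun x => _) = (fun x => S x i j + (- S p i j))).
    by apply: smoothD => //; exact: smooth_cst.
  by apply/funext => x; rewrite !mxE.
have sK i j : smooth (fun x => (S x - S p) i j * K i j (S x)).
  by apply: smoothM => //; exact: sS.
have -> : (fun x => F (S x)) = (fun x => F (S p) + \sum_i \sum_j (S x - S p) i j * K i j (S x)).
  by apply/funext => x; rewrite -FK addrC subrK.
have ss i : smooth (fun x => \sum_j (S x - S p) i j * K i j (S x)) by exact: smooth_sum.
rewrite (tangentD tv); [|exact: smooth_cst|exact: smooth_sum].
rewrite (tangent_cst smN _ tv) add0r derive_mx_sum // (tangent_sum smN _ tv) //.
apply: eq_bigr => i _; rewrite (tangent_sum smN _ tv) //; apply: eq_bigr => j _.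
rewrite (tangentM tv) //; last exact: sS.
rewrite subrr !mxE mul0r addr0 -Kp; congr (_ * _).
rewrite (_ : (fun x => _) = (fun x => S x i j + (- S p i j))).
  rewrite (tangentD tv) // ?(tangent_cst smN _ tv) ?addr0 //.
  exact: smooth_cst.
by apply/funext => x; rewrite !mxE.
Qed.

Definition group_elt (A : M) (GA : carrier G A) : G := exist _ A (mem_set GA).

Lemma group_eltP (g : G) : carrier G (val g).
Proof. exact: set_mem (valP g). Qed.

Lemma coset_map_surj (p : coset_space G H) : exists g : G, coset_map H g = p.
Proof.
case: p => S HS; have [g _ e] := set_mem HS; exists g.
by apply: val_inj => /=.
Qed.

Lemma coset_map_eq (g g' : G) : carrier H (invmx (val g) *m val g') ->
  coset_map H g = coset_map H g'.
Proof.
move=> h; apply: val_inj => /=; rewrite /lcoset.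
have ug := carrier_unit (group_eltP g); have ug' := carrier_unit (group_eltP g').
have uh := carrier_unit h.
have invh : invmx (invmx (val g) *m val g') = invmx (val g') *m val g.
  rewrite -[RHS](mulmxK uh) mulmxA -(mulmxA (invmx (val g'))) mulmxV // mulmx1.
  by rewrite mulVmx // mul1mx.
apply/seteqP; split=> x /= hx.
  rewrite (_ : _ *m _ = invmx (invmx (val g) *m val g') *m (invmx (val g) *m val x)).
    by apply: carrierM => //; exact: carrierV.
  by rewrite invh mulmxA mulmxK.
rewrite (_ : _ *m _ = (invmx (val g) *m val g') *m (invmx (val g') *m val x)).
  exact: carrierM.
by rewrite mulmxA mulmxK.
Qed.

Lemma coset_map_eq_inv (g g' : G) : coset_map H g = coset_map H g' ->
  carrier H (invmx (val g) *m val g').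
Proof.
move=> e.
have : lcoset H g' g' by rewrite /lcoset /= mulVmx ?(carrier_unit (group_eltP g')) //; exact: carrier1.
by have /= <- := congr1 val e.
Qed.

End SmoothManifolds.

(* Tangent vectors of [G] at [g], in the sense of derivations, are [g] times
   elements of the Lie algebra. *)
Definition infinitesimally_closed {R : realType} {n : nat} (G : matrix_group R n) : Prop :=
  forall g C : 'M[R]_n, carrier G g ->
  (forall F : 'M[R]_n -> R, Coo F ->
     (forall x y, carrier G x -> carrier G y -> F x = F y) -> 'D_C F g = 0) ->
  lie_algebra G (invmx g *m C).

(** Connectedness, in the form that lets a derivative vanishing along all curves t |-> g c(t) imply
    that a function is constant. *)
Definition generated_by_one_parameter {R : realType} {n : nat} (G : matrix_group R n) : Prop :=
  forall phi : G -> R,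
  (forall (g g' : G) X c (t : R), one_parameter G X c -> val g' = val g *m c t ->
     phi g' = phi g) ->
  forall g g' : G, phi g = phi g'.

(* A smooth local section of G -> G / H around the unit coset, cut off by chi
   so that both chi and S are defined on all matrices. *)
Definition slice {R : realType} {n : nat} (G H : set 'M[R]_n) : Prop :=
  exists (chi : 'M[R]_n -> R) (S : 'M[R]_n -> 'M[R]_n),
    [/\ Coo chi, Coo_mx S, chi 1%:M <> 0,
        forall g h, G g -> H h -> chi (g *m h) = chi g /\ S (g *m h) = S g &
        forall g, G g -> chi g <> 0 -> H (invmx g *m S g)].

(** * Functions, curves and tangent vectors on G / H *)

Section QuotientGeometry.
Context {R : realType} {n : nat}.
Local Notation M := 'M[R]_n.
Variables (G H : matrix_group R n).
Hypothesis HG : carrier H `<=` carrier G.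
Local Notation Q := (quotient_manifold G H).
Local Notation q := (@coset_map R n G H).
Let smQ := quotient_smooth_algebra G H.

Definition coset_invariant (F : M -> R) : Prop :=
  forall g h, carrier G g -> carrier H h -> F (g *m h) = F g.

(** The representative comes from choice, so the value is meaningful for coset-invariant F. *)
Definition descend (F : M -> R) : Q -> R :=
  fun p => F (val (sval (cid (coset_map_surj p)))).

Lemma descendE F (g : G) : coset_invariant F -> descend F (q g) = F (val g).
Proof.
move=> inv; rewrite /descend; case: cid => g' /= e.
have h := coset_map_eq_inv e.
have ug' := carrier_unit (group_eltP g').
by rewrite -[val g](mulKVmx ug') inv //; exact: group_eltP.
Qed.

Lemma smooth_descend F : Coo F -> coset_invariant F -> smooth (descend F).
Proof. by move=> cF inv; exists F => // x; exact: descendE. Qed.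

Lemma curve_quotient_derive (f : Q -> R) (F : M -> R) (c : R -> G) (t : R) (C : M) :
  Coo F -> (forall g : G, f (q g) = F (val g)) ->
  is_derive t (1 : R) (fun s => val (c s)) C ->
  is_derive t (1 : R) (fun s => f (q (c s))) ('D_C F (val (c t))).
Proof.
move=> cF eF dc; rewrite (_ : (fun s => _) = (fun s => F (val (c s)))).
  exact: is_derive_curve.
by apply/funext => s; rewrite eF.
Qed.

Definition curve_vector (c : R -> G) (t : R) : @functional R Q :=
  fun f => 'D_1 (fun s => f (q (c s))) t.

Lemma curve_vector_derivable (c : R -> G) (t : R) (C : M) (f : Q -> R) :
  is_derive t (1 : R) (fun s => val (c s)) C -> smooth f ->
  is_derive t (1 : R) (fun s => f (q (c s))) (curve_vector c t f).
Proof.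
move=> dc [F cF eF]; have [d _] := curve_quotient_derive cF eF dc.
exact: (DeriveDef d erefl).
Qed.

Lemma curve_vectorE (c : R -> G) (t : R) (C : M) (f : Q -> R) (F : M -> R) :
  is_derive t (1 : R) (fun s => val (c s)) C ->
  Coo F -> (forall g : G, f (q g) = F (val g)) ->
  curve_vector c t f = 'D_C F (val (c t)).
Proof. by move=> dc cF eF; have [_] := curve_quotient_derive cF eF dc. Qed.

Lemma tangent_curve (c : R -> G) (t : R) (C : M) :
  is_derive t (1 : R) (fun s => val (c s)) C ->
  tangent (q (c t) : Q) (curve_vector c t).
Proof.
move=> dc; split=> [a f g sf sg|f g sf sg].
  have df := curve_vector_derivable dc sf; have dg := curve_vector_derivable dc sg.
  have da := is_deriveM (is_derive_cst a t 1) df.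
  have [_] := is_deriveD da dg.
  by rewrite scaler0 addr0.
have df := curve_vector_derivable dc sf; have dg := curve_vector_derivable dc sg.
have [_ e] := is_deriveM df dg.
rewrite /curve_vector -/(curve_vector c t f) -/(curve_vector c t g) e.
by rewrite addrC /GRing.scale /= mulrC.
Qed.

Definition left_curve (g : G) phi (X : M) (op : one_parameter G X phi) (t : R) : G :=
  group_elt (carrierM (group_eltP g) (let: And3 _ Gp _ := op in Gp t)).

Definition right_curve (g : G) phi (X : M) (op : one_parameter G X phi) (t : R) : G :=
  group_elt (carrierM (let: And3 _ Gp _ := op in Gp t) (group_eltP g)).

Lemma left_curve_derive (g : G) phi X (op : one_parameter G X phi) (t : R) :
  is_derive t (1 : R) (fun s => val (left_curve g op s)) (val g *m phi t *m X).
Proof. by rewrite -mulmxA; exact: (is_derive_mulmxl _ (one_parameter_is_derive op t)). Qed.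

Lemma right_curve_derive (g : G) phi X (op : one_parameter G X phi) :
  is_derive (0 : R) (1 : R) (fun s => val (right_curve g op s)) (X *m val g).
Proof. by have [_ _ d0] := op; exact: (is_derive_mulmxr _ d0). Qed.

Lemma left_curve0 (g : G) phi X (op : one_parameter G X phi) : left_curve g op 0 = g.
Proof. by apply: val_inj => /=; rewrite (one_parameter0 op) mulmx1. Qed.

Lemma right_curve0 (g : G) phi X (op : one_parameter G X phi) : right_curve g op 0 = g.
Proof. by apply: val_inj => /=; rewrite (one_parameter0 op) mul1mx. Qed.

(** The infinitesimal action of X on G / H. These are global vector fields, on which nu can be
    evaluated smoothly, and at each point they realize all tangent vectors
    ([tangent_fundamental]). *)
Definition fundamental_field phi X (op : one_parameter G X phi) : @operator R Q :=
  fun f p => 'D_1 (fun t => f (coset_act (group_elt (let: And3 _ Gp _ := op in Gp t)) p)) 0.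

Lemma fundamental_fieldE phi X (op : one_parameter G X phi) (g : G) f :
  fundamental_field op f (q g) = curve_vector (right_curve g op) 0 f.
Proof.
rewrite /fundamental_field /curve_vector.
rewrite (_ : (fun t => f (coset_act _ _)) = (fun s => f (q (right_curve g op s)))) //.
apply/funext => t; rewrite coset_actE; by congr (f (q _)); apply: val_inj.
Qed.

Lemma fundamental_vector_field phi X (op : one_parameter G X phi) :
  vector_field (fundamental_field op).
Proof.
split=> [f [F cF eF]|p].
  (* This is the derivative of F at x in the direction X x, expanded in entries so that its
     smoothness in x is visible. *)
  exists (fun x => \sum_i \sum_j (X *m x) i j * 'D_(delta_mx i j) F x).
    apply: Coo_sum => i; apply: Coo_sum => j; apply: CooM; last exact: Coo_derive.
    apply: Coo_mx_mul; first exact: Coo_mx_cst.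
    by move=> k l; exact: Coo_coord.
  move=> g; rewrite fundamental_fieldE.
  rewrite (curve_vectorE (right_curve_derive g op) cF eF) right_curve0.
  by rewrite derive_mx_sum.
have [g <-] := coset_map_surj p.
have tv := tangent_curve (right_curve_derive g op).
rewrite right_curve0 in tv.
by apply: (tangent_ext smQ _ tv) => f sf; rewrite /at_point fundamental_fieldE.
Qed.

Hypothesis slH : slice G H.
Hypothesis infG : infinitesimally_closed G.

(* Near the base point f = f o S with S the section, so that a derivation u of
   the functions on G / H extends to the derivation F |-> u(F o S) of C^oo(G). *)
Lemma tangent_quotient (g0 : G) : exists2 g : G, q g = q g0 &
  forall u, tangent (q g0 : Q) u -> exists2 X, lie_algebra G X &
    forall (f : Q -> R) (F : M -> R), Coo F -> (forall x : G, f (q x) = F (val x)) ->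
      u f = 'D_(val g *m X) F (val g).
Proof.
have [chi [S [cchi cS chi1 inv sec]]] := slH.
have Gg0 := group_eltP g0; have ug0 := carrier_unit Gg0.
(* The section around the unit coset, carried to g0 by left translation. *)
pose T (x : M) := val g0 *m S (invmx (val g0) *m x).
have cT : Coo_mx T.
  apply: Coo_mx_mul => [|i j]; first exact: Coo_mx_cst.
  apply: (@Coo_comp_mx _ _ _ (fun x : M => S x i j)) => //.
  apply: Coo_mx_mul => [|k l]; [exact: Coo_mx_cst|exact: Coo_coord].
have invT : forall g h, carrier G g -> carrier H h -> T (g *m h) = T g.
  move=> g h Gg Hh; rewrite /T mulmxA.
  by have [_ ->] := inv (invmx (val g0) *m g) h (carrierM (carrierV Gg0) Gg) Hh.
pose X (x : M) := chi (invmx (val g0) *m x).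
have cX : Coo X.
  apply: (@Coo_comp_mx _ _ _ chi) => //.
  apply: Coo_mx_mul => [|k l]; [exact: Coo_mx_cst|exact: Coo_coord].
have invX : coset_invariant X.
  move=> g h Gg Hh; rewrite /X mulmxA.
  by have [-> _] := inv (invmx (val g0) *m g) h (carrierM (carrierV Gg0) Gg) Hh.
have secT (x : G) : X (val x) <> 0 -> carrier H (invmx (val x) *m T (val x)).
  have Gy : carrier G (invmx (val g0) *m val x).
    by apply: carrierM; [exact: carrierV|exact: group_eltP].
  have ux := carrier_unit (group_eltP x).
  move=> /(sec _ Gy); congr (carrier H _); rewrite /T mulmxA; congr (_ *m _).
  have uy := carrier_unit Gy.
  rewrite -[RHS](mulmxK uy) -[LHS]mul1mx; congr (_ *m _).
  by rewrite mulmxA mulmxK // mulVmx.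
have X0 : X (val g0) <> 0 by rewrite /X mulVmx.
have GT0 : carrier G (T (val g0)).
  rewrite -[T _](mulKVmx ug0); apply: carrierM => //; apply: HG; exact: secT.
(* The section meets the coset of g0 at T g0, which may differ from g0; hence the change of
   representative. *)
pose g : G := group_elt GT0.
have qg : q g = q g0 by apply/esym/coset_map_eq; exact: secT.
exists g => // u tu.
pose Tb (p : Q) : M := T (val (sval (cid (coset_map_surj p)))).
have TbE (x : G) : Tb (q x) = T (val x).
  rewrite /Tb; case: cid => y /= e; have h := coset_map_eq_inv e.
  have uy := carrier_unit (group_eltP y).
  by rewrite -[val x](mulKVmx uy) invT //; exact: group_eltP.
have sTb (K : M -> R) : Coo K -> smooth (fun p => K (Tb p)).
  move=> cK; exists (fun x => K (T x)); first exact: Coo_comp_mx.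
  by move=> x; rewrite TbE.
pose C : M := \matrix_(i, j) u (fun p => Tb p i j).
have sX := smooth_descend cX invX.
have uE (f : Q -> R) (F : M -> R) : Coo F -> (forall x : G, f (q x) = F (val x)) -> u f = 'D_C F (val g).
  move=> cF eF; have sf : smooth f by exists F.
  have := derivation_expand smQ tu sTb cF; rewrite TbE -/C => <-.
  (* f agrees with F o Tb only where the cut-off X is nonzero. Applying u to the products and
     cancelling X (val g0) localizes the equality. *)
  have e : (fun p => descend X p * f p) = (fun p => descend X p * F (Tb p)).
    apply/funext => p; have [x <-] := coset_map_surj p.
    rewrite TbE descendE //; have [->|/eqP n0] := eqVneq (X (val x)) 0; first by rewrite !mul0r.
    have h := secT x n0.
    have GTx : carrier G (T (val x)).
      rewrite -[T _](mulKVmx (carrier_unit (group_eltP x))).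
      by apply: carrierM; [exact: group_eltP|exact: HG].
    by rewrite (@coset_map_eq _ _ _ _ x (group_elt GTx)) // eF.
  have e1 := tangentM tu sX sf; have e2 := tangentM tu sX (sTb F cF).
  rewrite e e2 TbE descendE // in e1.
  have e3 : F (T (val g0)) = f (q g0) by rewrite -qg eF.
  rewrite e3 in e1; move/addrI: e1 => /(mulfI _) -> //; exact/eqP.
exists (invmx (val g) *m C).
  (* A function constant on G descends to a constant, which u kills; so C passes the test of
     [infG]. *)
  apply: infG => [|F cF Fc]; first exact: group_eltP.
  rewrite -(uE (fun=> F 1%:M)) //; first exact: (tangent_cst smQ _ tu).
  by move=> x; apply: Fc; [exact: carrier1|exact: group_eltP].
by move=> f F cF eF; rewrite mulKVmx ?(carrier_unit GT0) //; exact: uE.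
Qed.

(** The curve g phi(t) stays in the coset g H. *)
Lemma subgroup_direction (g : G) X (f : Q -> R) (F : M -> R) : lie_algebra H X ->
  Coo F -> (forall x : G, f (q x) = F (val x)) -> 'D_(val g *m X) F (val g) = 0.
Proof.
move=> [phi op] cF eF.
have opG : one_parameter G X phi by have [a b c] := op; split=> // t; exact/HG/b.
have := curve_vectorE (left_curve_derive g opG 0) cF eF.
rewrite left_curve0 (one_parameter0 op) mulmx1 => <-.
rewrite /curve_vector (_ : (fun s => _) = (fun=> f (q g))); first exact: derive_cst.
apply/funext => s; congr f; apply/esym/coset_map_eq => /=.
by rewrite mulKmx ?(carrier_unit (group_eltP g)) //; have [_ + _] := op; exact.
Qed.

Hypothesis dimQ : quotient_dim G H 2.

Lemma quotient_dim2 (p : Q) (u1 u2 u3 : @functional R Q) :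
  tangent p u1 -> tangent p u2 -> tangent p u3 ->
  exists a1 a2 a3 : R, (a1, a2, a3) <> (0, 0, 0) /\
    forall f, smooth f -> a1 * u1 f + a2 * u2 f + a3 * u3 f = 0.
Proof.
have [g0 <-] := coset_map_surj p.
have [g _ H1] := tangent_quotient g0.
move=> /H1 [X1 L1 E1] /H1 [X2 L2 E2] /H1 [X3 L3 E3].
have [V [W [LV LW dVW]]] := dimQ.
have WV : (W <= V)%VS.
  apply/subvP => X /LW [phi [a b c]]; apply/LV; exists phi; split=> // t; exact/HG/b.
(* These are dim W + 3 vectors in a space of dimension dim W + 2; hence X1, X2, X3 are dependent
   modulo W, whose elements do not act on functions of the coset. *)
pose s := [:: X1, X2, X3 & (vbasis W : seq _)].
have sV : (<< s >> <= V)%VS.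
  apply/span_subvP => x; rewrite !inE => /or4P[/eqP->|/eqP->|/eqP->|xW]; try exact/LV.
  by apply: (subvP WV); exact: vbasis_mem.
have nf : ~~ free s.
  apply/negP => fs; have := dimvS sV; rewrite (eqP fs) dVW /= size_tuple.
  by rewrite addn2 ltnn.
have [a1 [a2 [a3 [nz aW]]]] : exists a1 a2 a3 : R, (a1, a2, a3) <> (0, 0, 0) /\
    a1 *: X1 + a2 *: X2 + a3 *: X3 \in W.
  apply: contrapT => no; move/negP: nf; apply.
  have fb : free (vbasis W) := basis_free (vbasisP W).
  have key (a1 a2 a3 : R) : a1 *: X1 + a2 *: X2 + a3 *: X3 \in W -> (a1, a2, a3) = (0, 0, 0).
    by move=> h; apply: contrapT => nz; apply: no; exists a1, a2, a3.
  rewrite /s !free_cons fb andbT.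
  have sp : <<vbasis W>>%VS = W by apply/eqP; have /andP[] := vbasisP W.
  apply/and3P; split.
  - apply/negP; rewrite !span_cons sp => /memv_addP[y /vlineP[b ->] [z /memv_addP[y' /vlineP[c ->] [w wW ->]] e]].
    have := key 1 (- b) (- c); rewrite scale1r e !scaleNr.
    rewrite (_ : _ - _ - _ = w); last by rewrite [b *: X2 + _]addrC addrK [c *: X3 + w]addrC addrK.
    by move=> /(_ wW) [/eqP]; rewrite oner_eq0.
  - apply/negP; rewrite !span_cons sp => /memv_addP[y /vlineP[b ->] [w wW e]].
    have := key 0 1 (- b); rewrite scale0r add0r scale1r e scaleNr.
    by rewrite addrAC subrr add0r => /(_ wW) [/eqP]; rewrite oner_eq0.
  - apply/negP; rewrite sp => wW.
    have := key 0 0 1; rewrite !scale0r !add0r scale1r => /(_ wW) [/eqP].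
    by rewrite oner_eq0.
exists a1, a2, a3; split=> // f [F cF eF].
rewrite (E1 f F) // (E2 f F) // (E3 f F) //.
rewrite -!derive_dirZ // -!derive_dirD // !scalemxAr -!mulmxDr.
by apply: (subgroup_direction g _ cF eF); exact/LW.
Qed.

End QuotientGeometry.

(** * Unimodular coisotropic quotients *)

Section UnimodularQuotient.
Context {R : realType} {n : nat}.
Local Notation M := 'M[R]_n.
Variables (G H : matrix_group R n).
Hypothesis HG : carrier H `<=` carrier G.
Local Notation Q := (quotient_manifold G H).
Local Notation q := (@coset_map R n G H).
Hypothesis slH : slice G H.
Hypothesis infG : infinitesimally_closed G.
Hypothesis dimQ : quotient_dim G H 2.
Hypothesis genG : generated_by_one_parameter G.
Variable pi : @bracket R Q.
Hypothesis poi : poisson pi.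
Let smQ := quotient_smooth_algebra G H.

(** At g the vector g X is also (g X g^-1) g, the value of the fundamental field of the
    conjugate. *)
Lemma tangent_fundamental (p : Q) w : tangent p w ->
  exists phi X (op : one_parameter G X phi),
    forall f, smooth f -> w f = fundamental_field op f p.
Proof.
have [g0 <-] := coset_map_surj p.
have [g qg tg] := tangent_quotient HG slH infG g0.
move=> /tg [X [phi op] E].
have op' := one_parameter_conj op (group_eltP g).
exists (fun t => val g *m phi t *m invmx (val g)), (val g *m X *m invmx (val g)), op'.
move=> f [F cF eF]; rewrite (E f F) // -qg fundamental_fieldE.
rewrite (curve_vectorE (right_curve_derive g op') cF eF) right_curve0.
by rewrite mulmxKV // (carrier_unit (group_eltP g)).
Qed.

Lemma unimodular_vanish : unimodular pi ->
  (forall f g : Q -> R, smooth f -> smooth g -> forall p0 : G, val p0 = 1%:M -> pi f g (q p0) = 0) ->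
  forall (f g : Q -> R) p, smooth f -> smooth g -> pi f g p = 0.
Proof.
move=> [nu [D [vol mod [k sk Dk]]]] pi1.
have [bi _] := poi.
have dim2 := quotient_dim2 HG slH infG dimQ.
have [F hF] := choice (poisson_density dim2 bi vol).
have hF1 p f w : smooth f -> tangent p w -> nu p (at_point (pi f) p) w = - F p * w f.
  by have [+ _] := hF p; exact.
have hF1' x f w := @hF1 x f w.
have hF2 p : F p = 0 <-> forall f g, smooth f -> smooth g -> pi f g p = 0.
  by have [_] := hF p.
suff F0 p : F p = 0 by move=> f g p sf sg; exact: (iffLR (hF2 p) (F0 p) f g sf sg).
pose phi (g : G) := F (q g) ^+ 2 * expR (2 * k (q g)).
suff phi0 g : phi g = 0.
  have [g <-] := coset_map_surj p; have /eqP := phi0 g.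
  by rewrite mulf_eq0 expR_eq0 orbF sqrf_eq0 => /eqP.
pose e : G := group_elt (carrier1 G).
have -> : phi g = phi e.
  move: g; suff H1 : forall (g g' : G) X c (t : R), one_parameter G X c ->
      val g' = val g *m c t -> phi g' = phi g.
    by move=> g; exact: genG.
  move=> g g' X c t op e'.
  pose ga := left_curve g op.
  have -> : g' = ga t by apply: val_inj.
  have -> : g = ga 0 by rewrite /ga left_curve0.
  apply: (@is_derive_0_is_cst _ (fun s => phi (ga s))) => {e' g' t} s.
  (* Such u and a exist because nu vanishes nowhere. Extending u to a fundamental field makes E =
     Y(a) a denominator for F near this point. *)
  have [u [a [tu sa ua]]] : exists u a, [/\ tangent (q (ga s) : Q) u, smooth a & u a <> 0].
    have [_ /(_ (q (ga s))) [u [v [tu tv uv0]]]] := vol.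
    have [a [b [sa sb ab]]] := form_dual vol tu tv uv0.
    apply: contrapT => no; apply: ab.
    have z w d : tangent (q (ga s) : Q) w -> smooth d -> w d = 0.
      by move=> tw sc; apply: contrapT => nz; apply: no; exists w, d.
    by rewrite (z u a) // (z u b) // !mul0r subrr.
  have [psi [Y [opY uE]]] := tangent_fundamental tu.
  pose E := fundamental_field opY a.
  have vY := fundamental_vector_field H opY.
  have vX : vector_field (pi a) by case: bi => _; exact.
  have sE : smooth E by have [+ _] := vY; exact.
  (* m = - nu(X_a, Y), put in the shape of [smooth_lin]. *)
  pose m p := (-1) * eval_form nu (pi a) (fundamental_field opY) p + 0.
  have sm : smooth m.
    apply: (smooth_lin smQ) => //; last exact: (smooth_cst smQ).
    by have [[sv _ _ _] _] := vol; exact: sv.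
  have mFE x : m x = F x * E x.
    rewrite /m /eval_form addr0 hF1 // ?mulN1r ?mulNr ?opprK //.
    by have [_] := vY; exact.
  have E0 : E (q (ga s)) <> 0 by rewrite /E -uE.
  have dc := left_curve_derive g op s.
  have tw := tangent_curve H dc.
  have tr := density_transport smQ bi vol poi mod sk Dk hF1' hF2 sE sm mFE E0 tw.
  have dE := curve_vector_derivable dc sE.
  have dm := curve_vector_derivable dc sm.
  have dk := curve_vector_derivable dc sk.
  set w := curve_vector _ _ in tr dE dm dk.
  have Ene : E (q (ga s)) != 0 by exact/eqP.
  have cE : {for s, continuous (fun r => E (q (ga r)))}.
    by apply: differentiable_continuous; apply/derivable1_diffP; have [] := dE.
  have dV : is_derive s (1 : R) (fun r => (E (q (ga r)))^-1) (- (E (q (ga s))) ^- 2 *: w E).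
    have [d1 <-] := dE.
    by apply: DeriveDef; [exact: (@derivableV _ _ (fun r => E (q (ga r))) s 1 Ene d1)|exact: (@deriveV _ _ (fun r => E (q (ga r))) s 1 Ene d1)].
  have dQ := is_deriveM dm dV.
  have dQ2 := is_deriveM dQ dQ.
  have d2k := is_deriveM (is_derive_cst (2 : R) s (1 : R)) dk.
  have dexp := @is_derive1_comp _ expR _ s _ _ (is_derive_expR _) d2k.
  have dphi := is_deriveM dQ2 dexp.
  apply: (@near_eq_is_derive _ _ _ (fun r => (m (q (ga r)) * (E (q (ga r)))^-1) * (m (q (ga r)) * (E (q (ga r)))^-1) * expR (2 * k (q (ga r))))).
    have : \forall r \near s, E (q (ga r)) != 0.
      have oo : open [set x : R | x != 0] by exact: open_neq.
      exact: (cE _ (open_nbhs_nbhs (conj oo Ene))).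
    apply: filterS => r nz; rewrite /phi mFE mulfK //.
  apply: (is_derive_eq dphi).
  rewrite /GRing.scale /= !fctE.
  have -> : m (q (ga s)) * (E (q (ga s)))^-1 = F (q (ga s)) by rewrite mFE mulfK.
  set FF := F _ in tr *. set EE := E _ in Ene *; set kk := expR _.
  have mm : m (q (ga s)) = FF * EE by rewrite mFE.
  rewrite mm in tr *.
  have tr' : FF * (w m) = FF * (FF * w E - w k * (FF * EE)) by lra.
  (* The derivative of phi is 2 exp(2 k) / E times F (w m - F w E + w k m), which
     [density_transport] shows to vanish. *)
  apply: (@etrans _ _ (2 * kk / EE * (FF * w m - FF * (FF * w E - w k * (FF * EE))))); first by field.
  by rewrite tr' subrr mulr0.
rewrite /phi (iffRL (hF2 (q e))) ?expr0n ?mul0r // => f h sf sh.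
exact: pi1.
Qed.

End UnimodularQuotient.

(* [omega A B] stands for a bivector at a point of G evaluated on the
   covectors [tr (A -)] and [tr (B -)] on the Lie algebra. *)
Definition orbit_rigid {R : realType} {n : nat} (G : matrix_group R n) (w : 'M[R]_n) : Prop :=
  forall omega : 'M[R]_n -> 'M[R]_n -> R,
  (forall a A B C, omega (a *: A + B) C = a * omega A C + omega B C) ->
  (forall A B, omega A B = - omega B A) ->
  (forall A B, (forall X, lie_algebra G X -> \tr (A *m X) = 0) -> omega A B = 0) ->
  (forall y A B, carrier G y -> let w' := y *m w *m invmx y in
     omega (w' *m A - A *m w') (w' *m B - B *m w') = 0) ->
  forall A B, omega A B = 0.

(** * Vanishing of a Poisson-Lie structure with a zero quotient *)

Section PoissonLie.
Context {R : realType} {n : nat}.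
Local Notation M := 'M[R]_n.
Variables (G : matrix_group R n) (piG : @bracket R (group_manifold G)).
Local Notation GM := (group_manifold G).
Hypothesis pl : poisson_lie piG.
Let smG := group_smooth_algebra G.

Lemma poisson_lie_mul (f g : GM -> R) (x y : G) : smooth f -> smooth g ->
  piG f g (gmul x y) = piG (fun z => f (gmul z y)) (fun z => g (gmul z y)) x
                     + piG (fun z => f (gmul x z)) (fun z => g (gmul x z)) y.
Proof. by move=> sf sg; have [_ /(_ f g sf sg (x, y)) /= <-] := pl. Qed.

(** At (e, e) multiplicativity reads Pi(e) = Pi(e) + Pi(e). *)
Lemma poisson_lie_one (f g : GM -> R) (e : G) : val e = 1%:M ->
  smooth f -> smooth g -> piG f g e = 0.
Proof.
move=> e1 sf sg; have := poisson_lie_mul e e sf sg.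
have er z : gmul z e = z by apply: val_inj; rewrite /= e1 mulmx1.
have el z : gmul e z = z by apply: val_inj; rewrite /= e1 mul1mx.
rewrite er.
have E h : (fun z => h (gmul z e)) = h :> (G -> R) by apply/funext => z; rewrite er.
have E' h : (fun z => h (gmul e z)) = h :> (G -> R) by apply/funext => z; rewrite el.
by rewrite !E !E'; lra.
Qed.

Section Quotient.
Variables (H : matrix_group R n) (pi : @bracket R (quotient_manifold G H)).
Local Notation Q := (quotient_manifold G H).
Local Notation q := (@coset_map R n G H).
Hypothesis HG : carrier H `<=` carrier G.
Hypothesis pm : poisson_map piG pi (fun g : GM => q g : Q).
Hypothesis pi0 : forall (f g : Q -> R) p, smooth f -> smooth g -> pi f g p = 0.
Hypothesis infG : infinitesimally_closed G.
Hypothesis detG : forall x, carrier G x -> \det x = 1.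

(** The functions z |-> f (q (z y)) are those invariant under right translation by y H y^-1. In the
    multiplicativity formula at x y, the left-hand side and the term in the second variable are
    brackets of pullbacks by q, which vanish since pi = 0. *)
Lemma right_translates_commute (f g : Q -> R) (x y : G) : smooth f -> smooth g ->
  piG (fun z => f (q (gmul z y))) (fun z => g (q (gmul z y))) x = 0.
Proof.
have act (h : Q -> R) : smooth h -> @smooth R Q (fun p => h (coset_act x p)).
  move=> [F cF eF]; exists (fun z => F (val x *m z)).
    apply: (Coo_comp_mx cF); apply: Coo_mx_mul => [|i j]; first exact: Coo_mx_cst.
    exact: Coo_coord.
  by move=> z; rewrite coset_actE eF.
move=> sf sg.
have := @poisson_lie_mul (fun z => f (q z)) (fun z => g (q z)) x y sf sg.
have := pm sf sg (gmul x y); rewrite /= pi0 // => ->.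
have E h : (fun z => h (q (gmul x z))) = (fun z => (fun p => h (coset_act x p)) (q z)) :> (G -> R).
  by apply/funext => z; rewrite coset_actE.
rewrite (E f) (E g) (pm (act f sf) (act g sg) y) pi0 //; try exact: act.
by rewrite addr0 => <-.
Qed.

Variable w : M.
Hypothesis Hw : forall h, carrier H h -> h *m w = w *m h.
Hypothesis rig : orbit_rigid G w.

(** The adjugate is polynomial in the entries, so it extends inversion on G to a smooth function of
    all matrices. *)
Let adjG x : carrier G x -> \adj x = invmx x.
Proof. by move=> Gx; rewrite /invmx (carrier_unit Gx) detG // invr1 scale1r. Qed.

Let tG (f : GM -> R) x : smooth f -> tangent x (at_point (piG f) x).
Proof. by move=> sf; have [[[_ /(_ f sf) [_ +]] _] _] := pl; exact. Qed.

Let anti (f g : GM -> R) x : smooth f -> smooth g -> piG f g x = - piG g f x.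
Proof. by move=> sf sg; have [[[+ _] _] _] := pl; exact. Qed.

Lemma tangent_group (x : G) v : tangent (x : GM) v -> exists2 X, lie_algebra G X &
  forall (f : GM -> R) F, Coo F -> (forall z : G, f z = F (val z)) ->
    v f = 'D_(val x *m X) F (val x).
Proof.
move=> tv; have ux := carrier_unit (group_eltP x).
have sv (K : M -> R) : Coo K -> @smooth R GM (fun z : GM => K (val (z : G))).
  by move=> cK; exists K.
have D (F : M -> R) (cF : Coo F) := derivation_expand smG tv sv cF.
exists (invmx (val x) *m \matrix_(i, j) v (fun z : G => val z i j)).
  apply: infG => [|F cF Fc]; first exact: group_eltP.
  rewrite -D // -[RHS](tangent_cst smG (F 1%:M) tv); congr v; apply/funext => z.
  by apply: Fc; [exact: group_eltP|exact: carrier1].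
move=> f F cF eF; rewrite mulKVmx // -D //; congr v.
by apply/funext => z; rewrite eF.
Qed.

(** Covectors at x are represented by the functions z |-> tr (A x^-1 z), with differential X |-> tr
    (A X) after left translation; [om] is the bivector at x read on them. Rigidity of the orbit of w
    gives om = 0. *)
Lemma poisson_lie_vanish (f g : GM -> R) (x : G) : smooth f -> smooth g -> piG f g x = 0.
Proof.
have Gx := group_eltP x; have ux := carrier_unit Gx.
pose L A (z : M) := \tr (A *m (invmx (val x) *m z)).
pose l A : GM -> R := fun z => L A (val (z : G)).
have cL A : Coo (L A).
  apply: Coo_tr; apply: Coo_mx_mul; first exact: Coo_mx_cst.
  by apply: Coo_mx_mul => [|i j]; [exact: Coo_mx_cst|exact: Coo_coord].
have sl A : smooth (l A) by exists (L A).
have DL A C z : 'D_C (L A) z = \tr (A *m (invmx (val x) *m C)).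
  have d1 := is_derive_line (cL A) z C 0.
  have E : (fun s : R => L A (z + s *: C)) = (fun s => L A z + s * L A C).
    apply/funext => s; rewrite /L !mulmxDr mxtraceD; congr (_ + _).
    by rewrite -!scalemxAr mxtraceZ.
  have d2 := is_deriveD (is_derive_cst (L A z) (0 : R) (1 : R))
    (is_deriveM (is_derive_id (0 : R) (1 : R)) (is_derive_cst (L A C) (0 : R) (1 : R))).
  rewrite E scale0r addr0 in d1; have [_ <-] := d1; have [_] := d2.
  by rewrite add0r scaler0 add0r [_ *: _]mulr1.
have val_l (h : GM -> R) F A v : tangent (x : GM) v -> Coo F -> (forall z : G, h z = F (val z)) ->
    (forall X, lie_algebra G X -> 'D_(val x *m X) F (val x) = \tr (A *m X)) ->
    v h = v (l A).
  move=> /tangent_group [X LX E] cF eF cov.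
  by rewrite (E h F) // (E (l A) (L A)) // DL mulKmx // cov.
pose om A B := piG (l A) (l B) x.
have om_val (h k : GM -> R) F K A B : Coo F -> (forall z : G, h z = F (val z)) ->
    Coo K -> (forall z : G, k z = K (val z)) ->
    (forall X, lie_algebra G X -> 'D_(val x *m X) F (val x) = \tr (A *m X)) ->
    (forall X, lie_algebra G X -> 'D_(val x *m X) K (val x) = \tr (B *m X)) ->
    piG h k x = om A B.
  move=> cF eF cK eK covF covK.
  have sh : smooth h by exists F.
  have sk : smooth k by exists K.
  rewrite -[LHS]/(at_point (piG h) x k) (val_l k K B _ (tG x sh) cK eK covK).
  rewrite /at_point anti // -[piG _ h x]/(at_point (piG (l B)) x h).
  rewrite (val_l h F A _ (tG x (sl B)) cF eF covF) /at_point /om [RHS]anti //.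
have om0 : forall A B, om A B = 0.
  apply: rig.
  - move=> a A B C; rewrite /om anti // [piG (l A) _ _]anti // [piG (l B) _ _]anti //.
    rewrite -[piG _ _ _]/(at_point (piG (l C)) x (l (a *: A + B))).
    have -> : l (a *: A + B) = (fun z => a * l A z + l B z).
      by apply/funext => z; rewrite /l /L mulmxDl mxtraceD -scalemxAl mxtraceZ.
    by rewrite (tangent_lin _ (tG x (sl C))) // /at_point; lra.
  - by move=> A B; exact: anti.
  - move=> A B hA; rewrite /om anti // -[piG _ _ _]/(at_point (piG (l B)) x (l A)).
    have [X LX E] := tangent_group (tG x (sl B)).
    by rewrite (E (l A) (L A)) // DL mulKmx // hA // oppr0.
  move=> y A B Gy w'; have uy := carrier_unit Gy.
  (* The function z |-> tr (x A x^-1 z w z^-1) is right H-invariant because w commutes with H;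
     conjugating A by x makes its differential at x the covector of the commutator of w and A. *)
  pose P (A : M) (w : M) (z : M) := \tr (val x *m A *m invmx (val x) *m (z *m w *m \adj z)).
  have cP A1 w1 : Coo (P A1 w1).
    apply: Coo_tr; apply: Coo_mx_mul; first exact: Coo_mx_cst.
    have cid : Coo_mx (fun z : M => z) by move=> i j; exact: Coo_coord.
    apply: Coo_mx_mul; last exact: Coo_mx_adj.
    by apply: Coo_mx_mul => //; exact: Coo_mx_cst.
  have invP A1 : coset_invariant G H (P A1 w).
    move=> z h Gz Hh; have uz := carrier_unit Gz; have uh := carrier_unit Hh.
    rewrite /P (adjG (carrierM Gz (HG Hh))) (adjG Gz) (invmx_mul uz uh); congr (\tr (_ *m _)).
    by rewrite -(mulmxA z h) (Hw Hh) !mulmxA mulmxK.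
  have covP A1 X : lie_algebra G X ->
      'D_(val x *m X) (P A1 w') (val x) = \tr ((w' *m A1 - A1 *m w') *m X).
    move=> [phi op]; have [_ Gp d0] := op.
    have d1 := is_derive_curve (cP A1 w') (is_derive_mulmxl (val x) d0).
    rewrite (one_parameter0 op) mulmx1 in d1; have [_ <-] := d1.
    have dphi := is_derive_mulmx (is_derive_mulmxr w' d0) (one_parameter_inv_is_derive op).
    have [_] := is_derive_mxtrace (is_derive_mulmxl A1 dphi).
    rewrite oppr0 (one_parameter0 op) mulmx1 mul1mx.
    have -> : (fun s : R => \tr (A1 *m (phi s *m w' *m phi (- s)))) = (fun s => P A1 w' (val x *m phi s)).
      apply/funext => s; have us := carrier_unit (Gp s).
      rewrite /P (adjG (carrierM Gx (Gp s))) (invmx_mul ux us) (one_parameterN op).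
      rewrite -!mulmxA mulKmx // [in RHS]mxtrace_mulC -!mulmxA; congr (\tr _).
      by rewrite mulVmx // mulmx1.
    move=> ->.
    have E1 : \tr (A1 *m (X *m w')) = \tr (w' *m A1 *m X) by rewrite mulmxA mxtrace_mulC mulmxA.
    have E2 : \tr (A1 *m (w' *m - X)) = - \tr (A1 *m w' *m X) by rewrite !mulmxN raddfN /= mulmxA.
    by rewrite mulmxDr mxtraceD E1 E2 mulmxBl [RHS]raddfB.
  pose gy : G := group_elt Gy.
  (* Right translation by y replaces w by w' = y w y^-1. *)
  have e A1 (z : G) : descend (P A1 w) (q (gmul z gy)) = P A1 w' (val z).
    rewrite descendE // /P /= (adjG (carrierM (group_eltP z) Gy)) (adjG (group_eltP z)).
    rewrite (invmx_mul (carrier_unit (group_eltP z)) uy); congr (\tr (_ *m _)).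
    by rewrite /w' !mulmxA.
  have := @right_translates_commute (descend (P A w)) (descend (P B w)) x gy.
  rewrite (om_val _ _ (P A w') (P B w') (w' *m A - A *m w') (w' *m B - B *m w')) //.
  - apply; apply: smooth_descend => //.
  - exact: covP.
  - exact: covP.
move=> [F cF eF] [K cK eK].
(* The differential of F at x, left-translated to the unit and represented through the trace
   pairing. *)
pose N (F : M -> R) : M := (\matrix_(j, i) 'D_(delta_mx i j) F (val x)) *m val x.
have covN (F1 : M -> R) X : Coo F1 -> 'D_(val x *m X) F1 (val x) = \tr (N F1 *m X).
  move=> cF1; rewrite derive_mx_sum // /N -mulmxA /mxtrace exchange_big /=.
  apply: eq_bigr => j _; rewrite [in RHS]mxE; apply: eq_bigr => i _.
  by rewrite [in RHS]mxE mulrC.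
by rewrite (om_val f g F K (N F) (N K)) // => X _; exact: covN.
Qed.

End Quotient.
End PoissonLie.

Section Reduction.
Context {R : realType} {n : nat}.
Variables (G H : matrix_group R n).
Hypothesis HG : carrier H `<=` carrier G.
Hypothesis infG : infinitesimally_closed G.
Hypothesis detG : forall x, carrier G x -> \det x = 1.
Hypothesis genG : generated_by_one_parameter G.

(** Common to both groups: what must be checked case by case is isolated in the hypotheses, and w
    will be a generator of the Lie algebra of H. *)
Lemma coisotropic_not_unimodular (piG : @bracket R (group_manifold G))
    (pi : @bracket R (quotient_manifold G H)) (w : 'M[R]_n) :
  quotient_dim G H 2 -> slice G H ->
  (forall h, carrier H h -> h *m w = w *m h) -> orbit_rigid G w ->
  poisson_lie piG -> nonzero_bivector piG -> coisotropic_homogeneous piG pi ->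
  ~ unimodular pi.
Proof.
move=> dimQ sl Hw rig pl [f [g [x [sf sg fg]]]] [poi _ pm] um; apply: fg.
have pi1 (f0 g0 : quotient_manifold G H -> R) : smooth f0 -> smooth g0 ->
    forall p0 : G, val p0 = 1%:M -> pi f0 g0 (coset_map H p0) = 0.
  move=> sf0 sg0 p0 p01; rewrite -(pm f0 g0 sf0 sg0 p0).
  exact: (poisson_lie_one pl p01).
have pi0 := unimodular_vanish HG sl infG dimQ genG poi um pi1.
exact: (poisson_lie_vanish pl HG pm pi0 infG detG Hw rig).
Qed.

End Reduction.

(** * SL(2) *)

Section ThreeDimensional.
Context {R : realType} {vT : vectType R}.

Lemma dim3_basis (V : {vspace vT}) (v1 v2 v3 : vT) :
  v1 \in V -> v2 \in V -> v3 \in V ->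
  (forall x, x \in V -> exists a b c, x = a *: v1 + b *: v2 + c *: v3) ->
  (forall a b c : R, a *: v1 + b *: v2 + c *: v3 = 0 -> [/\ a = 0, b = 0 & c = 0]) ->
  \dim V = 3%N.
Proof.
move=> V1 V2 V3 gen ind; pose s := [:: v1; v2; v3].
have sV : << s >>%VS = V.
  apply/eqP; rewrite eqEsubv; apply/andP; split.
    by apply/span_subvP => x; rewrite !inE => /or3P[] /eqP ->.
  apply/subvP => x /gen [a [b [c ->]]].
  by rewrite !memvD ?memvZ // memv_span ?inE ?eqxx ?orbT.
have fs : free s.
  rewrite /s !free_cons nil_free andbT; apply/and3P; split; apply/negP.
  - rewrite !span_cons span_nil addv0 => /memv_addP[y /vlineP[b ->] [z /vlineP[c ->] e]].
    have := ind 1 (- b) (- c); rewrite scale1r e !scaleNr.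
    case; last by move/eqP; rewrite oner_eq0.
    by rewrite [b *: v2 + _]addrC addrK subrr.
  - rewrite !span_cons span_nil addv0 => /vlineP[c e].
    have := ind 0 1 (- c); rewrite scale0r scale1r e scaleNr add0r subrr.
    by case=> // _ /eqP; rewrite oner_eq0.
  - rewrite span_nil memv0 => /eqP e.
    have := ind 0 0 1; rewrite !scale0r e scaler0 !addr0.
    by case=> // _ _ /eqP; rewrite oner_eq0.
by rewrite -sV (eqP fs).
Qed.

Lemma dim1_line (W : {vspace vT}) : \dim W = 1%N ->
  exists2 w, w != 0 & forall x, x \in W <-> exists c, x = c *: w.
Proof.
move=> d1; pose w := vpick W; have w0 : w != 0.
  by rewrite vpick0 -dimv_eq0 d1.
have e : <[w]>%VS = W.
  by apply/eqP; rewrite eqEdim d1 dim_vline w0 -memvE memv_pick.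
exists w => // x; rewrite -e; split; first by move=> /vlineP.
by move=> [c ->]; exact: memvZ (memv_line w).
Qed.

End ThreeDimensional.

Section TwoByTwo.
Context {R : realType}.
Implicit Types (a b c d t : R) (A B X : 'M[R]_2).

Definition mx2 a b c d : 'M[R]_2 :=
  \matrix_(i, j) (if i == 0 then if j == 0 then a else b else if j == 0 then c else d).

Lemma ord2E (i : 'I_2) : i = 0 \/ i = 1.
Proof. by case: i => [[|[|//]] p]; [left|right]; exact: val_inj. Qed.

Lemma mx2P A B : A 0 0 = B 0 0 -> A 0 1 = B 0 1 -> A 1 0 = B 1 0 -> A 1 1 = B 1 1 ->
  A = B.
Proof.
by move=> *; apply/matrixP => i j; case: (ord2E i) => ->; case: (ord2E j) => ->.
Qed.

Lemma mx2E A : A = mx2 (A 0 0) (A 0 1) (A 1 0) (A 1 1).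
Proof. by apply: mx2P; rewrite mxE. Qed.

Lemma mx2_inj a b c d a' b' c' d' : mx2 a b c d = mx2 a' b' c' d' ->
  [/\ a = a', b = b', c = c' & d = d'].
Proof.
by move=> /matrixP e; have := (e 0 0, e 0 1, e 1 0, e 1 1); rewrite !mxE => -[[[]]].
Qed.

Lemma mulmx2 a b c d a' b' c' d' :
  mx2 a b c d *m mx2 a' b' c' d' =
  mx2 (a * a' + b * c') (a * b' + b * d') (c * a' + d * c') (c * b' + d * d').
Proof. by apply: mx2P; rewrite !mxE big_ord_recl big_ord1 !mxE. Qed.

Lemma addmx2 a b c d a' b' c' d' :
  mx2 a b c d + mx2 a' b' c' d' = mx2 (a + a') (b + b') (c + c') (d + d').
Proof. by apply: mx2P; rewrite !mxE. Qed.

Lemma oppmx2 a b c d : - mx2 a b c d = mx2 (- a) (- b) (- c) (- d).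
Proof. by apply: mx2P; rewrite !mxE. Qed.

Lemma scalemx2 t a b c d : t *: mx2 a b c d = mx2 (t * a) (t * b) (t * c) (t * d).
Proof. by apply: mx2P; rewrite !mxE. Qed.

Lemma mx2_0 : 0 = mx2 0 0 0 0. Proof. by apply: mx2P; rewrite !mxE. Qed.

Lemma mx2_1 : 1%:M = mx2 1 0 0 1. Proof. by apply: mx2P; rewrite !mxE. Qed.

Lemma mxtrace2 A : \tr A = A 0 0 + A 1 1.
Proof. by rewrite /mxtrace big_ord_recl big_ord1; congr (_ + A _ _); exact: val_inj. Qed.

Lemma det_mx2 A : \det A = A 0 0 * A 1 1 - A 0 1 * A 1 0.
Proof.
rewrite (expand_det_row _ 0) big_ord_recl big_ord1 /cofactor !det_mx11 !mxE /=.
have -> : lift 0 0 = 1 :> 'I_2 by exact: val_inj.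
have -> : lift 1 0 = 0 :> 'I_2 by exact: val_inj.
by rewrite expr0 expr1; ring.
Qed.

Lemma invmx2 a b c d : a * d - b * c = 1 -> invmx (mx2 a b c d) = mx2 d (- b) (- c) a.
Proof.
move=> e; have u : mx2 a b c d \in unitmx by rewrite unitmxE det_mx2 !mxE /= e unitr1.
rewrite -[RHS](mulKmx u) mulmx2 -[LHS]mulmx1 mx2_1; congr (_ *m mx2 _ _ _ _); lra.
Qed.

Lemma is_derive_mx2 (a b c d : R -> R) (t a' b' c' d' : R) :
  is_derive t (1 : R) a a' -> is_derive t (1 : R) b b' ->
  is_derive t (1 : R) c c' -> is_derive t (1 : R) d d' ->
  is_derive t (1 : R) (fun s => mx2 (a s) (b s) (c s) (d s)) (mx2 a' b' c' d').
Proof.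
move=> *; apply/is_derive_mxP => i j.
rewrite mxE (_ : (fun s => _) = (fun s => if i == 0 then if j == 0 then a s else b s else if j == 0 then c s else d s)).
  by case: (i == 0); case: (j == 0).
by apply/funext => s; rewrite mxE.
Qed.

Lemma Coo_mx2 {V : normedModType R} (a b c d : V -> R) :
  Coo a -> Coo b -> Coo c -> Coo d -> Coo_mx (fun x => mx2 (a x) (b x) (c x) (d x)).
Proof.
move=> ca cb cc cd i j.
rewrite (_ : (fun s => mx2 (a s) (b s) (c s) (d s) i j) = (fun s => if i == 0 then if j == 0 then a s else b s else if j == 0 then c s else d s)).
  by case: (i == 0); case: (j == 0).
by apply/funext => s; rewrite mxE.
Qed.

End TwoByTwo.

(** * The group SL(2) and its Lie algebra *)

Section SL2.
Context {R : realType}.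
Implicit Types (a b c d t : R) (A B C X g : 'M[R]_2).
Local Notation G := (SL R 2).

Lemma SL2P a b c d : carrier G (mx2 a b c d) <-> a * d - b * c = 1.
Proof. by rewrite /= /SL_set /= det_mx2 !mxE. Qed.

Lemma derive_det2 C g : 'D_C (fun x : 'M[R]_2 => \det x) g
  = C 0 0 * g 1 1 + g 0 0 * C 1 1 - (C 0 1 * g 1 0 + g 0 1 * C 1 0).
Proof.
rewrite (_ : (fun x => _) = (fun x : 'M[R]_2 => x 0 0 * x 1 1 - x 0 1 * x 1 0)); last first.
  by apply/funext => x; exact: det_mx2.
have d i j : is_derive g C (fun x : 'M[R]_2 => x i j) (C i j).
  by move: i j; apply: (iffLR (is_derive_mxP id _ _ _)); exact: is_derive_id.
have [_ ->] := is_deriveB (is_deriveM (d 0 0) (d 1 1)) (is_deriveM (d 0 1) (d 1 0)).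
by rewrite /GRing.scale /=; ring.
Qed.

Lemma Coo_id_mx {n} : Coo_mx (fun x : 'M[R]_n => x).
Proof. by move=> i j; exact: Coo_coord. Qed.

Lemma SL2_lie_traceless X : lie_algebra G X -> X 0 0 + X 1 1 = 0.
Proof.
move=> [phi op]; have [_ Gp d0] := op.
have [_] := is_derive_curve (Coo_det Coo_id_mx) d0.
rewrite (_ : (fun s => _) = (fun=> 1)); last by apply/funext => s; exact: Gp.
rewrite derive_cst (one_parameter0 op) derive_det2 !mxE /= => ->.
by lra.
Qed.

(** The hypothesis says that the matrix has square zero, so its exponential is 1 + t X. Nilpotents
    span sl(2) and their exponentials generate SL(2), so no other exponentials are needed for these
    two facts. *)
Lemma nilpotent_one_parameter a b c : a * a + b * c = 0 ->
  one_parameter G (mx2 a b c (- a)) (fun t => mx2 (1 + t * a) (t * b) (t * c) (1 - t * a)).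
Proof.
move=> e; split.
- move=> s t; rewrite mulmx2.
  have e1 : s * t * (a * a + b * c) = 0 by rewrite e mulr0.
  by congr mx2; lra.
- move=> t; apply/SL2P; have e1 : t * t * (a * a + b * c) = 0 by rewrite e mulr0.
  lra.
- have dz (x y : R) : is_derive (0 : R) (1 : R) (fun t => x + t * y) y.
    have [d v] := is_deriveD (is_derive_cst x (0 : R) (1 : R)) (is_deriveM (is_derive_id (0:R) (1:R)) (is_derive_cst y (0:R) (1:R))).
    apply: DeriveDef; first exact: d.
    by rewrite v add0r scaler0 add0r [_ *: _]mulr1.
  have dz0 (y : R) : is_derive (0 : R) (1 : R) (fun t => t * y) y.
    by have := dz 0 y; under eq_fun do rewrite add0r.
  apply: is_derive_mx2 => //.
  by have := dz 1 (- a); under eq_fun do rewrite mulrN.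
Qed.

Lemma SL2_lie_algebraP (V : {vspace 'M[R]_2}) :
  (forall X, lie_algebra G X <-> X \in V) ->
  forall X, lie_algebra G X <-> X 0 0 + X 1 1 = 0.
Proof.
move=> LV X; split; first exact: SL2_lie_traceless.
move=> tr0; apply/LV.
have N a b c : a * a + b * c = 0 -> mx2 a b c (- a) \in V.
  by move=> e; apply/LV; eexists; exact: (nilpotent_one_parameter e).
(* A sum of multiples of three nilpotents; the velocities are closed under such sums because they
   form the subspace V. *)
have -> : X = X 0 0 *: mx2 1 (- 1) 1 (- 1) + (X 0 1 + X 0 0) *: mx2 0 1 0 (- 0)
            + (X 1 0 - X 0 0) *: mx2 0 0 1 (- 0).
  rewrite [LHS]mx2E !scalemx2 !addmx2; congr mx2; lra.
by rewrite !memvD ?memvZ // N //; lra.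
Qed.

Lemma SL2_dim_lie (V : {vspace 'M[R]_2}) :
  (forall X, lie_algebra G X <-> X \in V) -> \dim V = 3%N.
Proof.
move=> LV; have tV X : X \in V <-> X 0 0 + X 1 1 = 0.
  by rewrite -(SL2_lie_algebraP LV); split=> /LV.
apply: (@dim3_basis _ _ V (mx2 1 0 0 (-1)) (mx2 0 1 0 0) (mx2 0 0 1 0)).
- by apply/tV; rewrite !mxE /=; lra.
- by apply/tV; rewrite !mxE /=; lra.
- by apply/tV; rewrite !mxE /=; lra.
- move=> X /tV t0; exists (X 0 0), (X 0 1), (X 1 0).
  by rewrite [LHS]mx2E !scalemx2 !addmx2; congr mx2; lra.
- move=> a b c; rewrite !scalemx2 !addmx2 mx2_0 => /mx2_inj [e1 e2 e3 _].
  by split; lra.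
Qed.

(** det is constant on G, and its derivative at g in the direction C is tr (g^-1 C). *)
Lemma SL2_infinitesimally_closed :
  (exists V : {vspace 'M[R]_2}, forall X, lie_algebra G X <-> X \in V) ->
  infinitesimally_closed G.
Proof.
move=> [V LV] g C Gg H; apply/(SL2_lie_algebraP LV).
have := H _ (Coo_det Coo_id_mx).
rewrite derive_det2 => e; rewrite [g]mx2E [C]mx2E invmx2; last first.
  by rewrite -det_mx2; exact: Gg.
rewrite mulmx2 !mxE /=; have := e (fun x y Gx Gy => etrans Gx (esym Gy)).
by lra.
Qed.

(** Elementary operations: when the lower left entry is nonzero, three unipotent factors bring g to
    the unit. *)
Lemma SL2_generated : generated_by_one_parameter G.
Proof.
move=> phi inv; suff H : forall g : G, phi g = phi (group_elt (carrier1 G)).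
  by move=> ? ?; rewrite H [RHS]H.
have up (g g' : G) t : val g' = val g *m mx2 1 t 0 1 -> phi g' = phi g.
  have e : 0 * 0 + 1 * 0 = 0 :> R by lra.
  have op := nilpotent_one_parameter e.
  move=> e'; apply: (inv _ _ _ _ t op); rewrite e'; congr (_ *m mx2 _ _ _ _); lra.
have lo (g g' : G) t : val g' = val g *m mx2 1 0 t 1 -> phi g' = phi g.
  have e : 0 * 0 + 0 * 1 = 0 :> R by lra.
  have op := nilpotent_one_parameter e.
  move=> e'; apply: (inv _ _ _ _ t op); rewrite e'; congr (_ *m mx2 _ _ _ _); lra.
have Gu t : carrier G (mx2 1 t 0 1) by apply/SL2P; lra.
have Gl t : carrier G (mx2 1 0 t 1) by apply/SL2P; lra.
have main (g : G) : val g 1 0 != 0 -> phi g = phi (group_elt (carrier1 G)).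
  move=> c0; have Gg := group_eltP g.
  have e : val g 0 0 * val g 1 1 - val g 0 1 * val g 1 0 = 1 by rewrite -det_mx2; exact: Gg.
  move: c0 e; set a := val g 0 0; set b := val g 0 1; set c := val g 1 0; set d := val g 1 1.
  move=> c0 e.
  (* The lower right entry c t + d becomes 1. Subtracting c times the second column from the first
     then clears the lower left entry, and det = 1 settles the upper left one. *)
  pose t := (1 - d) / c.
  have tc : c * t = 1 - d by rewrite /t; field.
  pose g1 : G := group_elt (carrierM Gg (Gu t)).
  rewrite -(up g g1 t) //.
  pose g2 : G := group_elt (carrierM (group_eltP g1) (Gl (- c))).
  rewrite -(lo g1 g2 (- c)) //.
  rewrite -(up g2 (group_elt (carrier1 G)) (- (a * t + b))) //=.
  rewrite [val g]mx2E -/a -/b -/c -/d !mulmx2 mx2_1.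
  have e1 : a * (c * t) = a * (1 - d) by rewrite tc.
  have e2 : c * (c * t) = c * (1 - d) by rewrite tc.
  have e3 : a - c * (a * t + b) = 1 by lra.
  have e4 : (a * t + b) * (a - c * (a * t + b)) = a * t + b by rewrite e3 mulr1.
  have e5 : (a * t + b) * (c * (c * t)) = (a * t + b) * (c * (1 - d)) by rewrite tc.
  congr mx2; lra.
move=> x; have [c0|] := eqVneq (val x 1 0) 0; last exact: main.
have Gg := group_eltP x.
(* Here c = 0, so d <> 0, and this factor makes the lower left entry equal to d. *)
pose g1 : G := group_elt (carrierM Gg (Gl 1)).
rewrite -(lo x g1 1) //; apply: main.
have : \det (val x) = 1 by exact: Gg.
rewrite det_mx2 c0 mulr0 subr0 /= => e.
rewrite [val x]mx2E mulmx2 mxE /= c0 mul0r add0r mulr1.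
by apply/eqP => d0; move: e; rewrite d0 mulr0 => /esym/eqP; rewrite oner_eq0.
Qed.

End SL2.

(** If S is a section for T, then g |-> g0 S(g0^-1 g g0) g0^-1 is one for g0 T g0^-1. *)
Lemma slice_conj {R : realType} {n : nat} (G : matrix_group R n) (H T : set 'M[R]_n)
    (g0 : 'M[R]_n) : carrier G g0 ->
  (forall h, H h <-> T (invmx g0 *m h *m g0)) -> slice G T -> slice G H.
Proof.
move=> Gg0 HT [chi [S [cchi cS chi1 inv sec]]].
have ug0 := carrier_unit Gg0.
pose c (g : 'M[R]_n) := invmx g0 *m g *m g0.
have cc : Coo_mx c.
  apply: Coo_mx_mul; last exact: Coo_mx_cst.
  by apply: Coo_mx_mul; [exact: Coo_mx_cst|exact: Coo_id_mx].
have Gc g : carrier G g -> carrier G (c g).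
  by move=> Gg; apply: carrierM => //; apply: carrierM => //; exact: carrierV.
have cM g h : c (g *m h) = c g *m c h.
  by rewrite /c !mulmxA mulmxK.
exists (fun g => chi (c g)), (fun g => g0 *m S (c g) *m invmx g0); split.
- exact: Coo_comp_mx.
- apply: Coo_mx_mul; last exact: Coo_mx_cst.
  apply: Coo_mx_mul; first exact: Coo_mx_cst.
  by move=> i j; exact: (Coo_comp_mx (cS i j) cc).
- by rewrite /c mulmx1 mulVmx.
- move=> g h Gg /HT Th; rewrite cM.
  by have [-> ->] := inv (c g) (c h) (Gc g Gg) Th.
- move=> g Gg n0; apply/HT; have := sec _ (Gc g Gg) n0.
  have ug := carrier_unit Gg.
  have u1 : invmx g0 *m g \in unitmx by rewrite unitmx_mul unitmx_inv ug0.
  have u2 : invmx g0 \in unitmx by rewrite unitmx_inv.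
  by rewrite /c (invmx_mul u1 ug0) (invmx_mul u2 ug) invmxK !mulmxA mulmxKV.
Qed.

Lemma Coo_idR {R : realType} : Coo (fun x : R => x).
Proof.
apply: Coo_rect => [x|x v|k _ v]; first exact: cvg_id.
- exact: derivable_id.
- rewrite (_ : (fun x : R => 'D_v (fun y : R => y) x) = (fun=> v)); first exact: Coo_cst.
  by apply/funext => x; exact: derive_id.
Qed.

(** * A local section of SL(2) over its quotient by a torus *)

Section Torus.
Context {R : realType}.
Implicit Types (a b c d t : R).

(* The unit group of norm 1 of R[X] / (X^2 - del), identity component if
   0 <= del: the connected centralizer of [mx2 0 del 1 0]. *)
Definition norm_one (del a b : R) : Prop := a ^+ 2 - del * b ^+ 2 = 1 /\ (0 <= del -> 0 < a).

Definition torus (del : R) : set 'M[R]_2 :=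
  [set A | exists a b, A = mx2 a (del * b) b a /\ norm_one del a b].

Variable del : R.

(** The torus multiplies d + c sqrt(del), for the bottom row (c, d), by elements of norm 1; so the
    norm Q is invariant, and so is U. The section S is the upper triangular representative of the
    coset with bottom row (0, sqrt Q), as in an Iwasawa decomposition. [rho] equals sqrt Q where Q
    >= 1/2, and the flat term in [D] keeps the radicand positive everywhere. [sgn] selects d > 0
    when 0 <= del, since the torus then omits -1. *)
Let Q (g : 'M[R]_2) := g 1 1 ^+ 2 - del * g 1 0 ^+ 2.
Let U (g : 'M[R]_2) := g 0 1 * g 1 1 - del * (g 0 0 * g 1 0).
Let D g := Q g ^+ 2 + flat 0 (1 / 2 - Q g).
Let rho g := Num.sqrt (Num.sqrt (D g)).
Let sgn (g : 'M[R]_2) : R := if del < 0 then 1 else smooth_step (g 1 1).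
Let chi g := flat 0 (Q g - 1 / 2) * sgn g.
Let S g := mx2 (rho g)^-1 (U g * (rho g)^-1) 0 (rho g).

Let CooQ : Coo Q.
Proof. by apply: CooB; [apply: CooM|apply: CooZ; apply: CooM]; exact: Coo_coord. Qed.

Let CooU : Coo U.
Proof. by apply: CooB; [apply: CooM|apply: CooZ; apply: CooM]; exact: Coo_coord. Qed.

Let D_gt0 g : 0 < D g.
Proof.
have [Q0|Q0] := eqVneq (Q g) 0.
  by rewrite /D Q0 expr0n add0r subr0 flat_gt0 //; lra.
by rewrite /D ltr_wpDr ?flat_ge0 // exprn_even_gt0 //= Q0.
Qed.

Let Coo_rho : Coo rho.
Proof.
apply: Coo_sqrt => [|g]; last by rewrite sqrtr_gt0.
apply: Coo_sqrt => //; apply: CooD; first by apply: CooM.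
apply: (Coo_comp1 (Coo_flat 0)); apply: CooB => //; exact: Coo_cst.
Qed.

Let rho_gt0 g : 0 < rho g. Proof. by rewrite !sqrtr_gt0. Qed.

Let chi_neq0 g : chi g <> 0 -> 1 / 2 < Q g /\ (0 <= del -> 0 < g 1 1).
Proof.
move=> n0; split.
  by rewrite ltNge; apply/negP => le; apply: n0; rewrite /chi flat_le0 ?mul0r //; lra.
move=> d0; rewrite ltNge; apply/negP => le; apply: n0.
by rewrite /chi /sgn ltNge d0 /= smooth_step0 // mulr0.
Qed.

(** Otherwise d a <= - c del b; squaring, with a^2 = 1 + del b^2 and del c^2 <= d^2, gives d^2 <= 0.
    So the torus preserves the sign of d where Q > 1/2. *)
Let positive_corner a b c d : norm_one del a b -> 0 <= del -> 1 / 2 < d ^+ 2 - del * c ^+ 2 ->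
  0 < d -> 0 < c * (del * b) + d * a.
Proof.
move=> [n1 /[swap] d0 /(_ d0) a0] q d0'; rewrite ltNge; apply/negP => le.
have da : 0 < d * a by rewrite mulr_gt0.
have h1 : (d * a) ^+ 2 <= (c * (del * b)) ^+ 2.
  have : d * a <= - (c * (del * b)) by lra.
  move=> h; rewrite -[X in _ <= X]sqrrN; rewrite ler_sqr ?nnegrE //; lra.
have dc : 0 <= del * c ^+ 2 by rewrite mulr_ge0 // sqr_ge0.
have db : 0 <= del * b ^+ 2 by rewrite mulr_ge0 // sqr_ge0.
have e1 : (d * a) ^+ 2 = d ^+ 2 * (1 + del * b ^+ 2).
  by rewrite exprMn; congr (_ * _); lra.
have e2 : (c * (del * b)) ^+ 2 = (del * c ^+ 2) * (del * b ^+ 2) by ring.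
rewrite e1 e2 in h1.
have h2 : (del * c ^+ 2) * (del * b ^+ 2) <= d ^+ 2 * (del * b ^+ 2).
  by rewrite ler_wpM2r //; lra.
lra.
Qed.

Lemma torus_slice : slice (SL R 2) (torus del).
Proof.
exists chi, S; split.
- apply: CooM; first by apply: (Coo_comp1 (Coo_flat 0)); apply: CooB => //; exact: Coo_cst.
  rewrite /sgn; case: (del < 0); first exact: Coo_cst.
  apply: (@Coo_comp1 _ _ smooth_step); last exact: Coo_coord.
  apply: CooM; first exact: Coo_flat.
  apply: Coo_inv => [|x]; last by rewrite gt_eqF // smooth_step_den_gt0.
  apply: CooD; first exact: Coo_flat.
  apply: (Coo_comp1 (Coo_flat 0)); apply: CooB; first exact: Coo_cst.
  exact: Coo_idR.
- apply: Coo_mx2 => //.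
  + by apply: Coo_inv => // g; rewrite gt_eqF.
  + by apply: CooM => //; apply: Coo_inv => // g; rewrite gt_eqF.
  + exact: Coo_cst.
- rewrite /chi /sgn /Q mx2_1 !mxE /= expr0n mulr0 subr0 expr1n.
  apply/eqP; rewrite mulf_neq0 //; first by rewrite gt_eqF // flat_gt0 //; lra.
  by case: ifP => _; rewrite ?oner_neq0 // smooth_step1 ?oner_neq0 //; lra.
- move=> g h _ [a [b [-> no]]]; have [n1 _] := no.
  have QE : Q (g *m mx2 a (del * b) b a) = Q g.
    rewrite [g]mx2E mulmx2 /Q !mxE /=.
    set c := g 1 0; set d := g 1 1.
    rewrite (_ : _ - _ = (d ^+ 2 - del * c ^+ 2) * (a ^+ 2 - del * b ^+ 2)); last by ring.
    by rewrite n1 mulr1.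
  have UE : U (g *m mx2 a (del * b) b a) = U g.
    rewrite [g]mx2E mulmx2 /U !mxE /=.
    set x := g 0 0; set y := g 0 1; set c := g 1 0; set d := g 1 1.
    rewrite (_ : _ - _ = (y * d - del * (x * c)) * (a ^+ 2 - del * b ^+ 2)); last by ring.
    by rewrite n1 mulr1.
  split; last by rewrite /S /rho /D QE UE.
  rewrite /chi QE; have [q|q] := leP (Q g) (1 / 2).
    by rewrite flat_le0 ?mul0r //; lra.
  congr (_ * _); rewrite /sgn; case: ltP => // d0.
  have gh11 : (g *m mx2 a (del * b) b a) 1 1 = g 1 0 * (del * b) + g 1 1 * a.
    by rewrite {1}[g]mx2E mulmx2 !mxE.
  have gh10 : (g *m mx2 a (del * b) b a) 1 0 = g 1 0 * a + g 1 1 * b.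
    by rewrite {1}[g]mx2E mulmx2 !mxE.
  move: QE q; rewrite /Q gh11 gh10.
  set c := g 1 0; set d := g 1 1 => e q.
  set c' := c * a + d * b in e *; set d' := c * (del * b) + d * a in e *.
  have dc : 0 <= del * c ^+ 2 by rewrite mulr_ge0 // sqr_ge0.
  have dc' : 0 <= del * c' ^+ 2 by rewrite mulr_ge0 // sqr_ge0.
  (* As del c^2 >= 0, Q > 1/2 gives d^2 > 1/2 and likewise for d'; positive entries are thus on the
     plateau of the step. *)
  have big x : 0 < x -> 1 / 2 < x ^+ 2 -> smooth_step x = 1.
    by move=> x0 x2; apply: smooth_step1; nra.
  have [dl|dg|de] := ltgtP d 0.
  - have : 0 < (- c) * (del * b) + (- d) * a by apply: positive_corner; rewrite ?sqrrN //; lra.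
    move=> pos; have neg : d' <= 0 by rewrite /d'; lra.
    by rewrite !smooth_step0 // ltW.
  - have pos : 0 < d' by apply: positive_corner => //; lra.
    by rewrite !big //; lra.
  - by move: q; rewrite de expr0n /=; lra.
- move=> g Gg /chi_neq0 [q dpos].
  have DE : D g = Q g ^+ 2 by rewrite /D flat_le0 ?addr0 //; lra.
  have rE : rho g ^+ 2 = Q g.
    by rewrite /rho DE sqrtr_sqr ger0_norm ?sqr_sqrtr //; lra.
  have r0 : rho g != 0 by rewrite gt_eqF.
  have := Gg; rewrite /= /SL_set /= det_mx2 => det1.
  (* From g = S h with bottom row (c, d) = rho (b, a), the element sought is h^-1, whence the sign
     of c. *)
  exists (g 1 1 / rho g), (- g 1 0 / rho g); split.
    rewrite {1}[g]mx2E invmx2 // mulmx2 mulr0 addr0.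
    have e1 : g 1 1 * U g - g 0 1 * rho g ^+ 2 = - (del * g 1 0).
      rewrite rE /U /Q (_ : _ - _ = - (del * g 1 0) * (g 0 0 * g 1 1 - g 0 1 * g 1 0)); last by ring.
      by rewrite det1 mulr1.
    have e2 : - g 1 0 * U g + g 0 0 * rho g ^+ 2 = g 1 1.
      rewrite rE; apply: (@etrans _ _ (g 1 1 * (g 0 0 * g 1 1 - g 0 1 * g 1 0))).
        by rewrite /U /Q; ring.
      by rewrite det1 mulr1.
    congr mx2.
    - apply: (mulIf r0); rewrite mulrAC (_ : _ * rho g = g 1 1 * U g - g 0 1 * rho g ^+ 2); last by field.
      by rewrite e1; field.
    - by rewrite mulr0 addr0.
    - apply: (mulIf r0); rewrite (_ : _ * rho g = - g 1 0 * U g + g 0 0 * rho g ^+ 2); last by field.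
      by rewrite e2; field.
  split; last by move=> d0; rewrite divr_gt0 // dpos.
  rewrite !exprMn !exprVn rE sqrrN mulrA -mulrBl /Q divff // gt_eqF //.
  by apply: lt_trans q; lra.
Qed.

End Torus.

(** * Rigidity of adjoint orbits in sl(2) *)

Section SL2Orbit.
Context {R : realType}.
Local Notation G := (SL R 2).

(** [om] amounts to a linear form l on sl(2), with coordinates om h e, om h f, om e f. The
    hypothesis makes l vanish on all conjugates of w, and conjugation by unipotents already gives
    enough of them to force l = 0. *)
Lemma SL2_orbit_rigid (w : 'M[R]_2) :
  (forall X, lie_algebra G X -> X 0 0 + X 1 1 = 0) ->
  lie_algebra G w -> w != 0 -> orbit_rigid G w.
Proof.
move=> tr0 Lw w0 om lin anti nul orb.
pose e : 'M[R]_2 := mx2 0 1 0 0; pose f : 'M[R]_2 := mx2 0 0 1 0.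
pose h : 'M[R]_2 := mx2 1 0 0 (-1).
have om0r A : om A 1%:M = 0.
  rewrite anti nul ?oppr0 // => X /tr0; by rewrite mul1mx mxtrace2.
have diag A : om A A = 0 by have := anti A A; lra.
have lin0 A : om 0 A = 0.
  have := lin (-1) 0 0 A; rewrite scaler0 addr0; lra.
have expand A B : om A B =
    (((A 0 0 - A 1 1) / 2) * B 0 1 - ((B 0 0 - B 1 1) / 2) * A 0 1) * om h e +
    (((A 0 0 - A 1 1) / 2) * B 1 0 - ((B 0 0 - B 1 1) / 2) * A 1 0) * om h f +
    (A 0 1 * B 1 0 - B 0 1 * A 1 0) * om e f.
  have dec (C : 'M[R]_2) : C = ((C 0 0 - C 1 1) / 2) *: h + (C 0 1 *: e + (C 1 0 *: f + (((C 0 0 + C 1 1) / 2) *: 1%:M + 0))).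
    rewrite [LHS]mx2E mx2_1 mx2_0 !scalemx2 !addmx2; congr mx2; lra.
  have linr (a : R) X Y C : om C (a *: X + Y) = a * om C X + om C Y.
    by rewrite anti lin (anti X) (anti Y); ring.
  have zr C : om C 0 = 0 by rewrite anti lin0 oppr0.
  rewrite {1}[A]dec {1}[B]dec !lin !linr lin0 zr !om0r !diag.
  have z1 C : om 1%:M C = 0 by rewrite anti om0r oppr0.
  rewrite !z1 ?zr ?lin0 (anti f h) (anti f e) (anti e h); ring.
(* Testing on pairs of basis elements gives l times each entry of the conjugate of w, and these
   entries are not all 0. *)
have key a b c : (exists2 y, carrier G y & y *m w *m invmx y = mx2 a b c (- a)) ->
    c * om h f - b * om h e - 2 * a * om e f = 0.
  move=> [y Gy E].
  have O A B := orb y A B Gy; rewrite /= E in O.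
  set l := _ - _ - _.
  have l1 : 2 * a * l = 0.
    have := O e f; rewrite /e /f !mulmx2 !oppmx2 !addmx2 expand !mxE /= /l; lra.
  have l2 : b * l = 0.
    have := O h f; rewrite /f /h !mulmx2 !oppmx2 !addmx2 expand !mxE /= /l; lra.
  have l3 : c * l = 0.
    have := O h e; rewrite /e /h !mulmx2 !oppmx2 !addmx2 expand !mxE /= /l; lra.
  apply/eqP; apply: contraT => l0.
  have z x : x * l = 0 -> x = 0 by move/eqP; rewrite mulf_eq0 (negbTE l0) orbF => /eqP.
  have uy := carrier_unit Gy.
  have : mx2 a b c (- a) = 0.
    by rewrite (z b) // (z c) // (_ : a = 0) ?oppr0 -?mx2_0 //; have := z _ l1; lra.
  rewrite -E => E0; move/negP: w0; case; apply/eqP.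
  by rewrite -[w](mulKmx uy) -[y *m w](mulmxKV uy) E0 mul0mx mulmx0.
pose a := w 0 0; pose b := w 0 1; pose c := w 1 0.
have wE : w = mx2 a b c (- a).
  rewrite [LHS]mx2E; congr mx2; have := tr0 w Lw; rewrite /a; lra.
have up t : c * om h f - (b - 2 * a * t - t ^+ 2 * c) * om h e - 2 * (a + t * c) * om e f = 0.
  apply: key; exists (mx2 1 t 0 1); first by apply/SL2P; lra.
  by rewrite wE invmx2 ?mulmx2; [congr mx2; ring|lra].
have lo t : (c + 2 * a * t - t ^+ 2 * b) * om h f - b * om h e - 2 * (a - t * b) * om e f = 0.
  apply: key; exists (mx2 1 0 t 1); first by apply/SL2P; lra.
  by rewrite wE invmx2 ?mulmx2; [congr mx2; ring|lra].
(* The values 0, 1, -1 separate the coefficients of these polynomials in t. *)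
have u0 := up 0; have u1 := up 1; have u2 := up (-1); have o1 := lo 1; have o2 := lo (-1).
have cr : c * om h e = 0 by lra.
have ar : a * om h e = c * om e f by lra.
have bs : b * om h f = 0 by lra.
have as_ : a * om h f = - (b * om e f) by lra.
have z x y : x != 0 -> x * y = 0 -> y = 0 :> R.
  by move=> x0 /eqP; rewrite mulf_eq0 (negbTE x0) => /eqP.
suff [r0 [s0 p0]] : om h e = 0 /\ om h f = 0 /\ om e f = 0.
  by move=> A B; rewrite expand r0 s0 p0; lra.
have [c0|c0] := eqVneq c 0; last first.
  have r0 := z _ _ c0 cr.
  have p0 : om e f = 0 by apply: (z c) => //; rewrite -ar r0 mulr0.
  by split=> //; split=> //; apply: (z c) => //; rewrite r0 p0 in u0; lra.
have [b0|b0] := eqVneq b 0; last first.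
  have s0 := z _ _ b0 bs.
  have p0 : om e f = 0 by apply: (z b) => //; rewrite s0 in as_; lra.
  by split=> //; apply: (z b) => //; rewrite s0 p0 in u0; lra.
have a0 : a != 0.
  apply/eqP => a0; move/negP: w0; apply; apply/eqP.
  by rewrite wE a0 b0 c0 oppr0 -mx2_0.
rewrite b0 c0 in ar as_ u0.
split; first by apply: (z a) => //; lra.
split; first by apply: (z a) => //; lra.
by apply: (z a) => //; lra.
Qed.

End SL2Orbit.

(** * Norm-one groups are generated near the unit *)

Section OneParameterTorus.
Context {R : realType} (del : R).

(** The intermediate value theorem for be, increasing through 0, on an interval where al stays
    positive. For a curve in a norm-one group, be t = b and 0 < al t determine the point. The bound
    is put on b^2 to fit [norm_one_generated]. *)
Lemma curve_covers (al be : R -> R) : continuous al -> continuous be ->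
  al 0 = 1 -> be 0 = 0 -> is_derive (0 : R) (1 : R) be 1 ->
  exists2 e : R, 0 < e & forall b, b ^+ 2 < e -> exists2 t, be t = b & 0 < al t.
Proof.
move=> ca cb a0 b0 [dv v].
have D : h^-1 *: (be (h *: 1 + 0) - be 0) @[h --> 0^'] --> 'D_1 be 0 by exact: dv.
rewrite v in D.
have a_pos : \forall t \near (0 : R), 0 < al t.
  by apply: (@cvgr_gt _ _ _ _ _ _ (ca 0)); rewrite a0 ltr01.
have b_slope : \forall h \near (0 : R)^', 0 < h^-1 *: (be (h *: 1 + 0) - be 0).
  exact: (@cvgr_gt _ _ _ _ _ _ D 0 ltr01).
have /nbhs_ballP[r1 /= r10 h1] := a_pos.
have /nbhs_ballP[r2 /= r20 h2] := b_slope.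
pose eta := Num.min r1 r2 / 2.
have m0 : 0 < Num.min r1 r2 by rewrite lt_min r10.
have eta0 : 0 < eta by rewrite divr_gt0.
have lt1 : eta < r1.
  have : Num.min r1 r2 <= r1 by rewrite ge_min lexx.
  by rewrite /eta; lra.
have lt2 : eta < r2.
  have : Num.min r1 r2 <= r2 by rewrite ge_min lexx orbT.
  by rewrite /eta; lra.
have P t : `|t| <= eta -> 0 < al t.
  by move=> h; apply: h1; rewrite -ball_normE /= sub0r normrN; apply: le_lt_trans lt1.
have S t : `|t| <= eta -> t != 0 -> 0 < t^-1 * be t.
  move=> h t0; have := h2 t; rewrite -ball_normE /= sub0r normrN.
  by move=> /(_ (le_lt_trans h lt2) t0); rewrite b0 subr0 addr0 [t *: 1]mulr1.
have n1 : `|eta| <= eta by rewrite ger0_norm // ltW.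
have ne : eta != 0 by rewrite gt_eqF.
have p1 : 0 < be eta by have := S eta n1 ne; rewrite pmulr_rgt0 // invr_gt0.
have p2 : be (- eta) < 0.
  have := S (- eta); rewrite normrN oppr_eq0 => /(_ n1 ne).
  by rewrite invrN mulNr oppr_gt0 pmulr_rlt0 // invr_gt0.
exists (Num.min (be eta) (- be (- eta)) ^+ 2).
  by rewrite exprn_gt0 // lt_min p1 oppr_gt0.
move=> b; set m := Num.min _ _.
have m1 : 0 < m by rewrite lt_min p1 oppr_gt0.
move=> hb; have : `|b| < m.
  by rewrite -ltr_sqr ?nnegrE ?normr_ge0 ?(ltW m1) // real_normK ?num_real.
rewrite ltr_norml => /andP[bl bu].
have [mm1 mm2] : m <= be eta /\ m <= - be (- eta).
  by rewrite /m !ge_min !lexx orbT.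
have [t tin bt] : exists2 c, c \in `[- eta, eta]%R & be c = b.
  apply: IVT; first by lra.
    exact: continuous_subspaceT.
  have le : be (- eta) <= be eta by lra.
  by rewrite (min_idPl le) (max_idPr le); apply/andP; split; lra.
exists t => //; apply: P; rewrite ler_norml.
by move: tin; rewrite in_itv.
Qed.

(** Taking a square root divides b^2 by 2 (a + 1), which exceeds 2 once a > 0, so finitely many
    roots reach the given neighbourhood. The point -1, present only for del < 0, is outside the
    reach of this root and is treated apart. *)
Lemma norm_one_generated (P : R -> R -> Prop) :
  (forall a b c d, P a b -> P c d -> P (a * c + del * (b * d)) (a * d + b * c)) ->
  (exists2 e : R, 0 < e & forall a b, 0 < a -> a ^+ 2 - del * b ^+ 2 = 1 -> b ^+ 2 < e -> P a b) ->
  forall a b, norm_one del a b -> P a b.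
Proof.
move=> PM [e e0 Pe].
(* square roots: (a, b) is the square of (a', b / (2 a')) with a' = sqrt ((a + 1) / 2) *)
have half a b : -1 < a -> a ^+ 2 - del * b ^+ 2 = 1 ->
    let a' := Num.sqrt ((a + 1) / 2) in
    [/\ 0 < a', a' ^+ 2 - del * (b / (2 * a')) ^+ 2 = 1,
        (b / (2 * a')) ^+ 2 = b ^+ 2 / (2 * (a + 1)) &
        P a' (b / (2 * a')) -> P a b].
  move=> a1 n1 a'; have h0 : 0 < (a + 1) / 2 by lra.
  have a'0 : 0 < a' by rewrite sqrtr_gt0.
  have a'2 : a' ^+ 2 = (a + 1) / 2 by rewrite sqr_sqrtr // ltW.
  have b'2 : (b / (2 * a')) ^+ 2 = b ^+ 2 / (2 * (a + 1)).
    rewrite exprMn exprVn exprMn a'2; field; lra.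
  have nz : a + 1 != 0 by rewrite gt_eqF //; lra.
  have db : del * b ^+ 2 = (a + 1) * (a - 1) by lra.
  split=> //.
    by rewrite a'2 b'2 mulrA db; field.
  move=> h; have := PM _ _ _ _ h h; congr P.
    rewrite -!expr2 a'2 b'2 mulrA db; field => //.
  by field; rewrite gt_eqF.
have pos n : forall a b, 0 < a -> a ^+ 2 - del * b ^+ 2 = 1 -> b ^+ 2 < 2 ^+ n * e -> P a b.
  elim: n => [|n IH] a b a0 n1; first by rewrite expr0 mul1r; exact: Pe.
  move=> hb; have a1 : -1 < a by lra.
  have [/= a'0 n1' b'2 Pab] := half a b a1 n1.
  apply: Pab; apply: IH => //; rewrite b'2 ltr_pdivrMr; last by lra.
  apply: lt_le_trans hb _; rewrite exprS.
  have : 0 <= 2 ^+ n * e * a by rewrite !mulr_ge0 ?exprn_ge0 // ltW.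
  lra.
have Ppos a b : 0 < a -> a ^+ 2 - del * b ^+ 2 = 1 -> P a b.
  move=> a0 n1; have [n hn] : exists n : nat, b ^+ 2 < 2 ^+ n * e.
    have := archi_boundP (divr_ge0 (sqr_ge0 b) (ltW e0)).
    set N := Num.bound _ => hN; exists N.
    rewrite -ltr_pdivrMr //; apply: lt_trans hN _.
    by rewrite -natrX ltr_nat ltn_expl.
  exact: (pos n).
have Pgt a b : -1 < a -> a ^+ 2 - del * b ^+ 2 = 1 -> P a b.
  by move=> a1 n1; have [/= a'0 n1' _ Pab] := half a b a1 n1; apply: Pab; exact: Ppos.
move=> a b [n1 da]; have [a1|a1] := ltP (-1) a; first exact: Pgt.
have d0 : del < 0 by rewrite ltNge; apply/negP => /da; lra.
have b2 := sqr_ge0 b.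
have bb : 0 <= - del * b ^+ 2 by rewrite mulr_ge0 // ltW // oppr_gt0.
have aE : a = -1 by nra.
have b0 : b = 0.
  have : del * b ^+ 2 = 0 by rewrite aE in n1; lra.
  by move/eqP; rewrite mulf_eq0 lt_eqF //= sqrf_eq0 => /eqP.
(* (0, s) has norm 1 and square -1. *)
pose s := (Num.sqrt (- del))^-1.
have s2 : del * s ^+ 2 = -1.
  by rewrite /s exprVn sqr_sqrtr; [field; rewrite lt_eqF|lra].
have P0 : P 0 s by apply: Pgt; [lra|rewrite s2 expr0n /=; lra].
have := PM _ _ _ _ P0 P0; rewrite aE b0; congr P; last by lra.
by rewrite mulr0 add0r -expr2.
Qed.

End OneParameterTorus.

Section Conjugation.
Context {R : realType} {n : nat}.
Variables (H : matrix_group R n) (g0 : 'M[R]_n) (u0 : g0 \in unitmx).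

Definition conj_set : set 'M[R]_n := [set x | carrier H (g0 *m x *m invmx g0)].

Lemma conj_unit x : conj_set x -> x \in unitmx.
Proof.
by move=> /carrier_unit; rewrite !unitmx_mul unitmx_inv => /andP[/andP[]].
Qed.

Lemma conj_one : conj_set 1%:M.
Proof. by rewrite /conj_set /= mulmx1 mulmxV //; exact: carrier1. Qed.

Lemma conj_mul x y : conj_set x -> conj_set y -> conj_set (x *m y).
Proof.
move=> hx hy; have := carrierM hx hy; rewrite /conj_set /=.
by rewrite !mulmxA mulmxKV.
Qed.

Lemma conj_inv x : conj_set x -> conj_set (invmx x).
Proof.
move=> hx; have ux := conj_unit hx; have := carrierV hx; rewrite /conj_set /=.
have ui : invmx g0 \in unitmx by rewrite unitmx_inv.
have ugx : g0 *m x \in unitmx by rewrite unitmx_mul u0.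
by rewrite (invmx_mul ugx ui) (invmx_mul u0 ux) invmxK mulmxA.
Qed.

Definition conj_group : matrix_group R n := MatrixGroup conj_unit conj_one conj_mul conj_inv.

Lemma conj_groupP x : carrier H x <-> carrier conj_group (invmx g0 *m x *m g0).
Proof. by rewrite /= /conj_set /= !mulmxA mulmxV // mul1mx mulmxK. Qed.

Lemma conj_group_connected : connected (carrier H) -> connected (carrier conj_group).
Proof.
move=> cH.
have -> : carrier conj_group = (fun x => invmx g0 *m x *m g0) @` carrier H.
  apply/seteqP; split=> [x hx|_ [x hx <-]]; last exact: (iffLR (conj_groupP x) hx).
  exists (g0 *m x *m invmx g0); first exact: hx.
  by rewrite !mulmxA mulVmx // mul1mx mulmxKV.
apply: connected_continuous_connected => //.
apply: continuous_subspaceT => x; apply: mx_continuousP => i j.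
have c : Coo_mx (fun x : 'M[R]_n => invmx g0 *m x *m g0).
  apply: Coo_mx_mul; last exact: Coo_mx_cst.
  by apply: Coo_mx_mul; [exact: Coo_mx_cst|exact: Coo_id_mx].
exact: (Coo_continuous (c i j)).
Qed.

Lemma conj_group_lie X : lie_algebra conj_group X <-> lie_algebra H (g0 *m X *m invmx g0).
Proof.
split=> -[phi [pD Gp d0]].
  exists (fun t => g0 *m phi t *m invmx g0); split.
  - by move=> s t; rewrite pD !mulmxA mulmxKV.
  - exact: Gp.
  - exact: is_derive_mulmxLR.
exists (fun t => invmx g0 *m phi t *m g0); split.
- by move=> s t; rewrite pD !mulmxA mulmxK.
- by move=> t; exact: (iffLR (conj_groupP _) (Gp t)).
- have := is_derive_mulmxLR (invmx g0) g0 d0.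
  by rewrite !mulmxA mulVmx // mul1mx mulmxKV.
Qed.

End Conjugation.

Lemma connected_value {R : realType} {T : topologicalType} (A : set T) (f : T -> R) (x y : T) (v : R) :
  connected A -> continuous f -> A x -> A y -> f x <= v <= f y ->
  exists2 z, A z & f z = v.
Proof.
move=> cA cf Ax Ay xvy.
have : connected (f @` A).
  by apply: connected_continuous_connected => //; exact: continuous_subspaceT.
move/connected_intervalP => /(_ (f x) (f y) (imageP f Ax) (imageP f Ay) v xvy) [z Az <-].
by exists z.
Qed.

(** * Connected subgroups of SL(2) with a given one-dimensional Lie algebra *)

Section SL2Classification.
Context {R : realType} (K : matrix_group R 2) (del : R).
Hypothesis KSL : carrier K `<=` carrier (SL R 2).
Hypothesis cK : connected (carrier K).
Hypothesis LK : forall X, lie_algebra K X <-> exists c, X = c *: mx2 0 del 1 0.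
Local Notation wd := (mx2 0 del 1 0).

Let entry (i j : 'I_2) : continuous (fun x : 'M[R]_2 => x i j).
Proof. exact: coord_continuous. Qed.

(** The one-parameter subgroup with velocity [wd] commutes with [wd], so its elements are a + b wd,
    of norm det = 1. It covers the torus near the unit, and [norm_one_generated] does the rest. *)
Lemma SL2_torus_sub h : torus del h -> carrier K h.
Proof.
have Lw : lie_algebra K wd by apply/LK; exists 1; rewrite scale1r.
have [phi op] := Lw; have [pD Kp d0] := op.
have comm t : exists a b, phi t = mx2 a (del * b) b a.
  have := one_parameter_comm op t; rewrite [phi t]mx2E !mulmx2 => /mx2_inj [e1 e2 e3 e4].
  by exists (phi t 0 0), (phi t 1 0); congr mx2; lra.
have cphi i j : continuous (fun t => phi t i j).
  move=> t; apply: differentiable_continuous; apply/derivable1_diffP.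
  have /(iffLR (is_derive_mxP _ _ _ _)) := one_parameter_is_derive op t.
  by move=> /(_ i j) [].
have p0 := one_parameter0 op.
have [e e0 cov] : exists2 e : R, 0 < e & forall b, b ^+ 2 < e -> exists2 t, phi t 1 0 = b & 0 < phi t 0 0.
  apply: curve_covers => //; rewrite ?p0 ?mxE //.
  have /(iffLR (is_derive_mxP _ _ _ _)) := d0.
  by move=> /(_ 1 0); rewrite mxE.
move=> [a [b [-> no]]]; move: a b no; apply: norm_one_generated.
  move=> a b c d h1 h2; have := carrierM h1 h2; rewrite mulmx2.
  congr (carrier K _); congr mx2; ring.
exists e => // a b a0 n1 /cov [t tb ta].
have -> : mx2 a (del * b) b a = phi t; last exact: Kp.
have [a1 [b1 E]] := comm t; move: tb ta; rewrite E !mxE /= => tb a10; rewrite tb.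
have := KSL (Kp t); rewrite E tb => /SL2P n1'.
have /eqP : a ^+ 2 = a1 ^+ 2 by lra.
by rewrite eqrXn2 ?ltW // => /eqP ->.
Qed.

(** K normalizes the line of [wd]: h wd h^-1 = c wd. If del <> 0 then c is 1 or -1, and determinant
    or connectedness excludes -1, as well as the component of -1 in the centralizer when 0 < del. If
    del = 0 the normalizer is a Borel subgroup, whose diagonal part must be ruled out. *)
Lemma SL2_sub_torus : carrier K `<=` torus del.
Proof.
have Lw : lie_algebra K wd by apply/LK; exists 1; rewrite scale1r.
have norm h : carrier K h -> exists c, [/\ h 0 1 = c * del * h 1 0, del * h 0 0 = c * del * h 1 1,
    h 1 1 = c * h 0 0 & del * h 1 0 = c * h 0 1].
  move=> Kh; have uh := carrier_unit Kh.
  have /LK [c e] := lie_algebra_conj Kh Lw; exists c.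
  have : h *m wd = c *: wd *m h by rewrite -e mulmxKV.
  rewrite {1 2}[h]mx2E scalemx2 !mulmx2 => /mx2_inj [e1 e2 e3 e4].
  by split; lra.
have K1 : carrier K 1%:M := carrier1 K.
have det1 h : carrier K h -> h 0 0 * h 1 1 - h 0 1 * h 1 0 = 1.
  by move=> Kh; rewrite -det_mx2; exact: (KSL Kh).
have fin h : carrier K h -> h 1 1 = h 0 0 -> h 0 1 = del * h 1 0 -> (0 <= del -> 0 < h 0 0) ->
    torus del h.
  move=> Kh e1 e2 p; exists (h 0 0), (h 1 0); split; first by rewrite [LHS]mx2E e1 e2.
  by split=> //; have := det1 h Kh; rewrite e1 e2; lra.
have sq h : carrier K h -> del != 0 ->
    (h 1 1 = h 0 0 /\ h 0 1 = del * h 1 0) \/ (h 1 1 = - h 0 0 /\ h 0 1 = - (del * h 1 0)).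
  move=> Kh d0; have [c [e1 e2 e3 e4]] := norm h Kh.
  have : c = 1 \/ c = -1.
    have z1 : (c ^+ 2 - 1) * h 0 0 = 0.
      by apply: (mulfI d0); rewrite mulr0; rewrite e3 in e2; lra.
    have z2 : (c ^+ 2 - 1) * h 0 1 = 0.
      by have : c * (del * h 1 0) = c * (c * h 0 1); [rewrite e4|rewrite mulrA -e1; lra].
    have := det1 h Kh; have [->|c1] := eqVneq c 1; first by left.
    have [->|c2] := eqVneq c (-1); first by right.
    have nz : c ^+ 2 - 1 != 0 by rewrite subr_sqr_1 mulf_neq0 // ?subr_eq0 // addr_eq0.
    move/eqP: z1; rewrite mulf_eq0 (negbTE nz) => /eqP ->.
    move/eqP: z2; rewrite mulf_eq0 (negbTE nz) => /eqP ->; lra.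
  by case=> cE; rewrite cE in e1 e3; [left|right]; split; lra.
have [d0|d0|d0] := ltgtP del 0.
- move=> h Kh; have := sq h Kh; rewrite lt_eqF // => /(_ erefl) [[e1 e2]|[e1 e2]].
    by apply: fin => //; rewrite leNgt d0.
  (* For c = -1 the determinant would be - h00^2 + del h10^2 <= 0. *)
  have := det1 h Kh; rewrite e1 e2.
  have := sqr_ge0 (h 0 0).
  have : 0 <= - del * h 1 0 ^+ 2 by rewrite mulr_ge0 ?sqr_ge0 // ltW // oppr_gt0.
  lra.
(* Elements with c = 1 have trace of absolute value at least 2, those with c = -1 have trace 0. The
   trace, 2 at the unit, therefore never takes the value 1 and stays above it on the connected group
   K. *)
- have no_half z : carrier K z -> z 0 0 + z 1 1 != 1.
    move=> Kz; apply/eqP => t1; have := sq z Kz; rewrite gt_eqF // => /(_ erefl) [[e1 e2]|[e1 e2]].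
      have h00 : z 0 0 = 1 / 2 by lra.
      have := det1 z Kz; rewrite e1 e2 h00.
      have : 0 <= del * z 1 0 ^+ 2 by rewrite mulr_ge0 ?sqr_ge0 // ltW.
      lra.
    lra.
  move=> h Kh.
  have ctr : continuous (fun x : 'M[R]_2 => x 0 0 + x 1 1).
    by move=> x; exact: (cvgD (@entry 0 0 x) (@entry 1 1 x)).
  have big : 1 < h 0 0 + h 1 1.
    rewrite ltNge; apply/negP => le1.
    have [|z Kz z1] := @connected_value _ _ _ (fun x : 'M[R]_2 => x 0 0 + x 1 1) h 1%:M 1 cK ctr Kh K1.
      by rewrite le1 /= !mxE /=; lra.
    by have := no_half z Kz; rewrite z1 eqxx.
  have := sq h Kh; rewrite gt_eqF // => /(_ erefl) [[e1 e2]|[e1 e2]]; last by lra.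
  by apply: fin => // _; lra.
- (* the Borel case: a nontrivial diagonal part would make K two-dimensional *)
  move=> h Kh.
  have tri z : carrier K z -> z 0 1 = 0 /\ z 0 0 * z 1 1 = 1.
    move=> Kz; have [c [e1 _ _ _]] := norm z Kz; have := det1 z Kz.
    rewrite d0 in e1; have z0 : z 0 1 = 0 by lra.
    by rewrite z0 => e2; split=> //; lra.
  have c00 := @entry 0 0.
  have pos z : carrier K z -> 0 < z 0 0.
    move=> Kz; rewrite ltNge; apply/negP => le0.
    have [|y Ky y0] := connected_value cK c00 Kz K1 (_ : _ <= 0 <= _).
      by rewrite le0 /= mxE /= ler01.
    by have [_] := tri y Ky; rewrite y0 mul0r => /esym/eqP; rewrite oner_eq0.
  pose P t := carrier K (mx2 t 0 0 t^-1).
  have PM s t : P s -> P t -> P (s * t).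
    by move=> h1 h2; have := carrierM h1 h2; rewrite mulmx2 !mulr0 !mul0r !addr0 !add0r /P invfM.
  have Pval z : carrier K z -> P (z 0 0).
    move=> Kz; have [z01 z1] := tri z Kz; have z0 := pos z Kz.
    have zV : z 1 1 = (z 0 0)^-1 by apply: (mulfI (lt0r_neq0 z0)); rewrite z1 divff // gt_eqF.
    (* The lower unipotents, in K by [SL2_torus_sub], clear the lower left entry and leave the
       diagonal part of z in K. *)
    have Ku : carrier K (mx2 1 0 (- (z 1 0 * z 0 0)) 1).
      apply: SL2_torus_sub; exists 1, (- (z 1 0 * z 0 0)); rewrite d0 mul0r.
      by split=> //; split=> //; rewrite mul0r subr0 expr1n.
    have := carrierM Kz Ku; rewrite {1}[z]mx2E mulmx2 z01 zV /P; congr (carrier K _).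
    by have zn : z 0 0 != 0; [rewrite gt_eqF|congr mx2; field].
  have PV t : P t -> P t^-1.
    move=> Pt; have := carrierV Pt; have := det1 _ Pt; rewrite !mxE /= => e.
    by rewrite invmx2 // oppr0 /P invrK.
  suff h1 : h 0 0 = 1.
    have [h01 hh] := tri h Kh; apply: fin => //; first by rewrite h1 in hh *; lra.
    - by rewrite h01 d0 mul0r.
    - by rewrite h1.
  apply: contrapT => n1.
  (* By connectedness the upper left entries fill the interval between 1 and h 0 0; inverses are
     taken if h 0 0 < 1. *)
  have [p1 p1gt Pp1] : exists2 p, 1 < p & forall t, 1 <= t <= p -> P t.
    have [lt|gt] : h 0 0 < 1 \/ 1 < h 0 0.
        by apply/orP; rewrite -neq_lt; apply/eqP.
      exists (h 0 0)^-1; first by rewrite invf_gt1 // pos.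
      move=> t /andP[t1 t2]; rewrite -[t]invrK; apply: PV.
      have t0 : 0 < t by lra.
      have [|z Kz <-] := connected_value cK c00 Kh K1 (_ : _ <= t^-1 <= _); last exact: Pval.
      rewrite mxE /= invf_le1 // t1 andbT -[X in X <= _]invrK lef_pV2 ?posrE //.
      by rewrite invr_gt0 pos.
    exists (h 0 0) => // t /andP[t1 t2].
    have [|z Kz <-] := connected_value cK c00 K1 Kh (_ : _ <= t <= _); last exact: Pval.
    by rewrite mxE /= t1 t2.
  pose L := ln p1; have L0 : 0 < L by rewrite ln_gt0.
  have pE : expR L = p1 by rewrite lnK // posrE; lra.
  have Pe u : 0 <= u -> P (expR u).
    move=> u0; have [N hN] : exists N : nat, u <= N%:R * L.
      have := archi_boundP (divr_ge0 u0 (ltW L0)).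
      set N := Num.bound _ => hN; exists N.
      by rewrite -ler_pdivrMr // ltW.
    elim: N u u0 hN => [|N IH] u u0 hN.
      have -> : u = 0 by rewrite mul0r in hN; lra.
      by rewrite expR0 /P invr1 -mx2_1.
    have [le|gt] := leP u L.
      by apply: Pp1; rewrite -pE ler_expR le andbT -expR0 ler_expR.
    rewrite -(subrK L u) expRD; apply: PM.
      by apply: IH; [lra|rewrite -natr1 in hN; lra].
    by apply: Pp1; rewrite pE; lra.
  have Pall u : P (expR u).
    have [u0|u0] := leP 0 u; first exact: Pe.
    by rewrite -[u]opprK expRN; apply/PV/Pe; lra.
  have dN : is_derive (0 : R) (1 : R) (fun t : R => - t) (-1).
    exact: is_deriveN (is_derive_id _ _).
  (* Then K contains the whole diagonal one-parameter subgroup, whose velocity is not a multiple of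
     [wd]. *)
  have opd : one_parameter K (mx2 1 0 0 (-1)) (fun t => mx2 (expR t) 0 0 (expR (- t))).
    split.
    - by move=> s t; rewrite mulmx2 !mulr0 !mul0r !addr0 !add0r -!expRD opprD.
    - by move=> t; rewrite expRN; exact: Pall.
    - apply: is_derive_mx2; try exact: is_derive_cst.
        by have := is_derive_expR (0 : R); rewrite expR0.
      have := @is_derive1_comp _ expR (fun t => - t) 0 _ _ (is_derive_expR _) dN.
      by rewrite oppr0 expR0 mul1r.
  have /LK [c] : lie_algebra K (mx2 1 0 0 (-1)) by eexists; exact: opd.
  rewrite scalemx2 => /mx2_inj [/eqP].
  by rewrite mulr0 oner_eq0.
Qed.

End SL2Classification.

(* Conjugating by [g] replaces the line [R w] by the line [R E]. *)
Lemma slice_of_model {R : realType} {n : nat} (G H : matrix_group R n)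
    (E w g : 'M[R]_n) (s : R) (T : set 'M[R]_n) :
  carrier H `<=` carrier G -> connected (carrier H) ->
  (forall X, lie_algebra H X <-> exists c, X = c *: w) ->
  carrier G g -> s != 0 -> (s *: w) *m g = g *m E ->
  (forall K : matrix_group R n, carrier K `<=` carrier G -> connected (carrier K) ->
     (forall X, lie_algebra K X <-> exists c, X = c *: E) -> forall x, carrier K x <-> T x) ->
  slice G T -> (forall x, T x -> x *m E = E *m x) ->
  slice G H /\ forall h, carrier H h -> h *m w = w *m h.
Proof.
move=> HG cH LH Gg s0 wg model slT TE.
have ug := carrier_unit Gg.
have wgE : w *m g = s^-1 *: (g *m E) by rewrite -wg -scalemxAl scalerA mulVf // scale1r.
pose K := conj_group H ug.
have e x : x = invmx g *m (g *m x *m invmx g) *m g.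
  by rewrite !mulmxA mulVmx // mul1mx mulmxKV.
have KG : carrier K `<=` carrier G.
  move=> x /HG Gx; rewrite [x]e.
  by apply: carrierM => //; apply: carrierM => //; exact: carrierV.
have cK : connected (carrier K) by exact: conj_group_connected.
have LK X : lie_algebra K X <-> exists c, X = c *: E.
  split.
    move=> /(iffLR (conj_group_lie H ug X)) /LH [c ec]; exists (c / s).
    rewrite [LHS]e ec -scalemxAr -scalemxAl -mulmxA wgE -scalemxAr scalerA.
    by rewrite mulKmx.
  move=> [c ->]; apply/(conj_group_lie H ug)/LH; exists (c * s).
  rewrite -scalemxAr -scalemxAl -wg -!scalemxAl scalerA.
  by rewrite mulmxK.
have tE := model K KG cK LK.
split.
  apply: (slice_conj Gg _ slT) => h.
  by rewrite -tE -(conj_groupP H ug).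
move=> h Hh; have [x Tx hE] : exists2 x, T x & h = g *m x *m invmx g.
  exists (invmx g *m h *m g); first exact/tE/(iffLR (conj_groupP H ug h)).
  by rewrite !mulmxA mulmxV // mul1mx mulmxK.
have wE : w = s^-1 *: (g *m E *m invmx g) by rewrite scalemxAl -wgE mulmxK.
rewrite hE wE -scalemxAr -scalemxAl; congr (_ *: _).
by rewrite !mulmxA mulmxKV // mulmxKV // -!mulmxA (mulmxA x) TE // !mulmxA.
Qed.

Section SL2Case.
Context {R : realType}.
Local Notation G := (SL R 2).

(* [g] has columns [v] and [s w v] for a vector [v] that is not an eigenvector
   of [w]. *)
Lemma SL2_companion (w : 'M[R]_2) : w 0 0 + w 1 1 = 0 -> w != 0 ->
  exists (s del : R) (g : 'M[R]_2),
    [/\ s != 0, carrier G g & (s *: w) *m g = g *m mx2 0 del 1 0].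
Proof.
move=> tr0 w0.
pose a := w 0 0; pose b := w 0 1; pose c := w 1 0.
have -> : w = mx2 a b c (- a) by rewrite [LHS]mx2E; congr mx2; rewrite /a; lra.
have [c0|c0] := eqVneq c 0; last first.
  (* Here v is the first basis vector. The scale s is fixed by det g = 1, and del comes from (s w)^2
     = s^2 (a^2 + b c). *)
  exists c^-1, (c^-1 ^+ 2 * (a ^+ 2 + b * c)), (mx2 1 (a / c) 0 1).
  split; [by rewrite invr_eq0|by apply/SL2P; lra|].
  by rewrite scalemx2 !mulmx2; congr mx2; field.
have [b0|b0] := eqVneq b 0; last first.
  exists (- b^-1), (b^-1 ^+ 2 * (a ^+ 2 + b * c)), (mx2 0 (-1) 1 (a / b)).
  split; [by rewrite oppr_eq0 invr_eq0|by apply/SL2P; lra|].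
  by rewrite scalemx2 !mulmx2; congr mx2; field.
have a0 : a != 0.
  apply: contraNneq w0 => a0; rewrite [w]mx2E -/a -/b -/c a0 b0 c0 mx2_0.
  by apply/eqP; congr mx2; rewrite -/a in tr0; lra.
(* Both basis vectors are eigenvectors of the diagonal matrix w, so v = (1, 1); with this s, (s w)^2
   = 1 / 4. *)
exists (- (2 * a)^-1), (1 / 4), (mx2 1 (- 1 / 2) 1 (1 / 2)).
split; first by rewrite oppr_eq0 invr_eq0 mulf_neq0 // pnatr_eq0.
  by apply/SL2P; lra.
by rewrite b0 c0 scalemx2 !mulmx2; congr mx2; field.
Qed.

Lemma torus_comm (del : R) (x : 'M[R]_2) : torus del x ->
  x *m mx2 0 del 1 0 = mx2 0 del 1 0 *m x.
Proof. by move=> [a [b [-> _]]]; rewrite !mulmx2; congr mx2; ring. Qed.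

(** Since dim sl(2) = 3, a quotient of dimension 2 leaves a line for the Lie algebra of H; w spans
    it. *)
Lemma SL2_reduction_hypotheses (H : matrix_group R 2) :
  carrier H `<=` carrier G -> connected (carrier H) -> quotient_dim G H 2 ->
  [/\ infinitesimally_closed G, slice G H &
      exists w, (forall h, carrier H h -> h *m w = w *m h) /\ orbit_rigid G w].
Proof.
move=> HG cH [V [W [LV LW dVW]]].
have exV : exists V : {vspace 'M[R]_2}, forall X, lie_algebra G X <-> X \in V by exists V.
have dW : \dim W = 1%N by move: dVW; rewrite (SL2_dim_lie LV) addn2 => -[].
have [w w0 Ww] := dim1_line dW.
have Hw : lie_algebra H w by apply/LW/Ww; exists 1; rewrite scale1r.
have Gw : lie_algebra G w.
  by have [phi [pD Hp d0]] := Hw; exists phi; split=> // t; exact/HG/Hp.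
have [s [del [g [s0 Gg wg]]]] := SL2_companion (SL2_lie_traceless Gw) w0.
have LH X : lie_algebra H X <-> exists c, X = c *: w by rewrite LW Ww.
have model (K : matrix_group R 2) : carrier K `<=` carrier G -> connected (carrier K) ->
    (forall X, lie_algebra K X <-> exists c, X = c *: mx2 0 del 1 0) ->
    forall x, carrier K x <-> torus del x.
  by move=> KG cK LK x; split; [exact: (SL2_sub_torus KG cK LK)|exact: (SL2_torus_sub KG LK)].
have [sl cent] := slice_of_model HG cH LH Gg s0 wg model (torus_slice del) (@torus_comm del).
split=> //; first exact: SL2_infinitesimally_closed.
exists w; split=> //.
by apply: SL2_orbit_rigid => //; exact: SL2_lie_traceless.
Qed.

End SL2Case.

(** * SO(3) *)

Local Notation j0 := (ord0 : 'I_3).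
Local Notation j1 := (lift ord0 ord0 : 'I_3).
Local Notation j2 := (lift ord0 (lift ord0 ord0) : 'I_3).

Section ThreeByThree.
Context {R : realType}.
Implicit Types (a b c d e f g h k t : R) (A B X : 'M[R]_3).

Definition mx3 a b c d e f g h k : 'M[R]_3 :=
  \matrix_(i, j) nth 0 (nth [::] [:: [:: a; b; c]; [:: d; e; f]; [:: g; h; k]] i) j.

Lemma ord3E (i : 'I_3) : [\/ i = j0, i = j1 | i = j2].
Proof.
by case: i => [[|[|[|//]]] p]; [constructor 1|constructor 2|constructor 3]; exact: val_inj.
Qed.

Lemma mx3P A B :
  [/\ A j0 j0 = B j0 j0, A j0 j1 = B j0 j1 & A j0 j2 = B j0 j2] ->
  [/\ A j1 j0 = B j1 j0, A j1 j1 = B j1 j1 & A j1 j2 = B j1 j2] ->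
  [/\ A j2 j0 = B j2 j0, A j2 j1 = B j2 j1 & A j2 j2 = B j2 j2] -> A = B.
Proof.
move=> [? ? ?] [? ? ?] [? ? ?]; apply/matrixP => i j.
by case: (ord3E i) => ->; case: (ord3E j) => ->.
Qed.

Lemma mx3E A : A = mx3 (A j0 j0) (A j0 j1) (A j0 j2) (A j1 j0) (A j1 j1) (A j1 j2)
  (A j2 j0) (A j2 j1) (A j2 j2).
Proof. by apply: mx3P; split; rewrite mxE. Qed.

Lemma mx3_inj a b c d e f g h k a' b' c' d' e' f' g' h' k' :
  mx3 a b c d e f g h k = mx3 a' b' c' d' e' f' g' h' k' ->
  [/\ [/\ a = a', b = b' & c = c'], [/\ d = d', e = e' & f = f'] &
      [/\ g = g', h = h' & k = k']].
Proof.
move=> /matrixP E.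
by split; split; [have := E j0 j0|have := E j0 j1|have := E j0 j2|have := E j1 j0|
  have := E j1 j1|have := E j1 j2|have := E j2 j0|have := E j2 j1|have := E j2 j2];
  rewrite !mxE.
Qed.

Lemma sum3E (F : 'I_3 -> R) : \sum_i F i = F j0 + F j1 + F j2.
Proof. by rewrite !big_ord_recl big_ord0 addr0 addrA. Qed.

Lemma mulmx3 a b c d e f g h k a' b' c' d' e' f' g' h' k' :
  mx3 a b c d e f g h k *m mx3 a' b' c' d' e' f' g' h' k' =
  mx3 (a * a' + b * d' + c * g') (a * b' + b * e' + c * h') (a * c' + b * f' + c * k')
      (d * a' + e * d' + f * g') (d * b' + e * e' + f * h') (d * c' + e * f' + f * k')
      (g * a' + h * d' + k * g') (g * b' + h * e' + k * h') (g * c' + h * f' + k * k').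
Proof. by apply: mx3P; split; rewrite !mxE sum3E !mxE. Qed.

Lemma addmx3 a b c d e f g h k a' b' c' d' e' f' g' h' k' :
  mx3 a b c d e f g h k + mx3 a' b' c' d' e' f' g' h' k' =
  mx3 (a + a') (b + b') (c + c') (d + d') (e + e') (f + f') (g + g') (h + h') (k + k').
Proof. by apply: mx3P; split; rewrite !mxE. Qed.

Lemma oppmx3 a b c d e f g h k :
  - mx3 a b c d e f g h k = mx3 (- a) (- b) (- c) (- d) (- e) (- f) (- g) (- h) (- k).
Proof. by apply: mx3P; split; rewrite !mxE. Qed.

Lemma scalemx3 t a b c d e f g h k :
  t *: mx3 a b c d e f g h k =
  mx3 (t * a) (t * b) (t * c) (t * d) (t * e) (t * f) (t * g) (t * h) (t * k).
Proof. by apply: mx3P; split; rewrite !mxE. Qed.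

Lemma trmx3 a b c d e f g h k :
  (mx3 a b c d e f g h k)^T = mx3 a d g b e h c f k.
Proof. by apply: mx3P; split; rewrite !mxE. Qed.

Lemma mx3_0 : 0 = mx3 0 0 0 0 0 0 0 0 0.
Proof. by apply: mx3P; split; rewrite !mxE. Qed.

Lemma mx3_1 : 1%:M = mx3 1 0 0 0 1 0 0 0 1.
Proof. by apply: mx3P; split; rewrite !mxE. Qed.

Lemma det_mx3 a b c d e f g h k :
  \det (mx3 a b c d e f g h k) = a * (e * k - f * h) - b * (d * k - f * g) + c * (d * h - e * g).
Proof.
rewrite (expand_det_row _ ord0) sum3E /cofactor !det_mx2 !mxE /=.
by rewrite !exprS expr0; ring.
Qed.

Lemma is_derive_mx3 (a b c d e f g h k : R -> R) (t a' b' c' d' e' f' g' h' k' : R) :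
  is_derive t (1 : R) a a' -> is_derive t (1 : R) b b' -> is_derive t (1 : R) c c' ->
  is_derive t (1 : R) d d' -> is_derive t (1 : R) e e' -> is_derive t (1 : R) f f' ->
  is_derive t (1 : R) g g' -> is_derive t (1 : R) h h' -> is_derive t (1 : R) k k' ->
  is_derive t (1 : R)
    (fun s => mx3 (a s) (b s) (c s) (d s) (e s) (f s) (g s) (h s) (k s))
    (mx3 a' b' c' d' e' f' g' h' k').
Proof.
move=> *; apply/is_derive_mxP => i j.
rewrite mxE (_ : (fun s => mx3 _ _ _ _ _ _ _ _ _ i j) = (fun s => nth 0 (nth [::]
   [:: [:: a s; b s; c s]; [:: d s; e s; f s]; [:: g s; h s; k s]] i) j)).
  by case: (ord3E i) => ->; case: (ord3E j) => ->.
by apply/funext => s; rewrite mxE.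
Qed.

Lemma Coo_mx3 {V : normedModType R} (a b c d e f g h k : V -> R) :
  Coo a -> Coo b -> Coo c -> Coo d -> Coo e -> Coo f -> Coo g -> Coo h -> Coo k ->
  Coo_mx (fun s => mx3 (a s) (b s) (c s) (d s) (e s) (f s) (g s) (h s) (k s)).
Proof.
move=> ca cb cc cd ce cf cg ch ck i j.
rewrite (_ : (fun s => mx3 _ _ _ _ _ _ _ _ _ i j) = (fun s => nth 0 (nth [::]
   [:: [:: a s; b s; c s]; [:: d s; e s; f s]; [:: g s; h s; k s]] i) j)).
  by case: (ord3E i) => ->; case: (ord3E j) => ->.
by apply/funext => s; rewrite mxE.
Qed.

End ThreeByThree.

(** * The Lie algebra of SO(3) *)

Section SO3LieAlgebra.
Context {R : realType}.
Local Notation G := (SO R 3).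

Lemma SO_invmx {n} (g : 'M[R]_n) : carrier (SO R n) g -> invmx g = g^T.
Proof.
by move=> Gg; have [ort _] := Gg; rewrite -[RHS](mulKmx (carrier_unit Gg)) ort mulmx1.
Qed.

Lemma SO_trmx {n} (g : 'M[R]_n) : carrier (SO R n) g -> carrier (SO R n) g^T.
Proof. by move=> Gg; rewrite -SO_invmx //; exact: carrierV. Qed.

Lemma SO_trmul {n} (g : 'M[R]_n) : carrier (SO R n) g -> g^T *m g = 1%:M.
Proof. by move=> Gg; rewrite -SO_invmx // mulVmx // (carrier_unit Gg). Qed.

Lemma is_derive_trmx {n} (a : R -> 'M[R]_n) (t : R) A :
  is_derive t (1 : R) a A -> is_derive t (1 : R) (fun s => (a s)^T) A^T.
Proof.
move=> /(iffLR (is_derive_mxP _ _ _ _)) da; apply/is_derive_mxP => i j.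
rewrite mxE (_ : (fun s => _) = (fun s => a s j i)) //.
by apply/funext => s; rewrite mxE.
Qed.

Lemma SO_lie_skew {n} (X : 'M[R]_n) : lie_algebra (SO R n) X -> X^T = - X.
Proof.
move=> [phi op]; have [_ Gp d0] := op.
have [_] := is_derive_mulmx (is_derive_trmx d0) d0.
rewrite (_ : (fun s => _) = (fun=> 1%:M)); last first.
  by apply/funext => s; exact: SO_trmul.
rewrite derive_cst (one_parameter0 op) trmx1 mul1mx mulmx1 => /esym/eqP.
by rewrite addr_eq0 => /eqP.
Qed.

(** The entries of x^T x are smooth and constant on the group; their derivatives at g in the
    direction C give the skewness. *)
Lemma SO_infinitesimal_skew {n} (g C : 'M[R]_n) : carrier (SO R n) g ->
  (forall F : 'M[R]_n -> R, Coo F ->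
    (forall x y, carrier (SO R n) x -> carrier (SO R n) y -> F x = F y) -> 'D_C F g = 0) ->
  (invmx g *m C)^T = - (invmx g *m C).
Proof.
move=> Gg H; rewrite SO_invmx // trmx_mul trmxK; apply/eqP; rewrite -addr_eq0.
apply/eqP/matrixP => i j; rewrite [RHS]mxE.
pose F (x : 'M[R]_n) := (x^T *m x) i j.
have cF : Coo F.
  apply: (Coo_mx_mul (S := fun x : 'M[R]_n => x^T) (T := fun x => x)); last exact: Coo_id_mx.
  move=> k l; rewrite (_ : (fun y => _) = (fun y : 'M[R]_n => y l k)); first exact: Coo_coord.
  by apply/funext => y; rewrite mxE.
have Fc x y : carrier (SO R n) x -> carrier (SO R n) y -> F x = F y.
  by move=> Gx Gy; rewrite /F !SO_trmul.
have H0 := H F cF Fc.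
have dl : is_derive (0 : R) (1 : R) (fun s : R => g + s *: C) C.
  apply/is_derive_mxP => k l.
  rewrite (_ : (fun s => _) = (fun s => g k l + s * C k l)); last first.
    by apply/funext => s; rewrite !mxE.
  have [d v] := is_deriveD (is_derive_cst (g k l) (0 : R) (1 : R))
    (is_deriveM (is_derive_id (0:R) (1:R)) (is_derive_cst (C k l) (0:R) (1:R))).
  apply: DeriveDef; first exact: d.
  by rewrite v add0r scaler0 add0r [_ *: _]mulr1.
have /(iffLR (is_derive_mxP _ _ _ _)) /(_ i j) [_] := is_derive_mulmx (is_derive_trmx dl) dl.
rewrite scale0r addr0 => <-.
have [_] := is_derive_line cF g C 0; rewrite scale0r addr0 => e.
exact: (etrans e H0).
Qed.

(** The matrix of the cross product with (a, b, c). *)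
Definition hat (a b c : R) : 'M[R]_3 := mx3 0 (- c) b c 0 (- a) (- b) a 0.

Lemma skew_hat (X : 'M[R]_3) : X^T = - X -> X = hat (X j2 j1) (X j0 j2) (X j1 j0).
Proof.
rewrite {1 2}[X]mx3E trmx3 oppmx3 => /mx3_inj [[e1 e2 e3] [e4 e5 e6] [e7 e8 e9]].
by rewrite [LHS]mx3E /hat; congr mx3; lra.
Qed.

Lemma SO3P a b c d e f g h k : carrier G (mx3 a b c d e f g h k) <->
  mx3 a b c d e f g h k *m (mx3 a b c d e f g h k)^T = 1%:M /\
  a * (e * k - f * h) - b * (d * k - f * g) + c * (d * h - e * g) = 1.
Proof. by rewrite -det_mx3. Qed.

Definition rotz (a b : R) : 'M[R]_3 := mx3 a (- b) 0 b a 0 0 0 1.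

(** The entries are arranged as the product law of [norm_one_generated] for del = -1. *)
Lemma rotz_mul a b c d : rotz a b *m rotz c d = rotz (a * c + -1 * (b * d)) (a * d + b * c).
Proof. by rewrite mulmx3 /rotz; congr mx3; ring. Qed.

Lemma SO3_rotz a b : a ^+ 2 + b ^+ 2 = 1 -> carrier G (rotz a b).
Proof.
move=> n1; apply/SO3P; split; last by lra.
by rewrite trmx3 mulmx3 mx3_1; congr mx3; lra.
Qed.

(** The rotation permuting the axes cyclically; conjugation by it reduces the other axes to the
    third. *)
Definition perm3 : 'M[R]_3 := mx3 0 0 1 1 0 0 0 1 0.

Lemma SO3_perm3 : carrier G perm3.
Proof.
apply/SO3P; split; last by lra.
by rewrite trmx3 mulmx3 mx3_1; congr mx3; lra.
Qed.

Lemma rotz_one_parameter : one_parameter G (hat 0 0 1) (fun t => rotz (cos t) (sin t)).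
Proof.
split.
- by move=> s t; rewrite rotz_mul cosD sinD; congr rotz; ring.
- by move=> t; apply: SO3_rotz; exact: cos2Dsin2.
- have ds := is_derive_sin (0 : R); have dc := is_derive_cos (0 : R).
  rewrite cos0 in ds; rewrite sin0 oppr0 in dc.
  apply: is_derive_mx3; rewrite ?oppr0; try exact: is_derive_cst; try exact: dc; try exact: ds.
Qed.

Lemma perm3_hat a b c : perm3 *m hat a b c *m invmx perm3 = hat c a b.
Proof.
rewrite SO_invmx; last exact: SO3_perm3.
by rewrite trmx3 !mulmx3 /hat; congr mx3; ring.
Qed.

Lemma SO3_lie_algebraP (V : {vspace 'M[R]_3}) :
  (forall X, lie_algebra G X <-> X \in V) ->
  forall X, lie_algebra G X <-> X^T = - X.
Proof.
move=> LV X; split; first exact: SO_lie_skew.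
move=> sk; apply/LV; rewrite (skew_hat sk).
have h3 : lie_algebra G (hat 0 0 1) by eexists; exact: rotz_one_parameter.
have h1 : lie_algebra G (hat 1 0 0).
  by rewrite -perm3_hat; apply: lie_algebra_conj => //; exact: SO3_perm3.
have h2 : lie_algebra G (hat 0 1 0).
  by rewrite -perm3_hat; apply: lie_algebra_conj => //; exact: SO3_perm3.
set a := X _ _; set b := X _ _; set c := X _ _.
have -> : hat a b c = a *: hat 1 0 0 + b *: hat 0 1 0 + c *: hat 0 0 1.
  by rewrite /hat !scalemx3 !addmx3; congr mx3; ring.
by rewrite !memvD ?memvZ //; exact/LV.
Qed.

Lemma SO3_dim_lie (V : {vspace 'M[R]_3}) :
  (forall X, lie_algebra G X <-> X \in V) -> \dim V = 3%N.
Proof.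
move=> LV; have tV X : X \in V <-> X^T = - X.
  by rewrite -(SO3_lie_algebraP LV); split=> /LV.
have hV a b c : hat a b c \in V.
  by apply/tV; rewrite trmx3 oppmx3; congr mx3; ring.
apply: (@dim3_basis _ _ V (hat 1 0 0) (hat 0 1 0) (hat 0 0 1)) => //.
- move=> X /tV /skew_hat e; exists (X j2 j1), (X j0 j2), (X j1 j0); rewrite [LHS]e.
  by rewrite /hat !scalemx3 !addmx3; congr mx3; ring.
- move=> a b c; rewrite /hat !scalemx3 !addmx3 mx3_0 => /mx3_inj [[_ e1 e2] [_ _ e3] _].
  by split; lra.
Qed.

Lemma SO3_infinitesimally_closed :
  (exists V : {vspace 'M[R]_3}, forall X, lie_algebra G X <-> X \in V) ->
  infinitesimally_closed G.
Proof.
move=> [V LV] g C Gg H; apply/(SO3_lie_algebraP LV).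
exact: SO_infinitesimal_skew.
Qed.

End SO3LieAlgebra.

(** * Rotations: generation, a local section, rigidity of orbits *)

Section SO3Case.
Context {R : realType}.
Local Notation G := (SO R 3).

(** The circle is the norm-one group for del = -1, and the addition formulas make the points (cos t,
    sin t) closed under its product. *)
Lemma circle_param (a b : R) : a ^+ 2 + b ^+ 2 = 1 -> exists t, a = cos t /\ b = sin t.
Proof.
move=> n1; apply: (@norm_one_generated _ (-1) (fun a b => exists t, a = cos t /\ b = sin t)).
- move=> c d e f [s [-> ->]] [t [-> ->]]; exists (s + t).
  by rewrite cosD sinD; split; ring.
- have ds := is_derive_sin (0 : R); rewrite cos0 in ds.
  have [e e0 cov] := curve_covers (@continuous_cos R) (@continuous_sin R) (cos0 R) (sin0 R) ds.
  exists e => // c d c0 n /cov [t td ct]; exists t; split=> //.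
  have := cos2Dsin2 t; rewrite td => n'.
  have /eqP : c ^+ 2 = cos t ^+ 2 by lra.
  by rewrite eqrXn2 ?ltW // => /eqP.
- by split; [lra|rewrite ler0N1].
Qed.

Lemma polar (x y : R) : exists r t,
  [/\ 0 <= r, r ^+ 2 = x ^+ 2 + y ^+ 2, x = r * cos t & y = r * sin t].
Proof.
pose r := Num.sqrt (x ^+ 2 + y ^+ 2).
have r2 : r ^+ 2 = x ^+ 2 + y ^+ 2 by rewrite sqr_sqrtr // addr_ge0 // sqr_ge0.
exists r; have [r0|r0] := eqVneq r 0.
  have := r2; rewrite r0 expr0n /= => /esym/eqP.
  rewrite paddr_eq0 ?sqr_ge0 // !sqrf_eq0 => /andP[/eqP -> /eqP ->].
  by exists 0; rewrite !mul0r expr0n addr0; split.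
have [|t [ct st]] := @circle_param (x / r) (y / r).
  by rewrite !exprMn -mulrDl -r2 -exprMn divff // expr1n.
by exists t; rewrite -ct -st; split; rewrite ?sqrtr_ge0 //; field.
Qed.

Lemma SO3_rows (g : 'M[R]_3) : carrier G g ->
  [/\ [/\ g j0 j0 ^+ 2 + g j0 j1 ^+ 2 + g j0 j2 ^+ 2 = 1,
          g j1 j0 ^+ 2 + g j1 j1 ^+ 2 + g j1 j2 ^+ 2 = 1 &
          g j2 j0 ^+ 2 + g j2 j1 ^+ 2 + g j2 j2 ^+ 2 = 1],
      [/\ g j0 j0 * g j1 j0 + g j0 j1 * g j1 j1 + g j0 j2 * g j1 j2 = 0,
          g j0 j0 * g j2 j0 + g j0 j1 * g j2 j1 + g j0 j2 * g j2 j2 = 0 &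
          g j1 j0 * g j2 j0 + g j1 j1 * g j2 j1 + g j1 j2 * g j2 j2 = 0] &
      g j0 j0 * (g j1 j1 * g j2 j2 - g j1 j2 * g j2 j1)
      - g j0 j1 * (g j1 j0 * g j2 j2 - g j1 j2 * g j2 j0)
      + g j0 j2 * (g j1 j0 * g j2 j1 - g j1 j1 * g j2 j0) = 1].
Proof.
rewrite {1}[g]mx3E => /SO3P [E dt]; rewrite trmx3 mulmx3 mx3_1 in E.
have [[e1 e2 e3] [e4 e5 e6] [e7 e8 e9]] := mx3_inj E.
by split=> //; split; lra.
Qed.

Lemma SO3_fix_row (g : 'M[R]_3) : carrier G g ->
  g j2 j0 = 0 -> g j2 j1 = 0 -> g j2 j2 = 1 ->
  exists a b, g = rotz a b /\ a ^+ 2 + b ^+ 2 = 1.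
Proof.
move=> Gg z0 z1 z2; have [[r0 r1 r2] [q1 q2 q3] dt] := SO3_rows Gg.
rewrite z0 z1 z2 in q2 q3 dt.
have c0 : g j0 j2 = 0 by lra.
have c1 : g j1 j2 = 0 by lra.
rewrite c0 c1 in r0 r1 q1 dt.
have : (g j0 j0 - g j1 j1) ^+ 2 + (g j0 j1 + g j1 j0) ^+ 2 = 0 by lra.
move/eqP; rewrite paddr_eq0 ?sqr_ge0 // !sqrf_eq0 subr_eq0 addr_eq0 => /andP[/eqP e1 /eqP e2].
exists (g j0 j0), (g j1 j0); split; last by rewrite e2 in r0; lra.
by rewrite [LHS]mx3E /rotz z0 z1 z2 c0 c1 -e1 e2.
Qed.

Lemma SO3_fix_col (g : 'M[R]_3) : carrier G g ->
  g j0 j2 = 0 -> g j1 j2 = 0 -> g j2 j2 = 1 ->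
  exists a b, g = rotz a b /\ a ^+ 2 + b ^+ 2 = 1.
Proof.
move=> Gg z0 z1 z2; have [|||a [b [e n1]]] := SO3_fix_row (SO_trmx Gg); rewrite ?mxE //.
exists a, (- b); split; last by rewrite sqrrN.
by rewrite -[g]trmxK e trmx3 /rotz opprK.
Qed.

(** Euler angles read on the last row: a rotation about the third axis clears its first entry, one
    about the first axis turns it into (0, 0, 1), and a rotation about the third axis remains. *)
Lemma SO3_generated : generated_by_one_parameter G.
Proof.
move=> phi inv; suff H : forall g : G, phi g = phi (group_elt (carrier1 G)).
  by move=> ? ?; rewrite H [RHS]H.
have oz := @rotz_one_parameter R.
have ox := one_parameter_conj oz (@SO3_perm3 R).
have rot_x t : perm3 *m rotz (cos t) (sin t) *m invmx perm3 =
    mx3 1 0 0 0 (cos t) (- sin t) 0 (sin t) (cos t) :> 'M[R]_3.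
  rewrite SO_invmx; last exact: SO3_perm3.
  by rewrite trmx3 !mulmx3; congr mx3; ring.
have Gz t : carrier G (rotz (cos t) (sin t)) by apply: SO3_rotz; exact: cos2Dsin2.
have Gx t : carrier G (mx3 1 0 0 0 (cos t) (- sin t) 0 (sin t) (cos t)).
  by rewrite -rot_x; have [_ + _] := ox; exact.
move=> g; have Gg := group_eltP g.
have [r [t [_ _ y1 x1]]] := polar (val g j2 j1) (val g j2 j0).
pose g1 : G := group_elt (carrierM Gg (Gz (- t))).
have -> : phi g = phi g1 by apply/esym; exact: (inv _ _ _ _ (- t) oz).
have g1x : val g1 j2 j0 = 0.
  rewrite /= [val g]mx3E mulmx3 mxE /= cosN sinN x1 y1; ring.
have [r' [s [r0 r2 z2 y2]]] := polar (val g1 j2 j2) (val g1 j2 j1).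
pose g2 : G := group_elt (carrierM (group_eltP g1) (Gx (- s))).
have -> : phi g1 = phi g2.
  by apply/esym; apply: (inv _ _ _ _ (- s) ox); rewrite rot_x.
have Gg1 := group_eltP g1; have [[_ _ n1] _ _] := SO3_rows Gg1.
have r1 : r' = 1.
  have /eqP : r' ^+ 2 = 1 ^+ 2 by rewrite g1x in n1; lra.
  by rewrite eqrXn2 ?ler01 // => /eqP.
rewrite r1 !mul1r in z2 y2.
have g2E : val g2 = val g1 *m mx3 1 0 0 0 (cos (- s)) (- sin (- s)) 0 (sin (- s)) (cos (- s)) by [].
set A := val g1 in g1x z2 y2 g2E.
have [|||a [b [e n2]]] := SO3_fix_row (group_eltP g2).
- by rewrite g2E [A]mx3E mulmx3 mxE /= g1x; ring.
- by rewrite g2E [A]mx3E mulmx3 mxE /= g1x z2 y2 cosN sinN; ring.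
- rewrite g2E [A]mx3E mulmx3 mxE /= g1x z2 y2 cosN sinN.
  by rewrite -(cos2Dsin2 s); ring.
have [u [ua ub]] := circle_param n2.
apply/esym; apply: (inv _ _ _ _ (- u) oz) => /=.
rewrite -[val g2]/(val g2) in e *; rewrite [_ *m _ as X in _ = X *m _]e.
by rewrite ua ub rotz_mul cosN sinN mx3_1 /rotz; congr mx3; have := cos2Dsin2 u; lra.
Qed.

(* The rotation of axis [e3 x (x, y, z)] mapping [e3] to the unit vector
   [(x, y, z)], where d = 1 / (1 + z). *)
Definition tilt (x y z d : R) : 'M[R]_3 :=
  mx3 (1 - x ^+ 2 * d) (- (x * y * d)) x (- (x * y * d)) (1 - y ^+ 2 * d) y (- x) (- y) z.

Lemma SO3_tilt x y z d : x ^+ 2 + y ^+ 2 + z ^+ 2 = 1 -> d * (1 + z) = 1 ->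
  carrier G (tilt x y z d).
Proof.
move=> n1 dz.
(* [k1] and [k2] multiplied by monomials make the orthogonality and determinant equations linear. *)
have k1 : d * (x ^+ 2 + y ^+ 2) = 1 - z.
  have -> : x ^+ 2 + y ^+ 2 = (1 + z) * (1 - z) by lra.
  by rewrite mulrA dz mul1r.
have dzE : d * z = 1 - d by lra.
have k2 : d ^+ 2 * (x ^+ 2 + y ^+ 2) = 2 * d - 1.
  by rewrite expr2 -mulrA k1 mulrBr dzE; ring.
have kx := congr1 ( *%R (x ^+ 2)) k2; have ky := congr1 ( *%R (y ^+ 2)) k2.
have kxy := congr1 ( *%R (x * y)) k2.
have lx := congr1 ( *%R x) k1; have ly := congr1 ( *%R y) k1.
apply/SO3P; split.
  by rewrite trmx3 mulmx3 mx3_1; congr mx3; lra.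
have m1 := congr1 ( *%R (y ^+ 2)) dzE; have m2 := congr1 ( *%R (x ^+ 2)) dzE.
have m3 := congr1 ( *%R (x ^+ 2 * y ^+ 2 * d)) dzE.
lra.
Qed.

(** The coset of g is determined by its third column g e3; the tilt with that column differs from g
    by a rotation fixing e3. The cut-off is nonzero only for z = g j2 j2 > 0, where [d] is 1 / (1 +
    z); the flat term keeps the denominator nonzero elsewhere, in particular at z = -1. *)
Lemma SO3_slice : slice G [set A | exists a b, A = rotz a b /\ a ^+ 2 + b ^+ 2 = 1].
Proof.
pose den (z : R) := (1 + z) ^+ 2 + flat 0 (- z).
have den0 z : den z != 0.
  have [z0|z0] := leP 0 z.
    by rewrite gt_eqF // ltr_wpDr ?flat_ge0 // exprn_gt0 //; lra.
  by rewrite gt_eqF // ltr_wpDl ?sqr_ge0 // flat_gt0 //; lra.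
pose d (g : 'M[R]_3) := (1 + g j2 j2) * (den (g j2 j2))^-1.
have c (i j : 'I_3) : Coo (fun g : 'M[R]_3 => g i j) := Coo_coord i j.
have cd : Coo d.
  have c1 : Coo (fun g : 'M[R]_3 => 1 + g j2 j2) by apply: CooD => //; exact: Coo_cst.
  apply: CooM => //; apply: Coo_inv => // ; apply: CooD; first exact: CooM.
  by apply: (Coo_comp1 (Coo_flat 0)); exact: CooN.
exists (fun g : 'M[R]_3 => flat 0 (g j2 j2)), (fun g : 'M[R]_3 => tilt (g j0 j2) (g j1 j2) (g j2 j2) (d g)).
split.
- exact: (Coo_comp1 (Coo_flat 0)).
- have c1 : Coo (fun _ : 'M[R]_3 => 1 : R) by exact: Coo_cst.
  have cxyd : Coo (fun g : 'M[R]_3 => - (g j0 j2 * g j1 j2 * d g)).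
    by apply: CooN; apply: CooM => //; exact: CooM.
  apply: Coo_mx3 => //; try exact: CooN.
    by apply: CooB => //; apply: CooM => //; exact: CooM.
  by apply: CooB => //; apply: CooM => //; exact: CooM.
- by rewrite mxE /=; apply/eqP; rewrite gt_eqF // flat_gt0.
- move=> g h _ [a [b [-> _]]].
  have e i : (g *m rotz a b) i j2 = g i j2.
    by rewrite mxE sum3E !mxE /= !mulr0 mulr1 !add0r.
  by rewrite /d !e.
- move=> g Gg n0; have z0 : 0 < g j2 j2.
    by rewrite ltNge; apply/negP => le; apply: n0; rewrite flat_le0.
  have dE : d g * (1 + g j2 j2) = 1.
    rewrite /d /den flat_le0 ?addr0; last by lra.
    by field; rewrite gt_eqF //; lra.
  have [[_ _ n1] _ _] := SO3_rows (SO_trmx Gg); rewrite !mxE in n1.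
  have Gt := SO3_tilt n1 dE.
  have Gm : carrier G (invmx g *m tilt (g j0 j2) (g j1 j2) (g j2 j2) (d g)).
    by apply: carrierM => //; exact: carrierV.
  have col i : (invmx g *m tilt (g j0 j2) (g j1 j2) (g j2 j2) (d g)) i j2 = (1%:M : 'M[R]_3) i j2.
    rewrite SO_invmx // -(SO_trmul Gg) !mxE; apply: eq_bigr => k _; congr (_ * _).
    by case: (ord3E k) => ->; rewrite mxE.
  by apply: SO3_fix_col; rewrite ?col ?mxE.
Qed.

(** Symmetric matrices pair to zero with so(3), so [om] is determined on skew ones, where om (hat u)
    (hat v) = l(u x v) for a linear form l. As (w x a) x (w x b) = (w . (a x b)) w, the hypothesis
    gives l = 0 on the orbit; cyclic permutations and a half-turn then isolate each coordinate of
    l. *)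
Lemma SO3_orbit_rigid (w : 'M[R]_3) : w^T = - w -> w != 0 ->
  (forall X, lie_algebra G X -> X^T = - X) -> orbit_rigid G w.
Proof.
move=> skw w0 sk om lin anti nul orb.
have diag A : om A A = 0 by have := anti A A; lra.
have lin0 A : om 0 A = 0.
  have := lin (-1) 0 0 A; rewrite scaler0 addr0; lra.
have linr (a : R) X Y C : om C (a *: X + Y) = a * om C X + om C Y.
  by rewrite anti lin (anti X) (anti Y); ring.
have zr C : om C 0 = 0 by rewrite anti lin0 oppr0.
pose e1 := hat 1 0 0 : 'M[R]_3; pose e2 := hat 0 1 0 : 'M[R]_3; pose e3 := hat 0 0 1 : 'M[R]_3.
have om_sym A B : A^T = A -> om A B = 0.
  move=> sA; apply: nul => X /sk sX.
  have : \tr (A *m X) = - \tr (A *m X).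
    by rewrite -{1}[A *m X]trmxK mxtrace_tr trmx_mul sA sX mulNmx raddfN /= mxtrace_mulC.
  lra.
have om_hat a b c a' b' c' : om (hat a b c) (hat a' b' c') =
    (b * c' - c * b') * om e2 e3 + (c * a' - a * c') * om e3 e1 + (a * b' - b * a') * om e1 e2.
  have dec x y z : hat x y z = x *: e1 + (y *: e2 + (z *: e3 + 0)) :> 'M[R]_3.
    by rewrite /e1 /e2 /e3 /hat addr0 !scalemx3 !addmx3; congr mx3; ring.
  rewrite !dec !lin !linr !lin0 !zr !diag (anti e2 e1) (anti e3 e2) (anti e1 e3); ring.
have bracket a b c a' b' c' : hat a b c *m hat a' b' c' - hat a' b' c' *m hat a b c =
    hat (b * c' - c * b') (c * a' - a * c') (a * b' - b * a') :> 'M[R]_3.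
  by rewrite !mulmx3 oppmx3 addmx3 /hat; congr mx3; ring.
pose O a b c := exists2 y, carrier G y & y *m w *m invmx y = hat a b c.
have key a b c : O a b c -> a * om e2 e3 + b * om e3 e1 + c * om e1 e2 = 0.
  move=> [y Gy E]; have P A B := orb y A B Gy; rewrite /= E in P.
  set l := _ + _ + _.
  have l1 : a * l = 0 by have := P e2 e3; rewrite !bracket om_hat /l; lra.
  have l2 : b * l = 0 by have := P e3 e1; rewrite !bracket om_hat /l; lra.
  have l3 : c * l = 0 by have := P e1 e2; rewrite !bracket om_hat /l; lra.
  apply/eqP; apply: contraT => l0.
  have z x : x * l = 0 -> x = 0 by move/eqP; rewrite mulf_eq0 (negbTE l0) orbF => /eqP.
  have uy := carrier_unit Gy.
  have E0 : y *m w *m invmx y = 0.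
    by rewrite E (z a) // (z b) // (z c) // /hat oppr0 -mx3_0.
  move/negP: w0; case; apply/eqP.
  by rewrite -[w](mulKmx uy) -[y *m w](mulmxKV uy) E0 mul0mx mulmx0.
have OM a b c y : carrier G y -> O a b c -> exists2 y', carrier G y' &
    y' *m w *m invmx y' = y *m hat a b c *m invmx y.
  move=> Gy [y' Gy' E]; exists (y *m y'); first exact: carrierM.
  by rewrite (invmx_mul (carrier_unit Gy) (carrier_unit Gy')) -E !mulmxA.
have Operm a b c : O a b c -> O c a b.
  by move=> /(OM _ _ _ _ (@SO3_perm3 R)) [y Gy E]; exists y => //; rewrite E perm3_hat.
have Osign a b c : O a b c -> O (- a) (- b) c.
  have Gs : carrier G (rotz (-1) 0 : 'M[R]_3) by apply: SO3_rotz; lra.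
  move=> /(OM _ _ _ _ Gs) [y Gy E]; exists y => //; rewrite E SO_invmx //.
  by rewrite trmx3 !mulmx3 /hat; congr mx3; ring.
have O0 : O (w j2 j1) (w j0 j2) (w j1 j0).
  exists 1%:M; first exact: carrier1.
  by rewrite mul1mx invmx1 mulmx1 [LHS]skew_hat.
move: O0; have wE := skew_hat skw; rewrite wE in w0; move: w0.
set a := w j2 j1; set b := w j0 j2; set c := w j1 j0 => w0 O0.
(* Some cyclic permutation of the coordinates of w has a nonzero last entry. *)
have all_z s : (forall x y z, O x y z -> z * s = 0) -> s = 0.
  move=> H; apply/eqP; apply: contraT => s0.
  have z x : x * s = 0 -> x = 0 by move/eqP; rewrite mulf_eq0 (negbTE s0) orbF => /eqP.
  have O1 := Operm _ _ _ O0; have O2 := Operm _ _ _ O1.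
  have c0 := z _ (H _ _ _ O0); have b0 := z _ (H _ _ _ O1); have a0 := z _ (H _ _ _ O2).
  by move/negP: w0; case; rewrite a0 b0 c0 /hat oppr0 -mx3_0.
(* Adding the equations for (x, y, z) and (- x, - y, z) isolates the last coordinate of l. *)
have r0 : om e1 e2 = 0.
  apply: all_z => x y z Oxyz.
  by have := key _ _ _ Oxyz; have := key _ _ _ (Osign _ _ _ Oxyz); lra.
have q0 : om e3 e1 = 0.
  apply: all_z => x y z /Operm/Operm Oxyz; have := key _ _ _ Oxyz.
  by have := key _ _ _ (Operm _ _ _ (Operm _ _ _ (Osign _ _ _ (Operm _ _ _ Oxyz)))); lra.
have p0 : om e2 e3 = 0.
  by apply: all_z => x y z /Operm /key; rewrite r0 q0; lra.
move=> A B.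
  have dec (X : 'M[R]_3) : X = (1 / 2) *: (X - X^T) + (1 / 2) *: (X + X^T).
    by apply/matrixP => i j; rewrite !mxE; lra.
  have symp (X : 'M[R]_3) : ((1 / 2) *: (X + X^T))^T = (1 / 2) *: (X + X^T).
    by rewrite linearZ /= linearD /= trmxK addrC.
  have skp (X : 'M[R]_3) : (X - X^T)^T = - (X - X^T).
    by rewrite linearB /= trmxK opprB.
  rewrite [A]dec [B]dec lin (om_sym _ _ (symp A)) anti lin (om_sym _ _ (symp B)).
  by rewrite (skew_hat (skp A)) (skew_hat (skp B)) om_hat p0 q0 r0; ring.
Qed.

End SO3Case.

(** * Connected one-dimensional subgroups of SO(3) *)

Section SO3Reduction.
Context {R : realType}.
Local Notation G := (SO R 3).

(** K normalizes the line of [hat 0 0 1], so it maps e3 to e3 or - e3; the entry at (j2, j2) is 1 or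
    -1, hence 1 by connectedness. Conversely the one-parameter subgroup covers the rotations near
    the unit, which generate. *)
Lemma SO3_rotz_classification (K : matrix_group R 3) :
  carrier K `<=` carrier G -> connected (carrier K) ->
  (forall X, lie_algebra K X <-> exists c, X = c *: hat 0 0 1) ->
  forall x, carrier K x <-> exists a b, x = rotz a b /\ a ^+ 2 + b ^+ 2 = 1.
Proof.
move=> KG cK LK.
have LE : lie_algebra K (hat 0 0 1) by apply/LK; exists 1; rewrite scale1r.
have edge z : carrier K z -> [/\ z j0 j2 = 0, z j1 j2 = 0 & z j2 j2 ^+ 2 = 1].
  move=> Kz; have uz := carrier_unit Kz.
  have /LK [c e] := lie_algebra_conj Kz LE.
  have : z *m hat 0 0 1 = c *: hat 0 0 1 *m z by rewrite -e mulmxKV.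
  rewrite {1 2}[z]mx3E scalemx3 !mulmx3 => /mx3_inj [_ _ [e1 e2 _]].
  have z0 : z j2 j0 = 0 by lra.
  have z1 : z j2 j1 = 0 by lra.
  have [[_ _ n1] [_ r2 r3] _] := SO3_rows (KG _ Kz).
  rewrite z0 z1 in n1 r2 r3.
  have n2 : z j2 j2 ^+ 2 = 1 by lra.
  have nz : z j2 j2 != 0 by apply/eqP => h; move/eqP: n2; rewrite h expr0n eq_sym oner_eq0.
  by split=> //; apply: (mulIf nz); lra.
have K1 : carrier K 1%:M := carrier1 K.
have c22 : continuous (fun x : 'M[R]_3 => x j2 j2) by exact: coord_continuous.
have sub x : carrier K x -> exists a b, x = rotz a b /\ a ^+ 2 + b ^+ 2 = 1.
  move=> Kx; have [x0 x1 x2] := edge x Kx; apply: SO3_fix_col => //; first exact: KG.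
  move/eqP: x2; rewrite -subr_eq0 subr_sqr_1 mulf_eq0 subr_eq0 addr_eq0 => /orP[/eqP//|/eqP xN].
  have [|z Kz z0] := connected_value cK c22 Kx K1 (_ : _ <= 0 <= _).
    by rewrite xN mxE /=; lra.
  by have [_ _] := edge z Kz; rewrite z0 expr0n => /esym/eqP; rewrite oner_eq0.
move=> x; split; first exact: sub.
move=> [a [b [-> n1]]].
have [phi op] := LE; have [pD Kp d0] := op.
have cphi i j : continuous (fun t => phi t i j).
  move=> t; apply: differentiable_continuous; apply/derivable1_diffP.
  have /(iffLR (is_derive_mxP _ _ _ _)) := one_parameter_is_derive op t.
  by move=> /(_ i j) [].
have p0 := one_parameter0 op.
have [e e0 cov] : exists2 e : R, 0 < e & forall b, b ^+ 2 < e -> exists2 t, phi t j1 j0 = b & 0 < phi t j0 j0.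
  apply: curve_covers => //; rewrite ?p0 ?mxE //.
  have /(iffLR (is_derive_mxP _ _ _ _)) := d0.
  by move=> /(_ j1 j0); rewrite mxE.
apply: (@norm_one_generated _ (-1) (fun a b => carrier K (rotz a b))).
- by move=> c d f g h1 h2; have := carrierM h1 h2; rewrite rotz_mul.
- exists e => // c d c1 n /cov [t td tc].
  have [f [g [E n2]]] := sub _ (Kp t).
  move: td tc; rewrite E !mxE /= => gd f0; rewrite gd in E n2.
  have /eqP : c ^+ 2 = f ^+ 2 by lra.
  by rewrite eqrXn2 ?ltW // => /eqP ->; rewrite -E; exact: Kp.
- by split; [lra|rewrite ler0N1].
Qed.

(** The tilt serves except at - e3, where 1 / (1 + z) is undefined; a half-turn about the first axis
    replaces it there. *)
Lemma SO3_transitive (x y z : R) : x ^+ 2 + y ^+ 2 + z ^+ 2 = 1 ->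
  exists g : 'M[R]_3, [/\ carrier G g, g j0 j2 = x, g j1 j2 = y & g j2 j2 = z].
Proof.
move=> n1; have [z1|z1] := eqVneq (1 + z) 0.
  have zE : z = -1 by lra.
  have : x ^+ 2 + y ^+ 2 = 0 by rewrite zE in n1; lra.
  move/eqP; rewrite paddr_eq0 ?sqr_ge0 // !sqrf_eq0 => /andP[/eqP x0 /eqP y0].
  exists (mx3 1 0 0 0 (-1) 0 0 0 (-1)); split; rewrite ?mxE /= ?x0 ?y0 ?zE //.
  apply/SO3P; split; last by lra.
  by rewrite trmx3 mulmx3 mx3_1; congr mx3; lra.
exists (tilt x y z (1 + z)^-1); split; rewrite ?mxE //=.
by apply: SO3_tilt => //; rewrite mulVf.
Qed.

(** g takes e3 to a unit vector on the axis of w. Then g^T w g is skew and kills e3, so it is a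
    multiple of [hat 0 0 1]. *)
Lemma SO3_skew_model (w : 'M[R]_3) : w^T = - w -> w != 0 ->
  exists (s : R) (g : 'M[R]_3),
    [/\ s != 0, carrier G g & (s *: w) *m g = g *m hat 0 0 1].
Proof.
move=> skw w0; have wE := skew_hat skw.
set a := w j2 j1 in wE; set b := w j0 j2 in wE; set c := w j1 j0 in wE.
have N0 : 0 < a ^+ 2 + b ^+ 2 + c ^+ 2.
  rewrite lt0r !addr_ge0 ?sqr_ge0 // andbT; apply/eqP => /eqP.
  rewrite paddr_eq0 ?addr_ge0 ?sqr_ge0 // paddr_eq0 ?sqr_ge0 // !sqrf_eq0.
  move=> /andP[/andP[/eqP a0 /eqP b0] /eqP c0].
  by move/negP: w0; apply; rewrite wE a0 b0 c0 /hat oppr0 -mx3_0.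
pose r := Num.sqrt (a ^+ 2 + b ^+ 2 + c ^+ 2).
have r0 : r != 0 by rewrite gt_eqF // sqrtr_gt0.
have r2 : r ^+ 2 = a ^+ 2 + b ^+ 2 + c ^+ 2 by rewrite sqr_sqrtr // ltW.
have [|g [Gg gx gy gz]] := @SO3_transitive (a / r) (b / r) (c / r).
  by rewrite !exprMn -!mulrDl -r2 -exprMn divff // expr1n.
pose w' := g^T *m w *m g.
have ug := carrier_unit Gg.
have wg : w *m g = g *m w' by rewrite /w' -SO_invmx // !mulmxA mulmxV // mul1mx.
have sk' : w'^T = - w' by rewrite /w' !trmx_mul trmxK skw mulNmx mulmxN mulmxA.
have col i : w' i j2 = 0.
  have wg0 k : (w *m g) k j2 = 0.
    rewrite wE [g]mx3E gx gy gz /hat mulmx3.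
    by case: (ord3E k) => ->; rewrite mxE /=; field.
  by rewrite /w' -mulmxA mxE big1 // => k _; rewrite wg0 mulr0.
have w'E : w' = w' j1 j0 *: hat 0 0 1.
  have hE := skew_hat sk'; have z21 : w' j2 j1 = 0.
    have /matrixP/(_ j1 j2) := sk'; rewrite [LHS]mxE [RHS]mxE col oppr0 => e.
    exact: e.
  rewrite z21 (col j0) in hE; rewrite {1}hE.
  by rewrite /hat scalemx3; congr mx3; ring.
set la := w' j1 j0 in w'E.
have la0 : la != 0.
  apply: contraNneq w0 => l0; rewrite -[w](mulmxK ug) wg w'E l0 scale0r mulmx0 mul0mx.
  exact: eqxx.
exists la^-1, g; split=> //; first by rewrite invr_eq0.
by rewrite -scalemxAl wg w'E -scalemxAr scalerA mulVf // scale1r.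
Qed.

Lemma SO3_reduction_hypotheses (H : matrix_group R 3) :
  carrier H `<=` carrier G -> connected (carrier H) -> quotient_dim G H 2 ->
  [/\ infinitesimally_closed G, slice G H &
      exists w, (forall h, carrier H h -> h *m w = w *m h) /\ orbit_rigid G w].
Proof.
move=> HG cH [V [W [LV LW dVW]]].
have exV : exists V : {vspace 'M[R]_3}, forall X, lie_algebra G X <-> X \in V by exists V.
have dW : \dim W = 1%N by move: dVW; rewrite (SO3_dim_lie LV) addn2 => -[].
have [w w0 Ww] := dim1_line dW.
have Hw : lie_algebra H w by apply/LW/Ww; exists 1; rewrite scale1r.
have Gw : lie_algebra G w.
  by have [phi [pD Hp d0]] := Hw; exists phi; split=> // t; exact/HG/Hp.
have skw := SO_lie_skew Gw.
have [s [g [s0 Gg wg]]] := SO3_skew_model skw w0.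
have LH X : lie_algebra H X <-> exists c, X = c *: w by rewrite LW Ww.
have comm (x : 'M[R]_3) : (exists a b, x = rotz a b /\ a ^+ 2 + b ^+ 2 = 1) ->
    x *m hat 0 0 1 = hat 0 0 1 *m x.
  by move=> [a [b [-> _]]]; rewrite !mulmx3; congr mx3; ring.
have [sl cent] := slice_of_model HG cH LH Gg s0 wg SO3_rotz_classification SO3_slice comm.
split=> //; first exact: SO3_infinitesimally_closed.
by exists w; split=> //; apply: SO3_orbit_rigid => //; exact: SO_lie_skew.
Qed.

End SO3Reduction.

Theorem theorem5p1 (R : realType) (n : nat) (G H : matrix_group R n)
    (piG : @bracket R (group_manifold G))
    (pi : @bracket R (quotient_manifold G H))
    (hG : (n = 3%N /\ G = SO R n) \/ (n = 2%N /\ G = SL R n))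
    (hpiG : poisson_lie piG)
    (hpiG0 : nonzero_bivector piG)
    (hHG : carrier H `<=` carrier G)
    (hHclosed : closed (carrier H))
    (hHconnected : connected (carrier H))
    (hdim : quotient_dim G H 2)
    (hpi : coisotropic_homogeneous piG pi) :
  ~ unimodular pi.
Proof.
case: hG => -[en eG]; subst n; subst G.
  have [inf sl [w [cent rig]]] := SO3_reduction_hypotheses hHG hHconnected hdim.
  apply: (coisotropic_not_unimodular hHG inf _ (@SO3_generated R) hdim sl cent rig hpiG hpiG0 hpi).
  by move=> x [].
have [inf sl [w [cent rig]]] := SL2_reduction_hypotheses hHG hHconnected hdim.
by apply: (coisotropic_not_unimodular hHG inf _ (@SL2_generated R) hdim sl cent rig hpiG hpiG0 hpi).
Qed.
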